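(* Let $N\ge 3$, $p,q\ge 1$, $0\le\alpha<N$ and $\beta>\alpha-N$. Consider the inequality $$\Delta^2 u-\lambda\Delta u\ \ge\ (K_{\alpha,\beta}*u^p)\,u^q\quad\text{in }\mathbb{R}^N. \qquad (P^+)$$ (i) If $\beta<-2$, then there exists $\lambda>0$ such that $(P^+)$ has a nontrivial non-negative solution if and only if $$p\ge\frac{N-\alpha}{N-2},\quad q\ge\frac{N-\alpha}{N-2}\quad\text{and}\quad p+q\ge\frac{2N-\alpha}{N-2}.$$ (ii) If $\beta>-1+\frac1q$, then there exists $\lambda>0$ such that $(P^+)$ has a nontrivial non-negative solution if and only if $$p>\frac{N-\alpha}{N-2},\quad q>\frac{N-\alpha}{N-2}\quad\text{and}\quad p+q>\frac{2N-\alpha}{N-2}.$$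
   Context: $K_{\alpha,\beta}(x)=|x|^{-\alpha}\log^{\beta}(1+|x|)$ for $x\in\mathbb{R}^N\setminus\{0\}$, where $\log^\beta(s)=(\log s)^\beta$, and $(K_{\alpha,\beta}*u^p)(x)=\int_{\mathbb{R}^N}K_{\alpha,\beta}(x-y)\,u(y)^p\,dy$. A non-negative solution of the inequality is a function $u\in C^4(\mathbb{R}^N)$ such that $u(x)\ge 0$ and $(K_{\alpha,\beta}*u^p)(x)<\infty$ for all $x\in\mathbb{R}^N$, and the inequality holds pointwise in $\mathbb{R}^N$. Nontrivial means $u\not\equiv 0$. *)

(* Defs.v *)
From HB Require Import structures.
From mathcomp Require Import all_boot all_order all_algebra.
From mathcomp Require Import all_classical all_reals all_analysis.

Set Implicit Arguments.
Unset Strict Implicit.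
Unset Printing Implicit Defensive.

Import Order.TTheory GRing.Theory Num.Theory.
Import numFieldNormedType.Exports.
Local Open Scope classical_set_scope.
Local Open Scope ring_scope.

(* R^n is 'rV[R]_n for topology and differentiation.  Its library norm `|x| is
   the sup norm, hence the separate Euclidean norm below. *)
Definition enorm (R : realType) (n : nat) (x : 'rV[R]_n) : R :=
  Num.sqrt (\sum_(i < n) x 0 i ^+ 2).

(* The n-dimensional Lebesgue measure, built as the n-fold product of
   lebesgue_measure.  It lives on n.-tuple (measurableTypeR R), whose
   sigma-algebra in the library is the product of the Borel ones, that is, the
   Borel sigma-algebra of R^n. *)
Section lebesgue_measure_tuple.
Context {R : realType}.

Definition tuple_of_pair (n : nat)
    (x : measurableTypeR R * n.-tuple (measurableTypeR R)) :
    n.+1.-tuple (measurableTypeR R) :=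
  [the n.+1.-tuple (measurableTypeR R) of x.1 :: x.2].

Lemma measurable_tuple_of_pair (n : nat) :
  measurable_fun [set: measurableTypeR R * n.-tuple (measurableTypeR R)]
    (@tuple_of_pair n).
Proof. by apply: measurable_cons. Qed.

Section cons_measure.
Variables (n : nat)
  (mu : {sigma_finite_measure set (n.-tuple (measurableTypeR R)) -> \bar R}).

Definition cons_measure : set (n.+1.-tuple (measurableTypeR R)) -> \bar R :=
  pushforward (lebesgue_measure \x mu)%E (@tuple_of_pair n).

Let measurable_preimage A : measurable A ->
  measurable (@tuple_of_pair n @^-1` A).
Proof.
by move=> mA; rewrite -[X in measurable X]setTI; exact: measurable_tuple_of_pair.
Qed.

Let cons_measure0 : cons_measure set0 = 0%E.
Proof. by rewrite /cons_measure /pushforward preimage_set0 measure0. Qed.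

Let cons_measure_ge0 A : (0 <= cons_measure A)%E.
Proof. by rewrite /cons_measure /pushforward; exact: measure_ge0. Qed.

Let cons_measure_sigma_additive : semi_sigma_additive cons_measure.
Proof.
move=> F mF tF mUF; rewrite /cons_measure /pushforward preimage_bigcup.
apply: measure_semi_sigma_additive.
- by move=> i; exact: measurable_preimage.
- apply/trivIsetP => /= i j _ _ ij; rewrite -preimage_setI.
  by move/trivIsetP : tF => /(_ _ _ _ _ ij) ->//; rewrite preimage_set0.
- by rewrite -preimage_bigcup; exact: measurable_preimage.
Qed.

HB.instance Definition _ := isMeasure.Build _ _ _ cons_measure
  cons_measure0 cons_measure_ge0 cons_measure_sigma_additive.

Let cons_measure_sigma_finite : sigma_finite setT cons_measure.
Proof.
have /sigma_finiteP[F [TF ndF Foo]] := sigma_finiteT (@lebesgue_measure R).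
have /sigma_finiteP[G [TG ndG Goo]] := sigma_finiteT mu.
exists (fun k => [set t | F k (thead t) /\ G k [tuple of behead t]]).
  apply/seteqP; split=> // t _ /=.
  have : [set: measurableTypeR R] (thead t) by [].
  have : [set: n.-tuple (measurableTypeR R)] [tuple of behead t] by [].
  rewrite TF TG => -[k _ Gk] [j _ Fj]; exists (maxn j k) => //=; split.
    by move: Fj; exact/subsetPset/ndF/leq_maxl.
  by move: Gk; exact/subsetPset/ndG/leq_maxr.
move=> k; have [mF Fk] := Foo k; have [mG Gk] := Goo k; split.
  apply: measurableI.
    rewrite -[X in measurable X]setTI; exact: measurable_tnth.
  rewrite -[X in measurable X]setTI; exact: measurable_behead.
rewrite /cons_measure /pushforward.
rewrite [X in (_ X < _)%E](_ : _ = F k `*` G k); last first.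
  have beheadK (x : R) (t : n.-tuple (measurableTypeR R)) :
    [tuple of behead (tuple_of_pair (x, t))] = t by exact: val_inj.
  by apply/seteqP; split=> -[x t] /=; rewrite beheadK.
by rewrite product_measure1E// lte_mul_pinfty// ge0_fin_numE.
Qed.

HB.instance Definition _ := Measure_isSigmaFinite.Build _ _ _ cons_measure
  cons_measure_sigma_finite.

End cons_measure.

Fixpoint lebesgue_measure_tuple (n : nat) :
    {sigma_finite_measure set (n.-tuple (measurableTypeR R)) -> \bar R} :=
  match n with
  | 0%N => [the {sigma_finite_measure set _ -> \bar R} of \d_([tuple])]
  | n'.+1 => [the {sigma_finite_measure set _ -> \bar R} of
               cons_measure (lebesgue_measure_tuple n')]
  end.

Lemma lebesgue_measure_tuple_box (n : nat)
    (A : 'I_n -> set (measurableTypeR R)) :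
  (forall i, measurable (A i)) ->
  lebesgue_measure_tuple n [set t | forall i, A i (tnth t i)] =
  (\prod_(i < n) lebesgue_measure (A i))%E.
Proof.
elim: n A => [|n ih] A mA.
  rewrite big_ord0 /= diracE mem_set//= => -[] //.
rewrite big_ord_recl -ih//= /cons_measure /pushforward.
rewrite -product_measure1E//; last first.
  rewrite [X in measurable X](_ : _ =
    \bigcap_(i in [set: 'I_n]) ((fun t => tnth t i) @^-1` (A (lift ord0 i)))).
    apply: fin_bigcap_measurable => // i _.
    rewrite -[X in measurable X]setTI; exact: measurable_tnth.
  by apply/seteqP; split => [t At i _|t At i] /=; [exact: At|exact: At i I].
congr (_ _); apply/seteqP; split => [[x t] /= At|[x t] /= [Ax At] i].
  by split => [|i]; [exact: (At ord0)|have := At (lift ord0 i); rewrite tnthS].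
case: (unliftP ord0 i) => [j ->|->]; first by rewrite tnthS; exact: At.
exact: Ax.
Qed.

End lebesgue_measure_tuple.

Definition rV_of_tuple (R : realType) (n : nat)
  (t : n.-tuple (measurableTypeR R)) : 'rV[R]_n := \row_i tnth t i.

Definition integral_rV (R : realType) (n : nat) (f : 'rV[R]_n -> \bar R) :
  \bar R := (\int[lebesgue_measure_tuple n]_t f (rV_of_tuple t))%E.

Section calculus.
Context {R : realType} {n : nat}.
Implicit Type f : 'rV[R]_n -> R.

Definition partial (i : 'I_n) f : 'rV[R]_n -> R :=
  fun x => 'D_(delta_mx 0 i) f x.

Fixpoint classC (k : nat) f : Prop :=
  continuous f /\
  match k with
  | 0%N => True
  | k'.+1 => forall i : 'I_n,
      (forall x, derivable f x (delta_mx 0 i)) /\ classC k' (partial i f)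
  end.

Definition laplacian f : 'rV[R]_n -> R :=
  fun x => \sum_(i < n) partial i (partial i f) x.

Definition bilaplacian f : 'rV[R]_n -> R := laplacian (laplacian f).

End calculus.

(* The value at x = 0, where the kernel is not defined, is irrelevant: it is
   only used under the integral sign. *)
Definition Kab (R : realType) (n : nat) (alpha beta : R) (x : 'rV[R]_n) : R :=
  enorm x `^ (- alpha) * ln (1 + enorm x) `^ beta.

Definition Kconv (R : realType) (n : nat) (alpha beta p : R)
    (u : 'rV[R]_n -> R) (x : 'rV[R]_n) : \bar R :=
  integral_rV (fun y => (Kab alpha beta (x - y) * u y `^ p)%:E).

Definition nonneg_solution (R : realType) (n : nat)
    (alpha beta p q lambda : R) (u : 'rV[R]_n -> R) : Prop :=
  [/\ classC 4 u,
      forall x, 0 <= u x,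
      forall x, (Kconv alpha beta p u x < +oo)%E &
      forall x, (Kconv alpha beta p u x * (u x `^ q)%:E <=
                 (bilaplacian u x - lambda * laplacian u x)%:E)%E].

Definition nontrivial (R : realType) (n : nat) (u : 'rV[R]_n -> R) : Prop :=
  exists x, u x != 0.

(* Main.v *)
Require Import Defs.
From mathcomp Require Import all_boot all_order all_algebra.
From mathcomp Require Import all_classical all_reals all_analysis.
From mathcomp Require Import measurable_realfun ring lra.
Set Implicit Arguments.
Unset Strict Implicit.
Unset Printing Implicit Defensive.
Import Order.TTheory GRing.Theory Num.Theory.
Import numFieldNormedType.Exports.
Local Open Scope classical_set_scope.
Local Open Scope ring_scope.

(* Write [w = lambda u - Delta u] and [D = N - 2], so that the inequality reads
   [- Delta w >= (K * u^p) u^q >= 0].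

   Necessity.  Finiteness of [K * u^p] makes the averages of [u] over large
   annuli small, which forces the superharmonic function [w] to be nonnegative.
   Hence [w >= c |x|^(-D)], and [u] is bounded below by the minimum of [w] over
   unit balls.  If [M(R)] is the minimum of [w] on the sphere of radius [R], then
   comparison on a ball of radius [R / 4] gives [M(R) >= c R^2 inf (K * u^p) u^q],
   where [K * u^p] is at least [c R^(-alpha) (ln R)^beta] times [1] (mass near the
   origin) or [R^N M(R)^p] (mass near the sphere).  With [M(R) >= c R^(-D)] this is
   contradictory unless [q] and [p + q] satisfy the bounds.  In a critical case
   the same lower bound on [- Delta w] improves the estimate to
   [w >= c R^(-D) (ln R)^(beta + 1)], which rules out [beta > -1 + 1/q].  The bound
   on [p] is the finiteness of [K * u^p] for [u >= c |x|^(-D)].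

   Sufficiency.  With [s = e + |x|^2], [m = D / 2] and [delta = - 2 - beta > 0] take
   [u = k (M s^(-m) - s^(-m) (ln s)^(-delta))].  Then [- Delta u] is bounded below by
   a multiple of [s^(-N/2) (ln s)^(beta + 1)], [Delta^2 u] is of lower order and is
   absorbed by a large [lambda], and [(K * u^p) u^q] has at most the same order, with
   a constant [k^(p+q)].  Under strict inequalities [alpha] can be decreased a
   little and [beta] replaced by [-3]. *)

(** * Directional derivatives and the Euclidean norm *)

Section pointwise_derivatives.
Context {R : realType} {V : normedModType R}.
Implicit Types (f g : V -> R) (x v : V).

(** Only [w] is superharmonic, [u] need not be; lower bounds are therefore proved for [w] and
    carried over to [u] on unit balls by a paraboloid. Means of [w] are taken against C^2 weights
    supported in annuli, so that Green's formula moves the derivatives of [laplacian u] onto the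
    weight and only averages of [u] itself have to be small. The thresholds come from the
    logarithms. In a critical case the powers of R cancel in M(R) >= c R^2 inf (K * u^p) u^q, and
    inserting w >= c R^(-D) (ln R)^(beta + 1) leaves (ln R)^((beta + 1)(Q + q) - 1), where Q is 0 or
    p according to the bound used for K * u^p; for Q = 0 this is unbounded exactly when beta > -1 +
    1/q. In the other direction the convolution gains one logarithm over the kernel, hence the power
    beta + 1. The choice delta + 1 = -(beta + 1) matches it with the source created by s^(-m) (ln
    s)^(-delta), and delta > 0 means beta < -2. Since p + q > 1, a small factor k then beats every
    constant. *)

Lemma isdD f g x v df dg : is_derive x v f df -> is_derive x v g dg ->
  is_derive x v (fun y => f y + g y) (df + dg).
Proof. by move=> hf hg; exact: is_deriveD. Qed.

Lemma isdN f x v df : is_derive x v f df -> is_derive x v (fun y => - f y) (- df).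
Proof. by move=> hf; exact: is_deriveN. Qed.

Lemma isdB f g x v df dg : is_derive x v f df -> is_derive x v g dg ->
  is_derive x v (fun y => f y - g y) (df - dg).
Proof. by move=> hf hg; exact: is_deriveB. Qed.

Lemma isdM f g x v df dg : is_derive x v f df -> is_derive x v g dg ->
  is_derive x v (fun y => f y * g y) (f x * dg + g x * df).
Proof. by move=> hf hg; exact: is_deriveM. Qed.

Lemma isdZ (k : R) f x v df : is_derive x v f df ->
  is_derive x v (fun y => k * f y) (k * df).
Proof. by move=> hf; exact: is_deriveZ. Qed.

Lemma isd_cst (k : R) x v : is_derive x v (fun _ => k) 0.
Proof. exact: is_derive_cst. Qed.

Lemma isd_sum n (h : 'I_n -> V -> R) x v (dh : 'I_n -> R) :
  (forall i, is_derive x v (h i) (dh i)) ->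
  is_derive x v (fun y => \sum_(i < n) h i y) (\sum_(i < n) dh i).
Proof.
move=> H; rewrite (_ : (fun y => _) = \sum_(i < n) h i); first exact: is_derive_sum.
by apply/funext => y; rewrite fct_sumE.
Qed.

(* Directional derivatives are derivatives along a line, which gives a chain
   rule that only requires directional differentiability of the inner map. *)
Lemma is_derive_lineP f x v df :
  is_derive x v f df <-> is_derive (0 : R) 1 (fun h : R => f (h *: v + x)) df.
Proof.
have E : 'D_1 (fun h : R => f (h *: v + x)) 0 = 'D_v f x.
  rewrite /derive; congr (lim (_ @ 0^')); apply/funext => h /=.
  by rewrite addr0 scale0r add0r [_%:A]mulr1.
split=> -[d <-].
  by apply: DeriveDef; [move/derivable1P: d|exact: E].
by apply: DeriveDef; [apply/derivable1P|rewrite E].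
Qed.

Lemma isd_comp (h : R -> R) f x v dh df :
  is_derive x v f df -> is_derive (f x) 1 h dh ->
  is_derive x v (fun y => h (f y)) (dh * df).
Proof.
move=> /is_derive_lineP hf hh; apply/is_derive_lineP.
by apply: (@is_derive1_comp _ h (fun t : R => f (t *: v + x))); rewrite scale0r add0r.
Qed.

Lemma isd_unique f x v a b :
  is_derive x v f a -> is_derive x v f b -> a = b.
Proof. by move=> [_ <-] [_ <-]. Qed.

End pointwise_derivatives.

Section pointwise_continuity.
Context {R : realType} {T : topologicalType}.
Implicit Types f g : T -> R.

Lemma contD f g : continuous f -> continuous g -> continuous (fun x => f x + g x).
Proof. by move=> cf cg x; apply: continuousD; [exact: cf|exact: cg]. Qed.

Lemma contB f g : continuous f -> continuous g -> continuous (fun x => f x - g x).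
Proof. by move=> cf cg x; apply: continuousB; [exact: cf|exact: cg]. Qed.

Lemma contM f g : continuous f -> continuous g -> continuous (fun x => f x * g x).
Proof. by move=> cf cg x; apply: continuousM; [exact: cf|exact: cg]. Qed.

End pointwise_continuity.

Lemma continuous_sumr (R : realType) (T : topologicalType) n (h : 'I_n -> T -> R) :
  (forall i, continuous (h i)) -> continuous (fun y => \sum_(i < n) h i y).
Proof.
move=> H; rewrite (_ : (fun y => _) = \sum_(i < n) h i); last first.
  by apply/funext => y; rewrite fct_sumE.
elim/big_ind : _ => [|f g cf cg|i _]; [exact: cst_continuous| |exact: H].
by move=> x; apply: continuousD; [exact: cf|exact: cg].
Qed.

Section sqnorm.
Context {R : realType} {n : nat}.
Implicit Types (f g : 'rV[R]_n -> R) (x c : 'rV[R]_n).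

Definition dirv (i : 'I_n) : 'rV[R]_n := delta_mx 0 i.

Definition sqn x : R := \sum_(i < n) x 0 i ^+ 2.

Lemma sqn_ge0 x : 0 <= sqn x.
Proof. by apply: sumr_ge0 => i _; exact: sqr_ge0. Qed.

Lemma enorm_ge0 x : 0 <= enorm x. Proof. exact: sqrtr_ge0. Qed.

Lemma sqr_enorm x : enorm x ^+ 2 = sqn x.
Proof. by rewrite sqr_sqrtr// sqn_ge0. Qed.

Lemma enormN x : enorm (- x) = enorm x.
Proof. by rewrite /enorm; congr Num.sqrt; apply: eq_bigr => i _; rewrite mxE sqrrN. Qed.

Lemma sqn0 : sqn 0 = 0.
Proof. by rewrite /sqn big1// => i _; rewrite mxE expr0n. Qed.

Lemma coord_le_enorm x i : `|x 0 i| <= enorm x.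
Proof.
rewrite -sqrtr_sqr ler_sqrt ?sqn_ge0// /sqn (bigD1 i)//= lerDl.
by apply: sumr_ge0 => j _; exact: sqr_ge0.
Qed.

Lemma enorm_le_sum x : enorm x <= \sum_(i < n) `|x 0 i|.
Proof.
have s0 : 0 <= \sum_(i < n) `|x 0 i| by apply: sumr_ge0.
rewrite -(ger0_norm s0) -sqrtr_sqr ler_sqrt ?sqr_ge0// expr2 mulr_suml.
apply: ler_sum => i _; rewrite -real_normK ?num_real// expr2 ler_wpM2l//.
by rewrite (bigD1 i)//= lerDl sumr_ge0.
Qed.

Lemma enorm_triangle x y : enorm (x + y) <= enorm x + enorm y.
Proof.
have s0 : 0 <= enorm x + enorm y by rewrite addr_ge0// enorm_ge0.
rewrite -(ger0_norm s0) -sqrtr_sqr ler_sqrt ?sqr_ge0// sqrrD !sqr_enorm.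
have -> : \sum_(i < n) (x + y) 0 i ^+ 2 =
    sqn x + (\sum_(i < n) x 0 i * y 0 i) *+ 2 + sqn y.
  rewrite /sqn -sumrMnl -!big_split/=; apply: eq_bigr => i _.
  by rewrite mxE sqrrD.
rewrite lerD2r lerD2l lerMn2r orFb.
(* Cauchy-Schwarz via the nonnegative sum of (x_i b - y_i a)^2 *)
set a := enorm x; set b := enorm y.
have a0 : 0 <= a := enorm_ge0 x. have b0 : 0 <= b := enorm_ge0 y.
have H : 0 <= a * b * (a * b - \sum_(i < n) x 0 i * y 0 i).
  have : 0 <= \sum_(i < n) (x 0 i * b - y 0 i * a) ^+ 2.
    by apply: sumr_ge0 => i _; exact: sqr_ge0.
  rewrite (_ : \sum_(i < n) _ =
    b ^+ 2 * sqn x - (a * b) * (\sum_(i < n) x 0 i * y 0 i) *+ 2 + a ^+ 2 * sqn y).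
    rewrite -!sqr_enorm -/a -/b => ?; nra.
  rewrite /sqn !mulr_sumr -sumrMnl -sumrB -big_split/=.
  by apply: eq_bigr => i _; ring.
have [a00|an0] := eqVneq a 0.
  rewrite big1 ?mulr_ge0// => i _.
  have := coord_le_enorm x i; rewrite -/a a00 normr_le0 => /eqP ->.
  by rewrite mul0r.
have [b00|bn0] := eqVneq b 0.
  rewrite big1 ?mulr_ge0// => i _.
  have := coord_le_enorm y i; rewrite -/b b00 normr_le0 => /eqP ->.
  by rewrite mulr0.
by move: H; rewrite pmulr_rge0 ?subr_ge0// mulr_gt0// lt_neqAle eq_sym ?an0 ?bn0.
Qed.

Lemma enormB_ge x y : enorm x - enorm y <= enorm (x - y).
Proof. by rewrite lerBlDr -{1}(subrK y x) enorm_triangle. Qed.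

Lemma isd_coord (i j : 'I_n) x : is_derive x (dirv i) (fun y : 'rV[R]_n => y 0 j) ((j == i)%:R).
Proof.
apply/is_derive_lineP.
rewrite (_ : (fun h : R => _) = fun h : R => (j == i)%:R * h + x 0 j); last first.
  by apply/funext => h; rewrite !mxE eqxx /= mulrC.
apply: (is_derive_eq (isdD (isdZ _ (is_derive_id _ _)) (isd_cst _ _ _))).
by rewrite mulr1 addr0.
Qed.

Lemma isd_sqn (i : 'I_n) x c :
  is_derive x (dirv i) (fun y => sqn (y - c)) (2 * (x - c) 0 i).
Proof.
pose h (j : 'I_n) (y : 'rV[R]_n) := (y 0 j - c 0 j) * (y 0 j - c 0 j).
rewrite (_ : (fun y => _) = fun y => \sum_(j < n) h j y); last first.
  by apply/funext => y; apply: eq_bigr => j _; rewrite !mxE expr2.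
pose e (j : 'I_n) : R := (j == i)%:R.
have -> : 2 * (x - c) 0 i = \sum_(j < n)
    ((x 0 j - c 0 j) * (e j - 0) + (x 0 j - c 0 j) * (e j - 0)).
  rewrite (bigD1 i)//= big1 => [|j /negbTE ji]; rewrite /e ?ji ?subr0 ?mulr0 ?addr0//.
  by rewrite eqxx !mxE !mulr1 mulr_natl mulr2n.
apply: isd_sum => j.
by apply: isdM; exact: (isdB (isd_coord i j x) (isd_cst (c 0 j) x _)).
Qed.

Lemma continuous_coord (j : 'I_n) : continuous (fun y : 'rV[R]_n => y 0 j).
Proof. move=> x; exact: coord_continuous. Qed.

Lemma continuous_sqn c : continuous (fun y : 'rV[R]_n => sqn (y - c)).
Proof.
rewrite (_ : (fun y => _) = fun y : 'rV[R]_n => \sum_(j < n) (y 0 j - c 0 j) ^+ 2).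
  apply: continuous_sumr => j x.
  apply: (@continuous_comp _ _ _ (fun y : 'rV[R]_n => y 0 j - c 0 j) (fun t => t ^+ 2)).
    apply: continuousB; [exact: continuous_coord|exact: cst_continuous].
  exact: exprn_continuous.
by apply/funext => y; apply: eq_bigr => j _; rewrite !mxE.
Qed.

Lemma continuous_enorm c : continuous (fun y : 'rV[R]_n => enorm (y - c)).
Proof.
move=> x; apply: (@continuous_comp _ _ _ (fun y : 'rV[R]_n => sqn (y - c)) Num.sqrt).
  exact: continuous_sqn.
exact: sqrt_continuous.
Qed.

End sqnorm.
(** * The Laplacian and the minimum principle *)

Section laplacian_at_a_point.
Context {R : realType} {n : nat}.
Implicit Types (f g : 'rV[R]_n -> R) (x c : 'rV[R]_n).

(** Relational and pointwise: first derivatives near [x] and second derivatives at [x] suffice. This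
    lets a barrier that is smooth only outside a ball be compared with [w] at a point. *)
Definition is_lap f x (L : R) := exists (D : 'I_n -> 'rV[R]_n -> R) (H : 'I_n -> R),
  [/\ forall i, \forall y \near x, is_derive y (dirv i) f (D i y),
      forall i, is_derive x (dirv i) (D i) (H i) & L = \sum_(i < n) H i].

Lemma is_lap_laplacian f x L : is_lap f x L -> laplacian f x = L.
Proof.
move=> [D [H [fD DH ->]]]; apply: eq_bigr => i _.
have [_ <-] := DH i; apply: near_eq_derive.
by apply: filterS (fD i) => y [_ <-].
Qed.

Lemma is_lapD f g x L M : is_lap f x L -> is_lap g x M ->
  is_lap (fun y => f y + g y) x (L + M).
Proof.
move=> [D [H [fD DH ->]]] [E [K [gE EK ->]]].
exists (fun i y => D i y + E i y), (fun i => H i + K i); split => [i|i|].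
- by near=> y; apply: isdD; near: y; [exact: fD|exact: gE].
- exact: isdD.
- by rewrite big_split.
Unshelve. all: by end_near. Qed.

Lemma is_lapZ (k : R) f x L : is_lap f x L -> is_lap (fun y => k * f y) x (k * L).
Proof.
move=> [D [H [fD DH ->]]].
exists (fun i y => k * D i y), (fun i => k * H i); split => [i|i|].
- by near=> y; apply: isdZ; near: y; exact: fD.
- exact: isdZ.
- by rewrite mulr_sumr.
Unshelve. all: by end_near. Qed.

Lemma is_lapB f g x L M : is_lap f x L -> is_lap g x M ->
  is_lap (fun y => f y - g y) x (L - M).
Proof.
move=> hf hg; rewrite -mulN1r (_ : (fun y => _) = fun y => f y + -1 * g y).
  exact: is_lapD hf (is_lapZ _ hg).
by apply/funext => y; rewrite mulN1r.
Qed.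

Lemma is_lap_cst (k : R) x : is_lap (fun _ => k) x 0.
Proof.
exists (fun _ _ => 0), (fun _ => 0); split => [i|i|]; last by rewrite big1.
- by near=> y; exact: isd_cst.
- exact: isd_cst.
Unshelve. all: by end_near. Qed.

(** The variable s = |x - c|^2 replaces |x - c| because it is a polynomial: the centre needs no
    separate treatment. *)
Lemma is_lap_radial (h h1 : R -> R) (h2 : R) c x :
  (\forall s \near sqn (x - c), is_derive (s : R) (1 : R) h (h1 s)) ->
  is_derive (sqn (x - c)) 1 h1 h2 ->
  is_lap (fun y => h (sqn (y - c))) x
    (4 * sqn (x - c) * h2 + 2 * n%:R * h1 (sqn (x - c))).
Proof.
move=> hh1 h1h2; set s := sqn (x - c).
exists (fun i y => h1 (sqn (y - c)) * (2 * (y 0 i - c 0 i))),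
  (fun i => h1 s * (2 * (1 - 0)) + (2 * (x 0 i - c 0 i)) * (h2 * (2 * (x - c) 0 i))).
split => [i|i|].
- have : \forall y \near x, is_derive (sqn (y - c)) 1 h (h1 (sqn (y - c))).
    by have := @continuous_sqn _ _ c x; move=> /(_ _ hh1).
  apply: filterS => y hy.
  have -> : y 0 i - c 0 i = (y - c) 0 i by rewrite !mxE.
  exact: (isd_comp (isd_sqn i y c) hy).
- apply: isdM; first exact: (isd_comp (isd_sqn i x c) h1h2).
  apply/isdZ/(isdB _ (isd_cst _ _ _)).
  by have := isd_coord i i x; rewrite eqxx.
- rewrite big_split/= subr0 sumr_const card_ord.
  rewrite [RHS]addrC; congr (_ + _); last by rewrite -mulr_natr mulr1; ring.
  rewrite [in LHS]/s /sqn !mulr_sumr mulr_suml; apply: eq_bigr => i _.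
  by rewrite !mxE; ring.
Qed.

End laplacian_at_a_point.

Section second_derivative_test.
Context {R : realType}.

Lemma second_derivative_ge0 (g d : R -> R) (H : R) :
  (\forall t \near (0 : R), is_derive (t : R) (1 : R) g (d t)) -> is_derive (0 : R) (1 : R) d H ->
  (\forall t \near (0 : R), g 0 <= g t) -> 0 <= H.
Proof.
move=> gd dH gmin; rewrite leNgt; apply/negP => H0.
have d0 : d 0 = 0.
  have /nbhs_ballP[e /= e0 He] : \forall t \near (0 : R), is_derive (t : R) (1 : R) g (d t) /\ g 0 <= g t.
    by near=> t; split; near: t.
  have Hin t : t \in `](- e), e[%R -> is_derive (t : R) (1 : R) g (d t) /\ g 0 <= g t.
    by rewrite in_itv /= -ltr_norml => te; apply: He; rewrite /ball /= sub0r normrN.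
  have z : (0 : R) \in `](- e), e[%R by rewrite in_itv/= oppr_lt0 e0.
  have := @derive1_at_min _ g (- e) e 0 _ _ z _.
  have [g0 _] := Hin _ z.
  move=> /(_ _ _ _) K; apply: (isd_unique g0); apply: K.
  - by rewrite -subr_ge0 opprK addr_ge0// ltW.
  - by move=> t /Hin[[]].
  - by move=> t /Hin[].
(* the difference quotients of d at 0 are negative, so d < 0 right of 0 *)
have dneg : \forall t \near (0 : R)^'+, d t < 0.
  have [dd dE] := dH.
  have : (fun h : R => h^-1 *: (d (h *: 1 + 0) - d 0)) @ 0^' --> H.
    by rewrite -dE; exact: dd.
  move/cvgrPdist_lt => /(_ (- H)); rewrite oppr_gt0 => /(_ H0).
  move=> /nbhs_ballP[e /= e0 He].
  exists e => //= t te t0.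
  have := He t te (lt0r_neq0 t0); rewrite d0 subr0 addr0 [_%:A]mulr1.
  rewrite ltr_norml => /andP[+ _].
  by rewrite opprK ltrBrDl gtrDr pmulr_rlt0 ?invr_gt0.
have [t [t0 [gdt [gt dt]]]] : exists t : R, 0 < t /\
    (forall s, 0 <= s <= t -> is_derive (s : R) (1 : R) g (d s)) /\ g 0 <= g t /\
    (forall s, 0 < s <= t -> d s < 0).
  have /nbhs_ballP[e /= e0 He] : \forall t \near (0 : R), is_derive (t : R) (1 : R) g (d t) /\ g 0 <= g t.
    by near=> t; split; near: t.
  move: dneg => -[e' /= e'0 He'].
  pose m := Num.min e e'.
  have m0 : 0 < m by rewrite lt_min e0.
  have me s : 0 <= s <= m / 2 -> `|0 - s| < m.
    by move=> /andP[s0 sm]; rewrite sub0r normrN ger0_norm//; lra.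
  exists (m / 2); split; first lra; split=> [s hs|].
    by apply: (He _ _).1; rewrite /ball/= (lt_le_trans (me _ hs))// ge_min lexx.
  split.
    by apply: (He _ _).2; rewrite /ball/= (lt_le_trans (me _ _)) ?ge_min ?lexx//; lra.
  move=> s /andP[s0 sm]; apply: He' => //; rewrite /ball/= (lt_le_trans (me _ _))//.
    by rewrite (ltW s0).
  by rewrite ge_min lexx orbT.
have [] := @MVT _ g d 0 t t0.
- by move=> s; rewrite in_itv/= => /andP[s0 st]; apply: gdt; rewrite !ltW.
- apply: derivable_within_continuous => s; rewrite in_itv/= => st.
  by have [] := gdt s st.
move=> s; rewrite in_itv/= subr0 => /andP[s0 st] E.
have : d s < 0 by apply: dt; rewrite s0 ltW.
by move=> ds; move: gt; rewrite -subr_ge0 E leNgt nmulr_rlt0 ?t0.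
Unshelve. all: by end_near. Qed.

(** The second derivative test along each coordinate line through [x], summed over the
    directions. *)
Lemma is_lap_min n (f : 'rV[R]_n -> R) x L : is_lap f x L ->
  (\forall y \near x, f x <= f y) -> 0 <= L.
Proof.
move=> [D [H [fD DH ->]]] fmin; apply: sumr_ge0 => i _.
have ct : continuous (fun t : R => t *: dirv i + x).
  move=> t; apply: cvgD; last exact: cvg_cst.
  exact: scalel_continuous.
have cl : (t *: dirv i + x) @[t --> (0 : R)] --> x.
  by have := ct 0; rewrite /continuous_at scale0r add0r.
apply: (@second_derivative_ge0 (fun t => f (t *: dirv i + x)) (fun t => D i (t *: dirv i + x))).
- have near_fD : \forall t \near (0 : R),
      is_derive (t *: dirv i + x) (dirv i) f (D i (t *: dirv i + x)).
    exact: cl (fD i).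
  apply: filterS near_fD => t /= /is_derive_lineP [d <-].
  have sh : (fun h : R => f (h *: dirv i + (t *: dirv i + x))) =
      (fun s => f (s *: dirv i + x)) \o shift t.
    by apply/funext => h /=; rewrite scalerDl addrA.
  apply/is_derive_lineP.
  rewrite (_ : (fun h : R => _) = fun h : R => f (h *: dirv i + (t *: dirv i + x))).
    exact: DeriveDef.
  by apply/funext => h /=; rewrite [h *: 1]mulr1 scalerDl addrA.
- by move/is_derive_lineP: (DH i).
- have near_fmin : \forall t \near (0 : R), f x <= f (t *: dirv i + x).
    exact: cl fmin.
  by apply: filterS near_fmin => t /=; rewrite scale0r add0r.
Qed.

End second_derivative_test.

Section minimum_principle.
Context {R : realType} {n : nat}.

(** At a negative minimum the Laplacian would be both nonnegative and, by hypothesis, strictly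
    negative. Boundary points are excluded because a point with a negative value is required to be
    interior. *)
Lemma minimum_principle (g : 'rV[R]_n -> R) (D : set 'rV[R]_n) :
  compact D -> {within D, continuous g} ->
  (forall x, D x -> g x < 0 ->
     nbhs x D /\ exists2 L : R, is_lap g x L & L < 0) ->
  forall x, D x -> 0 <= g x.
Proof.
move=> cD cg H x Dx.
have [|z] := @EVT_min_rV R n g D _ cD cg; first by exists x.
rewrite inE => Dz gz.
suff gz0 : 0 <= g z by apply: (le_trans gz0); apply: gz; rewrite inE.
rewrite leNgt; apply/negP => gz0.
have [nD [L lL L0]] := H _ Dz gz0.
suff : 0 <= L by rewrite leNgt L0.
apply: is_lap_min lL _; apply: filterS nD => y Dy.
by apply: gz; rewrite inE.
Qed.

End minimum_principle.

Section classC.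
Context {R : realType} {n : nat}.
Implicit Types (f g : 'rV[R]_n -> R).

Lemma classC_continuous k f : classC k f -> continuous f.
Proof. by case: k => [|k] []. Qed.

Lemma classCS k f : classC k.+1 f -> classC k f.
Proof.
elim: k f => [|k IH] f [cf Hf]; split=> // i.
by have [d c] := Hf i; split=> //; exact: IH.
Qed.

Lemma classC_derive k f i x : classC k.+1 f ->
  is_derive x (dirv i) f (partial i f x).
Proof. by move=> [_ /(_ i)[d _]]; exact/derivableP. Qed.

Lemma classC_partial k f i : classC k.+1 f -> classC k (partial i f).
Proof. by move=> [_ /(_ i)[_ ]]. Qed.

Lemma classC_lap f x : classC 2 f -> is_lap f x (laplacian f x).
Proof.
move=> cf; exists (fun i => partial i f), (fun i => partial i (partial i f) x).
split=> [i|i|//]; first by near=> y; exact: classC_derive cf.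
exact: (classC_derive _ _ (classC_partial i cf)).
Unshelve. all: by end_near. Qed.

Lemma partialE i f x df : is_derive x (dirv i) f df -> partial i f x = df.
Proof. by case. Qed.

Lemma classC_intro k f (df : 'I_n -> 'rV[R]_n -> R) : continuous f ->
  (forall i x, is_derive x (dirv i) f (df i x)) ->
  (forall i, classC k (df i)) -> classC k.+1 f.
Proof.
move=> cf fdf cdf; split=> // i; split=> [x|]; first by have [] := fdf i x.
rewrite (_ : partial i f = df i)//; apply/funext => x; exact: partialE.
Qed.

Lemma classCD k f g : classC k f -> classC k g -> classC k (fun x => f x + g x).
Proof.
elim: k f g => [|k IH] f g cf cg.
  by split=> //; apply: contD; [exact: classC_continuous cf|exact: classC_continuous cg].
apply: (@classC_intro _ _ (fun i x => partial i f x + partial i g x)).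
- by apply: contD; [exact: classC_continuous cf|exact: classC_continuous cg].
- by move=> i x; apply: isdD; [exact: classC_derive cf|exact: classC_derive cg].
- by move=> i; apply: IH; [exact: classC_partial cf|exact: classC_partial cg].
Qed.

Lemma classCZ k (a : R) f : classC k f -> classC k (fun x => a * f x).
Proof.
elim: k f => [|k IH] f cf.
  by split=> //; apply: contM; [exact: cst_continuous|exact: classC_continuous cf].
apply: (@classC_intro _ _ (fun i x => a * partial i f x)).
- by apply: contM; [exact: cst_continuous|exact: classC_continuous cf].
- by move=> i x; apply: isdZ; exact: classC_derive cf.
- by move=> i; apply: IH; exact: classC_partial cf.
Qed.

Lemma classC_cst k (a : R) : classC k (fun _ : 'rV[R]_n => a).
Proof.
elim: k a => [|k IH] a; first by split=> // x; exact: cst_continuous.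
apply: (@classC_intro _ _ (fun _ _ => 0)) => //.
by move=> x; exact: cst_continuous.
Qed.

Lemma classC_sum k m (F : 'I_m -> 'rV[R]_n -> R) : (forall i, classC k (F i)) ->
  classC k (fun x => \sum_(i < m) F i x).
Proof.
move=> cF; rewrite (_ : (fun x => _) = \sum_(i < m) F i); last first.
  by apply/funext => y; rewrite fct_sumE.
elim/big_ind : _ => [|f g cf cg|i _]; [exact: classC_cst| exact: classCD|exact: cF].
Qed.

Lemma classC_laplacian k f : classC k.+2 f -> classC k (laplacian f).
Proof. by move=> cf; apply: classC_sum => i; do 2 apply: classC_partial. Qed.

End classC.
(** * Lebesgue measure on R^n *)

Section measurability.
Context {R : realType} {n : nat}.
Implicit Types (f g : 'rV[R]_n -> R).
Local Notation tupleR := (n.-tuple (measurableTypeR R)).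

Lemma measurable_box (A : 'I_n -> set (measurableTypeR R)) :
  (forall i, measurable (A i)) ->
  measurable [set t : tupleR | forall i, A i (tnth t i)].
Proof.
move=> mA; rewrite [X in measurable X](_ : _ =
    \bigcap_(i in [set: 'I_n]) ((fun t : tupleR => tnth t i) @^-1` (A i))).
  apply: fin_bigcap_measurable => // i _.
  by rewrite -[X in measurable X]setTI; exact: measurable_tnth.
by apply/seteqP; split => [t At i _|t At i] /=; [exact: At|exact: At i I].
Qed.

Let grid (k : nat) (a : R) : R := (Num.floor (k.+1%:R * a))%:~R / k.+1%:R.

Let grid_le k a : `|a - grid k a| <= k.+1%:R^-1.
Proof.
have k0 : 0 < k.+1%:R :> R by [].
have H1 := floor_le_tmp (k.+1%:R * a). have H2 := floorD1_gt (k.+1%:R * a).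
have -> : a - grid k a = (k.+1%:R * a - (Num.floor (k.+1%:R * a))%:~R) / k.+1%:R.
  by rewrite /grid mulrBl mulrAC mulfV ?mul1r// gt_eqF.
rewrite ger0_norm; last by rewrite divr_ge0 ?subr_ge0// ltW.
rewrite ler_pdivrMr// mulVf ?gt_eqF// lerBlDr addrC ltW//.
by move: H2; rewrite intrD.
Qed.

Let measurable_grid k f :
  measurable_fun setT (fun t : tupleR => f (\row_i grid k (tnth t i))).
Proof.
move=> _ B mB; rewrite setTI.
pose v (z : n.-tuple int) : 'rV[R]_n := \row_i ((tnth z i)%:~R / k.+1%:R).
pose A (z : n.-tuple int) : set tupleR := [set t : tupleR | forall i,
  [set a : measurableTypeR R | `[(tnth z i)%:~R / k.+1%:R,
                 ((tnth z i)%:~R + 1) / k.+1%:R[%classic a] (tnth t i)].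
have AE z t : A z t <-> forall i, Num.floor (k.+1%:R * tnth t i) = tnth z i.
  have k0 : 0 < k.+1%:R :> R by [].
  split=> [At i|tz i].
    have := At i; rewrite /= in_itv/= ler_pdivrMr// ltr_pdivlMr// mulrC => H.
    by apply: floor_def; rewrite intrD.
  rewrite /= in_itv/= ler_pdivrMr// ltr_pdivlMr// -tz mulrC floor_le_tmp/=.
  by rewrite -intrD1 floorD1_gt.
(* Integer tuples are enumerated through [unpickle]; codes of no tuple, and boxes on which the value
   misses [B], contribute the empty set. *)
pose F m : set tupleR := if @unpickle (n.-tuple int) m is Some z then
   (if `[< B (f (v z)) >] then A z else set0) else set0.
rewrite [X in measurable X](_ : _ = \bigcup_m F m).
  apply: bigcupT_measurable => m; rewrite /F; case: unpickle => [z|//].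
  case: asboolP => // _.
  apply: (@measurable_box (fun i => `[(tnth z i)%:~R / k.+1%:R,
    ((tnth z i)%:~R + 1) / k.+1%:R[%classic)) => i; exact: measurable_itv.
apply/seteqP; split=> t /=.
  move=> Bt; pose z := [tuple Num.floor (k.+1%:R * tnth t i) | i < n].
  exists (pickle z) => //; rewrite /F pickleK.
  have -> : v z = \row_i grid k (tnth t i).
    by apply/rowP => i; rewrite !mxE tnth_mktuple.
  by rewrite asboolT//; apply/AE => i; rewrite tnth_mktuple.
move=> [m _]; rewrite /F; case: unpickle => [z|//].
case: asboolP => // Bz /AE tz.
suff -> : \row_i grid k (tnth t i) = v z by [].
by apply/rowP => i; rewrite !mxE /grid tz.
Qed.

(** [f] is the pointwise limit of its values at the points rounded down to the grid of mesh 1/(k+1).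
    Such an approximation is measurable because it is constant on countably many half-open boxes. *)
Lemma measurable_continuous_rV f : continuous f ->
  measurable_fun setT (fun t : tupleR => f (rV_of_tuple t)).
Proof.
move=> cf; apply: (measurable_fun_cvg (measurable_grid ^~ f)) => t _.
suff : (\row_i grid k (tnth t i)) @[k --> \oo] --> (rV_of_tuple t : 'rV[R]_n).
  by move=> /(cvg_comp _ _)/(_ (cf _)).
apply/cvg_ballP => e e0.
have : (k.+1%:R^-1 : R) @[k --> \oo] --> (0 : R) by exact: cvg_harmonic.
move/cvgrPdist_lt => /(_ e e0); apply: filterS => k.
rewrite sub0r normrN ger0_norm// => ke.
split=> // i j; rewrite !mxE /ball/=; exact: (le_lt_trans (grid_le _ _)).
Qed.

End measurability.

(** * Compactly supported functions *)

Section compact_support.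
Context {R : realType} {n : nat}.
Implicit Types (f g : 'rV[R]_n -> R).
Local Notation tupleR := (n.-tuple (measurableTypeR R)).
Local Notation mu := (@lebesgue_measure_tuple R n).

(** The condition bounds coordinates rather than the Euclidean norm, so that it passes with the same
    [M] to slices in any coordinate. *)
Definition supp_in (M : R) f := forall (x : 'rV[R]_n) i, M < `|x 0 i| -> f x = 0.

Lemma supp_in_ball (M : R) f : (forall x, M < enorm x -> f x = 0) -> supp_in M f.
Proof. by move=> H x i xi; apply: H; exact: (lt_le_trans xi (coord_le_enorm x i)). Qed.

Definition cube (c : 'rV[R]_n) (r : R) : set tupleR :=
  [set t | forall i, `[c 0 i - r, c 0 i + r]%classic (tnth t i)].

Lemma measurable_cube c r : measurable (cube c r).
Proof.
by apply: (@measurable_box _ _ (fun i => `[c 0 i - r, c 0 i + r]%classic)) => i;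
  exact: measurable_itv.
Qed.

Lemma measure_cube c r : 0 <= r -> mu (cube c r) = ((2 * r) ^+ n)%:E.
Proof.
move=> r0; rewrite (lebesgue_measure_tuple_box
    (A := fun i => `[c 0 i - r, c 0 i + r]%classic)); last first.
  by move=> i; exact: measurable_itv.
rewrite (eq_bigr (fun=> (2 * r)%:E)) => [|i _].
  by rewrite prodEFin prodr_const card_ord.
rewrite lebesgue_measure_itv/= lte_fin; case: ltP => [_|].
  by rewrite -EFinD; congr EFin; ring.
move=> H; have -> : r = 0 by lra.
by rewrite mulr0.
Qed.

Lemma compact_cube (r : R) (c : 'rV[R]_n) :
  compact [set x : 'rV[R]_n | forall i, `[c 0 i - r, c 0 i + r]%classic (x 0 i)].
Proof.
by apply: (rV_compact (A := fun i => `[c 0 i - r, c 0 i + r]%classic)) => i;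
  exact: segment_compact.
Qed.

Lemma bounded_on_cube f (M : R) : continuous f -> 0 <= M ->
  exists2 K : R, 0 <= K & forall x : 'rV[R]_n, (forall i, `|x 0 i| <= M) -> `|f x| <= K.
Proof.
move=> cf M0.
have cg : continuous (fun x => `|f x|).
  by move=> x; apply: (@continuous_comp _ _ _ f Num.norm); [exact: cf|exact: norm_continuous].
have [|c _ Hc] := @EVT_max_rV R n _ _ _ (compact_cube (r := M) (c := 0)) (continuous_subspaceT cg).
  by exists 0 => i /=; rewrite in_itv/= mxE sub0r add0r oppr_le0 M0.
exists `|f c| => // x xM; apply: Hc; rewrite inE => i /=.
by rewrite in_itv/= mxE sub0r add0r -ler_norml.
Qed.

Lemma integrable_compact_support f (M : R) : continuous f -> supp_in M f ->
  mu.-integrable setT (fun t => (f (rV_of_tuple t))%:E).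
Proof.
(* [M] may be negative; the maximum keeps the cube of radius [M'] nonempty. *)
move=> cf sf; pose M' := Num.max M 0.
have M'0 : 0 <= M' by rewrite le_max lexx orbT.
have [K K0 fK] := bounded_on_cube cf M'0.
have fE : (fun t => (f (rV_of_tuple t))%:E) =
    ((EFin \o (fun t => f (rV_of_tuple t))) \_ (cube 0 M')).
  apply/funext => t; rewrite patchE; case: ifPn => // /negP tM.
  have [i] : exists i, M' < `|tnth t i|.
    apply/not_existsP => H; apply: tM; rewrite inE => i /=.
    rewrite in_itv/= mxE sub0r add0r -ler_norml leNgt; exact/negP/H.
  rewrite gt_max => /andP[Mi _]; rewrite (sf _ i)//; by rewrite mxE.
have mf := measurable_continuous_rV cf.
rewrite fE -integrable_mkcond; last exact: measurable_cube.
apply: measurable_bounded_integrable.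
- exact: measurable_cube.
- by rewrite [X in (X < _)%E]measure_cube// ltry.
- exact: measurable_funTS.
- exists K; split; first exact: num_real.
  move=> x Kx t /= tM; apply/(le_trans _ (ltW Kx)); apply: fK => i.
  by have := tM i; rewrite /= in_itv/= !mxE sub0r add0r -ler_norml.
Qed.

End compact_support.

Section cons_rV.
Context {R : realType} {n : nat}.

Definition cons_rV (a : R) (v : 'rV[R]_n) : 'rV[R]_n.+1 :=
  \row_i oapp (v 0) a (unlift ord0 i).

Lemma cons_rV0 a v : cons_rV a v 0 ord0 = a.
Proof. by rewrite mxE unlift_none. Qed.

Lemma cons_rVS a v j : cons_rV a v 0 (lift ord0 j) = v 0 j.
Proof. by rewrite mxE liftK. Qed.

Lemma rV_of_tuple_cons (z : measurableTypeR R * n.-tuple (measurableTypeR R)) :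
  rV_of_tuple (tuple_of_pair z) = cons_rV z.1 (rV_of_tuple z.2).
Proof.
apply/rowP => i; case: (unliftP ord0 i) => [j ->|->].
  by rewrite cons_rVS !mxE tnthS.
by rewrite cons_rV0 mxE.
Qed.

Lemma cons_rV_dirS a v (h : R) j :
  cons_rV a (h *: dirv j + v) = h *: dirv (lift ord0 j) + cons_rV a v.
Proof.
apply/rowP => i; rewrite !mxE; case: (unliftP ord0 i) => [k ->|->] /=.
  by rewrite !mxE (inj_eq (@lift_inj _ ord0)).
by rewrite mulr0 add0r.
Qed.

Lemma cons_rV_dir0 a v (h : R) :
  cons_rV (h + a) v = h *: dirv ord0 + cons_rV a v.
Proof.
apply/rowP => i; rewrite !mxE; case: (unliftP ord0 i) => [k ->|->] /=.
  by rewrite mulr0 add0r.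
by rewrite mulr1.
Qed.

Lemma continuous_cons_rVr a : continuous (cons_rV a).
Proof.
move=> v A /nbhs_ballP[e /= e0 eA]; apply/nbhs_ballP; exists e => //= w vw.
apply: eA; move: vw => [_ H]; split=> // i j; rewrite !mxE.
case: (unliftP ord0 j) => [k _|_] /=; [exact: H|exact: ballxx].
Qed.

Lemma continuous_cons_rVl v : continuous (cons_rV ^~ v).
Proof.
move=> a A /nbhs_ballP[e /= e0 eA]; apply/nbhs_ballP; exists e => //= b ab.
apply: eA; split=> // i j; rewrite !mxE.
by case: (unliftP ord0 j) => [k _|_] //=; exact: ballxx.
Qed.

End cons_rV.

(** * Integration by parts *)

Section integration_by_parts.
Context {R : realType}.

(** The fundamental theorem of calculus on [-b, b], with [b] strictly beyond the support so that
    both boundary values vanish. *)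
Lemma integral_derive_line (f df : R -> R) (M : R) : continuous df ->
  (forall x, is_derive x (1 : R) f (df x)) -> (forall x, M < `|x| -> f x = 0) ->
  (forall x, M < `|x| -> df x = 0) ->
  (\int[lebesgue_measure]_x (df x)%:E = 0)%E.
Proof.
move=> cdf fdf f0 df0; pose b := Num.max M 0 + 1.
have b0 : 0 < b by rewrite ltr_wpDl// le_max lexx orbT.
have Mb (x : R) : b <= `|x| -> M < `|x|.
  by apply: lt_le_trans; rewrite /b ltr_pwDr// le_max lexx.
have -> : (fun x => (df x)%:E) = (EFin \o df) \_ `[- b, b].
  apply/funext => x; rewrite patchE; case: ifPn => //.
  rewrite notin_setE /= in_itv/= -ler_norml => /negP; rewrite -ltNge => bx.
  by rewrite df0//; apply: Mb; exact: ltW.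
rewrite -integral_mkcond.
have cf : continuous f.
  by move=> x; apply/differentiable_continuous/derivable1_diffP; have [] := fdf x.
have -> : (\int[lebesgue_measure]_(x in `[(- b)%R, b]) (df x)%:E =
    (f b)%:E - (f (- b))%:E)%E.
  apply: continuous_FTC2.
  - by rewrite gtrN.
  - exact: continuous_subspaceT.
  - split=> [x _||]; first by have [] := fdf x.
    + by apply: cvg_at_right_filter; exact: cf.
    + by apply: cvg_at_left_filter; exact: cf.
  - by move=> x _; rewrite derive1E; have [_ ->] := fdf x.
by rewrite !f0 ?subee//; apply: Mb; rewrite ?normrN ger0_norm// ltW.
Qed.

(** The condition M < |x_i| is open, so [f] vanishes in a whole neighbourhood of such a point. *)
Lemma supp_in_derive n (f df : 'rV[R]_n -> R) (M : R) v :
  (forall x, is_derive x v f (df x)) -> supp_in M f -> supp_in M df.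
Proof.
move=> fdf sf x i Mi; apply: (isd_unique (fdf x)).
apply: (near_eq_is_derive _ (isd_cst 0 x v)).
have : \forall y \near x, M < `|(y : 'rV[R]_n) 0 i|.
  have c : continuous (fun y : 'rV[R]_n => `|y 0 i|).
    move=> y; apply: (@continuous_comp _ _ _ (fun y : 'rV[R]_n => y 0 i) Num.norm).
      exact: continuous_coord.
    exact: norm_continuous.
  exact: (cvgr_gt _ (c x)).
by apply: filterS => y /sf ->.
Qed.

Lemma integral_cons n (F : 'rV[R]_n.+1 -> R) (M : R) : continuous F -> supp_in M F ->
  (lebesgue_measure \x lebesgue_measure_tuple n)%E.-integrable setT
    (fun z => (F (cons_rV z.1 (rV_of_tuple z.2)))%:E) /\
  (\int[lebesgue_measure_tuple n.+1]_t (F (rV_of_tuple t))%:E =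
   \int[(lebesgue_measure \x lebesgue_measure_tuple n)%E]_z
     (F (cons_rV z.1 (rV_of_tuple z.2)))%:E)%E.
Proof.
move=> cF sF.
have FE : (fun z => (F (cons_rV z.1 (rV_of_tuple z.2)))%:E) =
   (fun t => (F (rV_of_tuple t))%:E) \o @tuple_of_pair R n.
  by apply/funext => z /=; rewrite rV_of_tuple_cons.
have mF : measurable_fun setT (fun t : n.+1.-tuple (measurableTypeR R) =>
    (F (rV_of_tuple t))%:E).
  by apply/measurable_EFinP; exact: measurable_continuous_rV.
have iF : (lebesgue_measure \x lebesgue_measure_tuple n)%E.-integrable setT
    (fun z => (F (cons_rV z.1 (rV_of_tuple z.2)))%:E).
  have /integrableP[_ lt] := integrable_compact_support cF sF.
  apply/integrableP; split.
    rewrite FE; apply: measurableT_comp => //; exact: measurable_tuple_of_pair.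
  move: lt; rewrite /= /cons_measure ge0_integral_pushforward//=.
  - rewrite preimage_setT; congr (_ < _)%E; apply: eq_integral => z _.
    by rewrite rV_of_tuple_cons.
  - exact: measurable_tuple_of_pair.
  - apply/measurable_EFinP; apply: (measurableT_comp (@normr_measurable _ setT)).
    exact: measurable_continuous_rV.
split=> //=; rewrite /cons_measure integral_pushforward//=.
- by rewrite preimage_setT FE.
- exact: measurable_tuple_of_pair.
- by rewrite preimage_setT -FE.
Qed.

(** Fubini with the first coordinate split off. If [i] is the first coordinate, the line integral is
    taken first and vanishes; otherwise the slices with fixed first coordinate are covered by the
    induction on the dimension. *)
Lemma integral_partial n (i : 'I_n) (f df : 'rV[R]_n -> R) (M : R) :
  continuous df -> (forall x, is_derive x (dirv i) f (df x)) -> supp_in M f ->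
  (\int[lebesgue_measure_tuple n]_t (df (rV_of_tuple t))%:E = 0)%E.
Proof.
elim: n i f df => [|n IH] i f df; first by case: i.
move=> cdf fdf sf; have sdf := supp_in_derive fdf sf.
have [idf ->] := integral_cons cdf sdf.
have [j ij|i0] := unliftP ord0 i.
  rewrite -integral12_prod_meas1//= /fubini_F integral0_eq// => a _ /=.
  apply: (IH j (fun v => f (cons_rV a v)) (fun v => df (cons_rV a v))).
  - move=> v; apply: continuous_comp; [exact: continuous_cons_rVr|exact: cdf].
  - move=> v; apply/is_derive_lineP.
    have /is_derive_lineP := fdf (cons_rV a v); rewrite ij.
    by under eq_fun do rewrite -cons_rV_dirS.
  - by move=> v k Mk; apply: (sf _ (lift ord0 k)); rewrite cons_rVS.
rewrite -integral21_prod_meas1//= /fubini_G integral0_eq// => t _ /=.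
set v := rV_of_tuple t.
apply: (@integral_derive_line (fun a => f (cons_rV a v)) (fun a => df (cons_rV a v)) M).
- move=> a; apply: (@continuous_comp _ _ _ (cons_rV ^~ v)); [exact: continuous_cons_rVl|exact: cdf].
- move=> a; apply/is_derive_lineP.
  have /is_derive_lineP := fdf (cons_rV a v); rewrite i0.
  under eq_fun do rewrite -cons_rV_dir0.
  by under [X in _ -> is_derive _ _ X _]eq_fun do rewrite [_ *: 1]mulr1.
- by move=> a Ma; apply: (sf _ ord0); rewrite cons_rV0.
- by move=> a Ma; apply: (sdf _ ord0); rewrite cons_rV0.
Qed.

End integration_by_parts.

(** * A C^2 bump function and Green's formula *)

Section antiderivatives.
Context {R : realType}.
Implicit Types f : R -> R.

Lemma isd_continuous f df : (forall x, is_derive x (1 : R) f (df x)) -> continuous f.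
Proof.
by move=> fdf x; apply/differentiable_continuous/derivable1_diffP; have [] := fdf x.
Qed.

Lemma isd_MVT f df (a b : R) : (forall x, is_derive x (1 : R) f (df x)) -> a < b ->
  exists2 c, a < c < b & f b - f a = df c * (b - a).
Proof.
move=> fdf ab; have [c cab E] := MVT ab (fun x _ => fdf x)
  (continuous_subspaceT (isd_continuous fdf)).
by exists c => //; rewrite in_itv in cab.
Qed.

Lemma isd_ge0_le f df : (forall x, is_derive x (1 : R) f (df x)) ->
  (forall x, 0 <= df x) -> forall a b, a <= b -> f a <= f b.
Proof.
move=> fdf df0 a b; rewrite le_eqVlt => /predU1P[->//|ab].
have [c _] := isd_MVT fdf ab.
by move=> E; rewrite -subr_ge0 E mulr_ge0// subr_ge0 ltW.
Qed.

Lemma isd_eq0_cst f df (a b : R) : (forall x, is_derive x (1 : R) f (df x)) ->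
  (forall x, a <= x -> df x = 0) -> a <= b -> f b = f a.
Proof.
move=> fdf df0; rewrite le_eqVlt => /predU1P[->//|ab].
have [c /andP[ac _]] := isd_MVT fdf ab.
by rewrite df0 ?ltW// mul0r => /eqP; rewrite subr_eq0 => /eqP.
Qed.

(** Integration starts at [a - 1], strictly below [a], so that every x >= a is interior to an
    interval of integration; below [a] the primitive is locally zero. *)
Lemma antiderivative f (a : R) : continuous f -> (forall x, x <= a -> f x = 0) ->
  exists2 F : R -> R, forall x, is_derive x (1 : R) F (f x) &
                     forall x, x <= a -> F x = 0.
Proof.
move=> cf f0; pose b := a - 1.
pose F x := (\int[lebesgue_measure]_(t in `[b, x]) f t)%R.
have F0 x : x <= a -> F x = 0.
  move=> xa; rewrite /F /Rintegral integral0_eq// => t /=.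
  by rewrite in_itv/= => /andP[_ tx]; rewrite f0// (le_trans tx).
exists F => // x; have [xb|xb] := ltP x a.
  rewrite f0 ?ltW//; apply: (near_eq_is_derive _ (isd_cst 0 x (1 : R))).
  by near=> y; rewrite F0//; apply/ltW; near: y; exact: lt_nbhsl.
have bx : b < x by rewrite /b; lra.
have [||dF FE] := @continuous_FTC1_closed R f b x (x + 1) _ _ bx (cf x).
- by rewrite ltrDl.
- apply: continuous_compact_integrable; first exact: segment_compact.
  exact: continuous_subspaceT.
- by rewrite derive1E in FE; apply: DeriveDef.
Unshelve. all: by end_near. Qed.

(** [q3], obtained by integrating max(t, 0) twice, is a multiple of max(t, 0)^3 and hence C^2; the
    bump is the product of [q3 (t - 1)] and [q3 (2 - t)]. Two derivatives are all that Green's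
    formula needs. *)
Lemma C2_bump : exists (chi chi1 chi2 : R -> R),
  [/\ forall t, is_derive t (1 : R) chi (chi1 t),
      forall t, is_derive t (1 : R) chi1 (chi2 t),
      continuous chi2,
      (forall t, 0 <= chi t) /\ 0 < chi (3 / 2) &
      forall t, t <= 1 \/ 2 <= t -> [/\ chi t = 0, chi1 t = 0 & chi2 t = 0]].
Proof.
pose q1 (t : R) := Num.max t 0.
have cq1 : continuous q1.
  by move=> t; apply: continuous_max; [exact: cvg_id|exact: cst_continuous].
have q10 t : t <= 0 -> q1 t = 0 by move=> t0; rewrite /q1 max_r.
have q1p t : 0 < t -> 0 < q1 t by move=> t0; rewrite /q1 lt_max t0.
have step (q : R -> R) : continuous q -> (forall t, t <= 0 -> q t = 0) ->
    (forall t, 0 < t -> 0 < q t) -> exists Q : R -> R,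
    [/\ forall t, is_derive t (1 : R) Q (q t), continuous Q,
        forall t, t <= 0 -> Q t = 0 & forall t, 0 < t -> 0 < Q t].
  move=> cq q0 qp; have [Q dQ Q0] := antiderivative cq q0.
  exists Q; split=> //; first exact: isd_continuous dQ.
  move=> t t0; have [c /andP[c0 _]] := isd_MVT dQ t0.
  by rewrite (Q0 0)// !subr0 => ->; rewrite mulr_gt0// qp.
have [q2 [dq2 cq2 q20 q2p]] := step _ cq1 q10 q1p.
have [q3 [dq3 cq3 q30 q3p]] := step _ cq2 q20 q2p.
have q3ge t : 0 <= q3 t.
  by have [/q30->//|/q3p/ltW] := leP t 0.
have dl (q q' : R -> R) : (forall t, is_derive t (1 : R) q (q' t)) ->
    forall t, is_derive t (1 : R) (fun t => q (t - 1)) (q' (t - 1)).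
  move=> dq t; rewrite -[X in is_derive _ _ _ X]mulr1 -[X in _ * X]subr0.
  exact: (isd_comp (isdB (is_derive_id t (1 : R)) (isd_cst 1 t (1 : R))) (dq _)).
have dr (q q' : R -> R) : (forall t, is_derive t (1 : R) q (q' t)) ->
    forall t, is_derive t (1 : R) (fun t => q (2 - t)) (- q' (2 - t)).
  move=> dq t; apply: (is_derive_eq
    (isd_comp (isdB (isd_cst 2 t (1 : R)) (is_derive_id t (1 : R))) (dq _))).
  by rewrite sub0r mulrN1.
pose chi t := q3 (t - 1) * q3 (2 - t).
pose chi1 t := q3 (t - 1) * - q2 (2 - t) + q3 (2 - t) * q2 (t - 1).
pose chi2 t := (q3 (t - 1) * - - q1 (2 - t) + (- q2 (2 - t)) * q2 (t - 1)) +
  (q3 (2 - t) * q1 (t - 1) + q2 (t - 1) * - q2 (2 - t)).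
exists chi, chi1, chi2; split.
- by move=> t; exact: (isdM (dl _ _ dq3 t) (dr _ _ dq3 t)).
- move=> t; exact: (isdD (isdM (dl _ _ dq3 t) (isdN (dr _ _ dq2 t)))
    (isdM (dr _ _ dq3 t) (dl _ _ dq2 t))).
- have cl (q : R -> R) : continuous q -> continuous (fun t : R => q (t - 1)).
    move=> cq t; apply: (@continuous_comp _ _ _ (fun t : R => t - 1) q); last exact: cq.
    by apply: contB; [move=> ?; exact: cvg_id|exact: cst_continuous].
  have cr (q : R -> R) : continuous q -> continuous (fun t : R => q (2 - t)).
    move=> cq t; apply: (@continuous_comp _ _ _ (fun t : R => 2 - t) q); last exact: cq.
    by apply: contB; [exact: cst_continuous|move=> ?; exact: cvg_id].
  have cN (q : R -> R) : continuous q -> continuous (fun t => - q t).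
    by move=> cq t; apply: continuousN; exact: cq.
  exact: (contD (contD (contM (cl _ cq3) (cN _ (cN _ (cr _ cq1))))
      (contM (cN _ (cr _ cq2)) (cl _ cq2)))
    (contD (contM (cr _ cq3) (cl _ cq1)) (contM (cl _ cq2) (cN _ (cr _ cq2))))).
- split=> [t|]; first by rewrite mulr_ge0.
  by rewrite mulr_gt0//; apply: q3p; lra.
- move=> t [t1|t2].
    by rewrite /chi /chi1 /chi2 (q30 (t - 1)) ?(q20 (t - 1)) ?(q10 (t - 1)) ?subr_le0//;
      split; ring.
  by rewrite /chi /chi1 /chi2 (q30 (2 - t)) ?(q20 (2 - t)) ?(q10 (2 - t)) ?subr_le0//;
      split; ring.
Qed.

End antiderivatives.

Section green.
Context {R : realType} {n : nat}.
Implicit Types (f g G w : 'rV[R]_n -> R).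
Local Notation tupleR := (n.-tuple (measurableTypeR R)).
Local Notation mu := (@lebesgue_measure_tuple R n).

Definition Rint f : R := (\int[mu]_t f (rV_of_tuple t))%R.

Lemma Rint0 : Rint (cst 0) = 0.
Proof. by rewrite /Rint /Rintegral integral0_eq. Qed.

Lemma RintB f g M : continuous f -> continuous g -> supp_in M f -> supp_in M g ->
  Rint (fun x => f x - g x) = Rint f - Rint g.
Proof.
move=> cf cg sf sg; apply: RintegralB => //.
  exact: integrable_compact_support cf sf.
exact: integrable_compact_support cg sg.
Qed.

Lemma RintZ k f M : continuous f -> supp_in M f ->
  Rint (fun x => k * f x) = k * Rint f.
Proof.
move=> cf sf; apply: RintegralZl => //; exact: integrable_compact_support sf.
Qed.

Lemma le_Rint f g M : continuous f -> continuous g -> supp_in M f -> supp_in M g ->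
  (forall x, f x <= g x) -> Rint f <= Rint g.
Proof.
move=> cf cg sf sg fg; apply: le_Rintegral => //.
  exact: integrable_compact_support cf sf.
exact: integrable_compact_support cg sg.
Qed.

Lemma supp_inMl M f g : supp_in M f -> supp_in M (fun x => f x * g x).
Proof. by move=> sf x i /sf ->; rewrite mul0r. Qed.

Lemma supp_inMr M f g : supp_in M g -> supp_in M (fun x => f x * g x).
Proof. by move=> sf x i /sf ->; rewrite mulr0. Qed.

Lemma supp_in_sum M m (F : 'I_m -> 'rV[R]_n -> R) : (forall i, supp_in M (F i)) ->
  supp_in M (fun x => \sum_i F i x).
Proof. by move=> sF x i Mx; rewrite big1// => j _; exact: sF Mx. Qed.

Lemma supp_in_laplacian M G : classC 2 G -> supp_in M G -> supp_in M (laplacian G).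
Proof.
move=> cG sG; apply: supp_in_sum => i.
apply: (supp_in_derive (f := partial i G) (v := dirv i)).
  by move=> x; exact: classC_derive (classC_partial i cG).
by apply: (supp_in_derive (f := G) (v := dirv i)) => // x; exact: classC_derive cG.
Qed.

Lemma continuous_laplacian G : classC 2 G -> continuous (laplacian G).
Proof. by move=> /(@classC_laplacian _ _ 0)/classC_continuous. Qed.

Lemma green G w M : classC 2 G -> classC 2 w -> supp_in M G ->
  Rint (fun x => G x * laplacian w x) = Rint (fun x => w x * laplacian G x).
Proof.
move=> cG cw sG.
have cont1 f i : classC 2 f -> continuous (partial i f).
  by move=> cf; exact: classC_continuous (classC_partial i cf).
have cont2 f i : classC 2 f -> continuous (partial i (partial i f)).
  by move=> cf; exact: classC_continuous (classC_partial i (classC_partial i cf)).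
have cGc := classC_continuous cG. have cwc := classC_continuous cw.
have clG := continuous_laplacian cG. have clw := continuous_laplacian cw.
have s1 i : supp_in M (partial i G).
  by apply: (supp_in_derive (f := G) (v := dirv i)) => // x; exact: classC_derive cG.
have alg (a b c d e f : R) : a * b + c * d - (e * f + d * c) = a * b - e * f by ring.
(* The integrand is a divergence: [dF i] is the derivative in direction [i] of G d_i w - w d_i G, so
   its integral vanishes. *)
pose dF i x := G x * partial i (partial i w) x - w x * partial i (partial i G) x.
have I0 i : (\int[mu]_t (dF i (rV_of_tuple t))%:E = 0)%E.
  apply: (@integral_partial _ _ i (fun x => G x * partial i w x - w x * partial i G x) _ M).
  - exact: (contB (contM cGc (cont2 _ i cw)) (contM cwc (cont2 _ i cG))).
  - move=> x; apply: (is_derive_eq (isdB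
      (isdM (classC_derive i x cG) (classC_derive i x (classC_partial i cw)))
      (isdM (classC_derive i x cw) (classC_derive i x (classC_partial i cG))))).
    exact: alg.
  - by move=> x j Mx; rewrite (sG _ _ Mx) (s1 i _ _ Mx) mul0r mulr0 subr0.
have sdF i : supp_in M (dF i).
  move=> x j Mx; rewrite /dF (sG _ _ Mx) mul0r (_ : partial i _ x = 0) ?mulr0 ?subr0//.
  apply: (supp_in_derive (f := partial i G) (v := dirv i)) Mx => //.
  by move=> y; exact: classC_derive (classC_partial i cG).
have cdF i : continuous (dF i).
  exact: (contB (contM cGc (cont2 _ i cw)) (contM cwc (cont2 _ i cG))).
apply/eqP; rewrite -subr_eq0 -(RintB (M := M)); last 4 first.
- exact: (contM cGc clw).
- exact: (contM cwc clG).
- by apply: supp_inMl.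
- by apply: supp_inMr; exact: supp_in_laplacian.
rewrite (_ : (fun x => _) = fun x => \sum_(i < n) dF i x); last first.
  apply/funext => x; rewrite /laplacian !mulr_sumr -sumrB.
  by apply: eq_bigr => i _.
rewrite /Rint /Rintegral.
under eq_integral do rewrite -sumEFin.
rewrite integral_sum//=; last first.
  by move=> i; exact: integrable_compact_support (sdF i).
by rewrite big1 => [//|i _]; rewrite I0.
Qed.

End green.
Section radial_functions.
Context {R : realType} {n : nat}.
Implicit Types (c x : 'rV[R]_n) (h : R -> R).

Lemma continuous_radial h c : continuous h -> continuous (fun x : 'rV[R]_n => h (sqn (x - c))).
Proof.
move=> ch x; apply: (@continuous_comp _ _ _ (fun y : 'rV[R]_n => sqn (y - c)) h).
  exact: continuous_sqn.
exact: ch.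
Qed.

Lemma classC_radial (h h1 h2 : R -> R) c :
  (forall t, is_derive t (1 : R) h (h1 t)) -> (forall t, is_derive t (1 : R) h1 (h2 t)) ->
  continuous h2 -> classC 2 (fun x : 'rV[R]_n => h (sqn (x - c))).
Proof.
move=> dh dh1 ch2.
have ch := isd_continuous dh. have ch1 := isd_continuous dh1.
have cco (i : 'I_n) : continuous (fun x : 'rV[R]_n => 2 * (x 0 i - c 0 i)).
  apply: contM; first exact: cst_continuous.
  by apply: contB; [exact: continuous_coord|exact: cst_continuous].
have dco (i j : 'I_n) x : is_derive x (dirv j) (fun x : 'rV[R]_n => 2 * (x 0 i - c 0 i))
    (2 * ((i == j)%:R - 0)).
  exact: (isdZ _ (isdB (isd_coord j i x) (isd_cst (c 0 i) x (dirv j)))).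
have dr (f f1 : R -> R) (i : 'I_n) x : (forall t, is_derive t (1 : R) f (f1 t)) ->
    is_derive x (dirv i) (fun x => f (sqn (x - c))) (f1 (sqn (x - c)) * (2 * (x 0 i - c 0 i))).
  move=> df; have -> : x 0 i - c 0 i = (x - c) 0 i by rewrite !mxE.
  exact: (isd_comp (isd_sqn i x c) (df _)).
have D1 i x := dr h h1 i x dh.
apply: (classC_intro (continuous_radial ch) D1) => i.
have D2 j x := isdM (dr _ _ j x dh1) (dco i j x).
apply: (classC_intro _ D2) => [|j].
  exact: (contM (continuous_radial ch1) (cco i)).
split=> //.
exact: (contD (contM (continuous_radial ch1) (@cst_continuous _ _ _))
  (contM (cco i) (contM (continuous_radial ch2) (cco j)))).
Qed.

Lemma laplacian_radial (h h1 h2 : R -> R) c x :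
  (forall t, is_derive t (1 : R) h (h1 t)) -> (forall t, is_derive t (1 : R) h1 (h2 t)) ->
  laplacian (fun x : 'rV[R]_n => h (sqn (x - c))) x =
  4 * sqn (x - c) * h2 (sqn (x - c)) + 2 * n%:R * h1 (sqn (x - c)).
Proof.
move=> dh dh1; apply: is_lap_laplacian; apply: is_lap_radial => //.
by near=> s; exact: dh.
Unshelve. all: by end_near. Qed.

Lemma sqn_gt_of_enorm c (r : R) x : 0 <= r -> enorm c + Num.sqrt r < enorm x ->
  r <= sqn (x - c).
Proof.
move=> r0 H; have : Num.sqrt r <= enorm (x - c).
  by rewrite (le_trans _ (enormB_ge x c))// lerBrDl ltW.
move=> H2; rewrite -sqr_enorm -[leLHS]sqr_sqrtr// ler_sqr// nnegrE.
  exact: sqrtr_ge0.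
exact: enorm_ge0.
Qed.

End radial_functions.

Section powR_facts.
Context {R : realType}.
Implicit Types (x y a b e m : R).

Lemma continuous_powR_gt0 x e : 0 < x -> {for x, continuous (fun t => t `^ e)}.
Proof.
move=> x0; apply/differentiable_continuous/derivable1_diffP.
by have [] := is_derive1_powR e x0.
Qed.

Lemma continuous_powR_max m e : 0 < m -> continuous (fun t => Num.max t m `^ e).
Proof.
move=> m0 t; apply: (@continuous_comp _ _ _ (fun t => Num.max t m) (fun t => t `^ e)).
  by apply: continuous_max; [exact: cvg_id|exact: cst_continuous].
by apply: continuous_powR_gt0; rewrite lt_max m0 orbT.
Qed.

Lemma powR_addE x a b : 0 < x -> x `^ (a + b) = x `^ a * x `^ b.
Proof. by move=> x0; rewrite powRD// (gt_eqF x0) implybT. Qed.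

Lemma powR_add1 x a : 0 < x -> x `^ (a + 1) = x `^ a * x.
Proof. by move=> x0; rewrite powR_addE// powRr1// ltW. Qed.

Lemma powR_divE x y a : 0 < x -> 0 < y -> (x / y) `^ a = x `^ a / y `^ a.
Proof.
move=> x0 y0; rewrite powRM ?invr_ge0 ?ltW//.
by rewrite -powR_inv1 ?ltW// -powRrM mulN1r powRN.
Qed.

(** With e = n/2, the power s^(e-1) in the rescaled weight cancels against s^(1-e), and only the
    normalisation r^(-n/2) of a shell remains. *)
Lemma powR_shell_identity (s r e : R) : 0 < s -> 0 < r ->
  s * s `^ (- e) * ((s / r) `^ (e - 1) / r) = r `^ (- e).
Proof.
move=> s0 r0; rewrite powR_divE//.
have -> : s `^ (- e) = (s `^ e)^-1 by rewrite powRN.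
have -> : r `^ (- e) = (r `^ e)^-1 by rewrite powRN.
have -> : s `^ e = s `^ (e - 1) * s by rewrite -powR_add1// subrK.
have -> : r `^ e = r `^ (e - 1) * r by rewrite -powR_add1// subrK.
have sp := powR_gt0 (e - 1) s0. have rp := powR_gt0 (e - 1) r0.
by field; rewrite !gt_eqF.
Qed.

End powR_facts.

(** * Radial shells and averages *)

Section shells.
Context {R : realType} {n : nat}.
Variables (chi chi1 chi2 : R -> R).
Hypothesis dchi : forall t, is_derive t (1 : R) chi (chi1 t).
Hypothesis dchi1 : forall t, is_derive t (1 : R) chi1 (chi2 t).
Hypothesis cchi2 : continuous chi2.
Hypothesis chi_ge0 : forall t, 0 <= chi t.
Hypothesis chi_out : forall t, t <= 1 \/ 2 <= t -> [/\ chi t = 0, chi1 t = 0 & chi2 t = 0].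
Let cchi : continuous chi := isd_continuous dchi.
Local Notation h := (n%:R / 2 : R).

(** Here [r] is a squared radius: r^(-n/2) is the inverse n-th power of the radius and makes the
    integral of the weight independent of [r]. *)
Definition shell (x0 : 'rV[R]_n) (r : R) (x : 'rV[R]_n) : R :=
  r `^ (- h) * chi (sqn (x - x0) / r).

Lemma isd_scaled (f f1 : R -> R) (k r : R) : (forall t, is_derive t (1 : R) f (f1 t)) ->
  forall t, is_derive t (1 : R) (fun t => k * f (t / r)) (k / r * f1 (t / r)).
Proof.
move=> df t.
have E : (fun t => k * f (t / r)) = fun t => k * f (r^-1 * t).
  by apply/funext => y; rewrite mulrC [r^-1 * _]mulrC mulrC.
rewrite E; apply: (is_derive_eq (isdZ k (isd_comp (isdZ r^-1 (is_derive_id t (1 : R))) (df _)))).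
by rewrite mulr1 [r^-1 * t]mulrC; ring.
Qed.

Lemma classC_shell x0 r : classC 2 (shell x0 r).
Proof.
pose k := r `^ (- h).
apply: (classC_radial (h := fun t => k * chi (t / r)) (h1 := fun t => k / r * chi1 (t / r))
  (h2 := fun t => k / r / r * chi2 (t / r))).
- exact: isd_scaled.
- exact: isd_scaled.
- apply: contM; first exact: cst_continuous.
  move=> t; apply: (@continuous_comp _ _ _ (fun t : R => t / r) chi2); last exact: cchi2.
  by apply: contM; [move=> ?; exact: cvg_id|exact: cst_continuous].
Qed.

Lemma laplacian_shell x0 r x : laplacian (shell x0 r) x =
  r `^ (- h) / r * (4 * (sqn (x - x0) / r) * chi2 (sqn (x - x0) / r)
                    + 2 * n%:R * chi1 (sqn (x - x0) / r)).
Proof.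
pose k := r `^ (- h).
have D := isd_scaled k r dchi. have D1 := isd_scaled (k / r) r dchi1.
have -> : laplacian (shell x0 r) x = _ := laplacian_radial x0 x D D1.
by rewrite /k; ring.
Qed.

Lemma shell_ge0 x0 r x : 0 <= shell x0 r x.
Proof. by rewrite mulr_ge0// powR_ge0. Qed.

Lemma supp_in_shell x0 r : 0 < r -> supp_in (enorm x0 + Num.sqrt (2 * r)) (shell x0 r).
Proof.
move=> r0; apply: supp_in_ball => x xM; rewrite /shell.
have [] := @chi_out (sqn (x - x0) / r); last by move=> ->; rewrite mulr0.
by right; rewrite ler_pdivlMr//; apply: sqn_gt_of_enorm => //; rewrite mulr_ge0// ltW.
Qed.

Lemma supp_in_le (M M' : R) (f : 'rV[R]_n -> R) : M <= M' -> supp_in M f -> supp_in M' f.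
Proof. by move=> MM sf x i Mx; apply: (sf _ i); exact: le_lt_trans Mx. Qed.

(* The difference of two shells is the Laplacian of a nonnegative compactly
   supported radial function G = h(|x - x0|^2): solving 4 s h'' + 2 n h' = Phi
   amounts to integrating (s^{n/2} h')' = s^{n/2-1} Phi / 4 twice. *)
Lemma shell_potential x0 (a b : R) : 0 < a -> a <= b ->
  exists G : 'rV[R]_n -> R, [/\ classC 2 G, forall x, 0 <= G x,
    supp_in (enorm x0 + Num.sqrt (2 * b)) G &
    forall x, laplacian G x = 4 * (shell x0 b x - shell x0 a x)].
Proof.
move=> a0 ab; have b0 : 0 < b by exact: lt_le_trans ab.
pose kap1 (t : R) := Num.max t 1 `^ (h - 1) * chi t.
have ckap1 : continuous kap1.
  exact: (contM (@continuous_powR_max _ 1 (h - 1) ltr01) cchi).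
have kap1_out t : t <= 1 \/ 2 <= t -> kap1 t = 0.
  by move=> /chi_out[+ _ _]; rewrite /kap1 => ->; rewrite mulr0.
have kap1_ge0 t : 0 <= kap1 t by rewrite mulr_ge0// powR_ge0.
have [kap dkap kap0] := antiderivative ckap1 (fun t t1 => kap1_out t (or_introl t1)).
(* [k] stands for - s^(n/2) g', with [g] the radial function defined below. Both terms vanish for s
   <= a, and for s >= 2 b both equal [kap 2] and cancel; in between [k] is nonnegative because [kap]
   is nondecreasing. *)
pose k s := kap (s / a) - kap (s / b).
pose k1 s := 1 / a * kap1 (s / a) - 1 / b * kap1 (s / b).
have dk s : is_derive s (1 : R) k (k1 s).
  have E : k = fun s => 1 * kap (s / a) - 1 * kap (s / b).
    by apply/funext => y; rewrite !mul1r.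
  by rewrite E; exact: (isdB (isd_scaled 1 a dkap s) (isd_scaled 1 b dkap s)).
have ck1 : continuous k1.
  have cs (r : R) : continuous (fun t : R => 1 / r * kap1 (t / r)).
    apply: contM; first exact: cst_continuous.
    move=> t; apply: (@continuous_comp _ _ _ (fun t : R => t / r) kap1); last exact: ckap1.
    by apply: contM; [move=> ?; exact: cvg_id|exact: cst_continuous].
  exact: contB.
have dv1 (s r : R) : 0 < r -> s <= r -> s / r <= 1 by move=> r0 sr; rewrite ler_pdivrMr// mul1r.
have k_lo s : s <= a -> k s = 0 /\ k1 s = 0.
  move=> sa; have sb := le_trans sa ab.
  rewrite /k /k1 !kap0 ?dv1// !kap1_out; [|left; exact: dv1|left; exact: dv1].
  by rewrite !mulr0 !subr0.
have k_hi s : 2 * b <= s -> k s = 0.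
  move=> sb; rewrite /k; have cst t : 2 <= t -> kap t = kap 2.
    by move=> t2; apply: (isd_eq0_cst dkap) t2 => y y2; apply: kap1_out; right.
  rewrite !cst ?subrr// ler_pdivlMr//; apply: le_trans sb.
  by rewrite ler_pM2l.
have k_ge0 s : 0 <= k s.
  have [s0|s0] := leP s a; first by have [-> _] := k_lo _ s0.
  rewrite subr_ge0; apply: (isd_ge0_le dkap kap1_ge0).
  by rewrite ler_pM2l ?lef_pV2 ?posrE// (lt_trans a0).
(* Since [k] vanishes for s <= a, the truncation does not alter the product; it only makes the
   negative power of [s] continuous on the whole line. *)
pose m s := Num.max s (a / 2).
have a2 : 0 < a / 2 by rewrite divr_gt0.
pose psi s := m s `^ (- h) * k s.
pose psi1 s := m s `^ (- h) * k1 s + k s * (- h * m s `^ (- h - 1)).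
have cm e : continuous (fun s => m s `^ e) by exact: continuous_powR_max.
have cpsi : continuous psi by exact: (contM (cm _) (isd_continuous dk)).
have cpsi1 : continuous psi1.
  exact: (contD (contM (cm _) ck1) (contM (isd_continuous dk)
    (contM (@cst_continuous _ _ _) (cm _)))).
have dpsi s : is_derive s (1 : R) psi (psi1 s).
  have [sa|sa] := ltP s a.
    have [kk k1k] := k_lo _ (ltW sa).
    rewrite /psi1 kk k1k mul0r mulr0 addr0.
    apply: (near_eq_is_derive _ (isd_cst 0 s (1 : R))).
    near=> y; rewrite /psi (k_lo y _).1 ?mulr0//.
    by apply/ltW; near: y; exact: lt_nbhsl.
  have a2s : a / 2 < s by rewrite (lt_le_trans _ sa)// ltr_pdivrMr// ltr_pMr// ltr1n.
  have s0 : 0 < s by exact: lt_le_trans sa.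
  have ms y : a / 2 < y -> m y = y by move=> ay; rewrite /m max_l// ltW.
  rewrite /psi1 ms//.
  apply: (near_eq_is_derive _ (isdM (is_derive1_powR (- h) s0) (dk s))).
  by near=> y; rewrite /psi ms//; near: y; exact: lt_nbhsr.
have psi_lo s : s <= a -> psi s = 0.
  by move=> /k_lo[+ _]; rewrite /psi => ->; rewrite mulr0.
have psi_ge0 s : 0 <= psi s by rewrite mulr_ge0// powR_ge0.
have [H dH _] := antiderivative cpsi psi_lo.
pose g s := H (2 * b) - H s.
have dg s : is_derive s (1 : R) g (- psi s).
  by rewrite -[X in is_derive _ _ _ X]sub0r; exact: (isdB (isd_cst _ _ _) (dH s)).
have dg1 s : is_derive s (1 : R) (fun s => - psi s) (- psi1 s) by exact: isdN.
have g_hi s : 2 * b <= s -> g s = 0.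
  move=> bs; rewrite /g (isd_eq0_cst dH (a := 2 * b) (b := s)) ?subrr// => y by_.
  by rewrite /psi k_hi ?mulr0.
exists (fun x => g (sqn (x - x0))); split.
- apply: (classC_radial (h1 := fun s => - psi s) (h2 := fun s => - psi1 s)) => //.
  by move=> s; apply: continuousN; exact: cpsi1.
- move=> x; set s := sqn _; have [sb|bs] := leP s (2 * b); last by rewrite g_hi// ltW.
  by rewrite subr_ge0; exact: (isd_ge0_le dH psi_ge0).
- apply: supp_in_ball => x xM; apply: g_hi; apply: sqn_gt_of_enorm => //.
  by rewrite mulr_ge0// ltW.
- move=> x; have -> := laplacian_radial x0 x dg dg1; rewrite /shell; set s := sqn _.
  have [sa|sa] := ltP s a.
    have [kk k1k] := k_lo _ (ltW sa).
    rewrite /psi /psi1 kk k1k.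
    have [-> _ _] := @chi_out (s / a) (or_introl (dv1 _ _ a0 (ltW sa))).
    have [-> _ _] := @chi_out (s / b) (or_introl (dv1 _ _ b0 (le_trans (ltW sa) ab))).
    by rewrite !(mulr0, mul0r, addr0, oppr0, subr0).
  have s0 : 0 < s by exact: lt_le_trans sa.
  have ms : m s = s by rewrite /m max_l// (le_trans _ sa)// ler_pdivrMr// ler_pMr// ler1n.
  have K r : 0 < r -> s * s `^ (- h) * (1 / r * kap1 (s / r)) = r `^ (- h) * chi (s / r).
    move=> r0; rewrite -(powR_shell_identity h s0 r0) /kap1.
    have [sr|sr] := leP (s / r) 1.
      by have [-> _ _] := @chi_out (s / r) (or_introl sr); rewrite !mulr0.
    by ring.
  rewrite /psi /psi1 ms -(K a a0) -(K b b0) -/(k1 s).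
  have -> : s `^ (- h) = s `^ (- h - 1) * s by rewrite -powR_add1// subrK.
  rewrite /k1; field.
  by rewrite !gt_eqF.
Unshelve. all: by end_near. Qed.

(** Superharmonicity is tested against the nonnegative potential of [shell_potential], and Green's
    formula turns the result into a difference of two shell integrals. This takes the place of the
    monotonicity of spherical means. *)
Lemma shell_le w x0 (a b : R) : classC 2 w -> (forall x, laplacian w x <= 0) ->
  0 < a -> a <= b ->
  Rint (fun x => w x * shell x0 b x) <= Rint (fun x => w x * shell x0 a x).
Proof.
move=> cw lw a0 ab; have b0 : 0 < b by exact: lt_le_trans ab.
have aux (A B : R) : 4 * (A - B) <= 0 -> A <= B by lra.
have [G [cG G0 sG lG]] := shell_potential x0 a0 ab.
set M := enorm x0 + _ in sG.
have cs r := classC_continuous (classC_shell x0 r).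
have cwc := classC_continuous cw. have cGc := classC_continuous cG.
have clw := continuous_laplacian cw.
have sb : supp_in M (shell x0 b) by exact: supp_in_shell.
have sa : supp_in M (shell x0 a).
  apply: (@supp_in_le (enorm x0 + Num.sqrt (2 * a))); last exact: supp_in_shell.
  by rewrite lerD2l ler_wsqrtr// ler_pM2l.
have swb : supp_in M (fun x => w x * shell x0 b x) by apply: supp_inMr.
have swa : supp_in M (fun x => w x * shell x0 a x) by apply: supp_inMr.
have cwb := contM cwc (cs b). have cwa := contM cwc (cs a).
have E := green cG cw sG.
have : Rint (fun x => G x * laplacian w x) <= Rint (fun x => G x * 0).
  apply: (le_Rint (M := M)).
  - exact: (contM cGc clw).
  - exact: (contM cGc (@cst_continuous _ _ _)).
  - by apply: supp_inMl.
  - by apply: supp_inMl.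
  - by move=> x; rewrite ler_wpM2l.
rewrite E {E} (_ : (fun x => w x * _) =
  fun x => 4 * (w x * shell x0 b x - w x * shell x0 a x)); last first.
  by apply/funext => x; rewrite lG; ring.
have sd : supp_in M (fun x => w x * shell x0 b x - w x * shell x0 a x).
  by move=> x i Mx; rewrite (swb _ _ Mx) (swa _ _ Mx) subr0.
rewrite (RintZ 4 (contB cwb cwa) sd) (RintB cwb cwa swb swa).
have -> : (fun x => G x * 0) = cst 0 by apply/funext => x; rewrite mulr0.
by rewrite Rint0; exact: aux.
Qed.

End shells.
(** * The kernel *)

Section powR_asymptotics.
Context {R : realType}.
Implicit Types (x y r e g C l t : R).

Lemma powR_le_ge0 e x y : 0 <= e -> 0 <= x -> x <= y -> x `^ e <= y `^ e.
Proof. by move=> e0 x0 xy; apply: ge0_ler_powR => //; rewrite nnegrE// (le_trans x0). Qed.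

Lemma powR_le_le0 e x y : e <= 0 -> 0 < x -> x <= y -> y `^ e <= x `^ e.
Proof.
move=> e0 x0 xy; rewrite -(opprK e) !(powRN _ (- e)) lef_pV2 ?posrE ?powR_gt0//.
  by rewrite powR_le_ge0// ?oppr_ge0// ltW.
exact: lt_le_trans xy.
Qed.

Lemma powRM_gt0 x y e : 0 < x -> 0 < y -> (x * y) `^ e = x `^ e * y `^ e.
Proof. by move=> x0 y0; rewrite powRM// ltW. Qed.

Lemma ln_le_powR (d x : R) : 0 < d -> 0 < x -> ln x <= x `^ d / d.
Proof.
move=> d0 x0; rewrite ler_pdivlMr// mulrC -ln_powR.
by apply/ltW/ln_sublinear/powR_gt0.
Qed.

Lemma ln_gt0_1D r : 0 < r -> 0 < ln (1 + r).
Proof. by move=> r0; rewrite ln_gt0// ltrDl. Qed.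

Lemma ln_double r : 0 <= r -> ln (1 + 2 * r) <= 2 * ln (1 + r).
Proof.
move=> r0; have r1 : 0 < 1 + r by rewrite ltr_pwDl.
rewrite [leRHS]mulr_natl -lnXn// ler_ln ?posrE ?exprn_gt0//; last by rewrite ltr_pwDl// mulr_ge0.
by have := sqr_ge0 r; rewrite sqrrD expr1n mul1r; lra.
Qed.

Lemma ln_quarter r : 0 <= r -> ln (1 + r) / 4 <= ln (1 + r / 4).
Proof.
move=> r0; have q0 : 0 <= r / 4 by rewrite divr_ge0.
have := ln_double q0; have q1 : 0 <= 2 * (r / 4) by rewrite mulr_ge0.
have := ln_double q1; have -> : 2 * (2 * (r / 4)) = r by field.
by lra.
Qed.

(** The minimum covers both signs of [b]: the lower bound on [t] serves b >= 0 and the upper bound b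
    < 0. *)
Lemma powR_comparable (b l t : R) : 0 < l -> l / 4 <= t -> t <= 2 * l ->
  Num.min (4 `^ (- b)) (2 `^ b) * l `^ b <= t `^ b.
Proof.
move=> l0 lt tl; have t0 : 0 < t by apply: lt_le_trans lt; rewrite divr_gt0.
have lb : 0 <= l `^ b by exact: powR_ge0.
have [b0|b0] := leP 0 b.
  apply: (@le_trans _ _ ((l / 4) `^ b)); last by rewrite powR_le_ge0// divr_ge0// ltW.
  by rewrite powR_divE// mulrC ler_wpM2l// -powRN ge_min lexx.
apply: (@le_trans _ _ ((2 * l) `^ b)); last by rewrite powR_le_le0// ltW.
by rewrite powRM_gt0// ler_wpM2r// ge_min lexx orbT.
Qed.

Lemma ln_powR_small C e g : 0 < e ->
  exists2 r0, 1 <= r0 & forall r, r0 <= r -> C * ln (1 + r) `^ g <= r `^ e.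
Proof.
move=> e0; pose g' := `|g| + 1; have g'0 : 0 < g' by rewrite ltr_wpDl.
(* With this [d] the bound ln r <= r^d / d raised to the power [g'] costs r^(e/2); the other half of
   r^e absorbs [C]. *)
pose d := e / (2 * g'); have d0 : 0 < d by rewrite divr_gt0// mulr_gt0.
pose C' := `|C| * (d `^ (- g') * 2 `^ (e / 2)) + 1.
have C'0 : 0 < C' by rewrite ltr_wpDl// mulr_ge0// mulr_ge0// powR_ge0.
pose r0 := Num.max (expR 1) (C' `^ (2 / e)).
have er0 : expR 1 <= r0 by rewrite le_max lexx.
have e1 : 1 <= expR 1 :> R by rewrite -[leLHS]expR0 ler_expR.
exists r0; first exact: le_trans er0.
move=> r r0r; have r1 : 1 <= r by rewrite (le_trans e1)// (le_trans er0).
have rp : 0 < r by exact: lt_le_trans r1.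
set l := ln (1 + r).
have l1 : 1 <= l.
  rewrite -[leLHS](expRK 1) ler_ln ?posrE ?expR_gt0//; last by rewrite addr_gt0.
  by rewrite (le_trans (le_trans er0 r0r))// lerDr.
have l0 : 0 <= l by exact: le_trans l1.
have lg : l `^ g <= d `^ (- g') * 2 `^ (e / 2) * r `^ (e / 2).
  apply: (@le_trans _ _ (l `^ g')).
    by apply: ler_powR => //; rewrite /g' (le_trans (ler_norm g))// lerDl.
  apply: (@le_trans _ _ (((2 * r) `^ d / d) `^ g')).
    apply: powR_le_ge0 => //; first exact: ltW.
    apply: (le_trans (ln_le_powR d0 _)); first by rewrite addr_gt0.
    have h1 : 0 <= 1 + r by rewrite addr_ge0// ltW.
    have h2 : 1 + r <= 2 * r by rewrite mulr_natl mulr2n lerD2r.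
    by rewrite ler_pM2r ?invr_gt0//; apply: powR_le_ge0 => //; exact: ltW.
  rewrite powR_divE// ?powR_gt0 ?mulr_gt0// -powRrM.
  have -> : d * g' = e / 2 by rewrite /d; field; rewrite gt_eqF.
  by rewrite powRM_gt0// powRN mulrC mulrA.
have re : C' <= r `^ (e / 2).
  have -> : C' = (C' `^ (2 / e)) `^ (e / 2).
    rewrite -powRrM (_ : 2 / e * (e / 2) = 1); last by field; rewrite gt_eqF.
    by rewrite powRr1// ltW.
  apply: powR_le_ge0; first by rewrite divr_ge0// ltW.
    exact: powR_ge0.
  by rewrite (le_trans _ r0r)// le_max lexx orbT.
have -> : r `^ e = r `^ (e / 2) * r `^ (e / 2) by rewrite -powR_addE//; congr (_ `^ _); field.
have rr : 0 <= r `^ (e / 2) by exact: powR_ge0.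
apply: (@le_trans _ _ (`|C| * l `^ g)); first by rewrite ler_wpM2r ?powR_ge0// ler_norm.
apply: (@le_trans _ _ (`|C| * (d `^ (- g') * 2 `^ (e / 2) * r `^ (e / 2)))).
  by rewrite ler_wpM2l.
rewrite mulrA ler_wpM2r// (le_trans _ re)// /C' lerDl.
exact: ler01.
Qed.

End powR_asymptotics.

Section kernel.
Context {R : realType} {n : nat}.
Variables (alpha beta : R).
Implicit Types x z : 'rV[R]_n.

Lemma Kab_ge0 z : 0 <= Kab alpha beta z.
Proof. by rewrite mulr_ge0 ?powR_ge0. Qed.

Definition kappa (r : R) : R := r `^ (- alpha) * ln (1 + r) `^ beta.

Lemma kappa_gt0 r : 0 < r -> 0 < kappa r.
Proof. by move=> r0; rewrite mulr_gt0 ?powR_gt0// ln_gt0_1D. Qed.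

(** Doubling or quartering the radius changes the logarithm by bounded factors. The range
    accommodates a displacement by r/4 from a point at distance between r/2 and 3r/2. *)
Lemma Kab_lower : 0 <= alpha -> exists2 c, 0 < c &
  forall r z, 0 < r -> r / 4 <= enorm z -> enorm z <= 2 * r ->
  c * kappa r <= Kab alpha beta z.
Proof.
move=> a0; pose c1 : R := Num.min (4 `^ (- beta)) (2 `^ beta).
have c10 : 0 < c1 by rewrite lt_min !powR_gt0.
exists (2 `^ (- alpha) * c1); first by rewrite mulr_gt0// powR_gt0.
move=> r z r0 rz zr; have z0 : 0 < enorm z by apply: lt_le_trans rz; rewrite divr_gt0.
rewrite /Kab /kappa mulrACA; apply: ler_pM.
- by rewrite mulr_ge0 ?powR_ge0.
- by rewrite mulr_ge0 ?powR_ge0// ltW.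
- rewrite -powRM_gt0//; apply: powR_le_le0 => //; by rewrite oppr_le0.
- apply: powR_comparable; first exact: ln_gt0_1D.
    apply: (le_trans (ln_quarter (ltW r0))).
    rewrite ler_ln ?posrE ?addr_gt0 ?divr_gt0//.
    by rewrite lerD2l.
  apply: le_trans (ln_double (ltW r0)).
  rewrite ler_ln ?posrE ?addr_gt0 ?mulr_gt0//.
  by rewrite lerD2l.
Qed.

Lemma measurable_Kab x :
  measurable_fun setT (fun t : n.-tuple (measurableTypeR R) => Kab alpha beta (x - rV_of_tuple t)).
Proof.
have E t : enorm (x - rV_of_tuple t) = enorm (rV_of_tuple t - x).
  by rewrite -enormN opprB.
rewrite /Kab; under eq_fun do rewrite E.
have ce := @continuous_enorm R n x.
apply: measurable_funM.
  apply: (measurableT_comp (measurable_powR (- alpha))).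
  exact: (measurable_continuous_rV ce).
apply: (measurableT_comp (measurable_powR beta)).
apply: (measurable_continuous_rV (f := fun y => ln (1 + enorm (y - x)))) => y.
apply: (@continuous_comp _ _ _ (fun y : 'rV[R]_n => 1 + enorm (y - x)) (@ln R)).
  apply: (contD (@cst_continuous _ _ _) ce).
by apply: continuous_ln; rewrite ltr_pwDl// enorm_ge0.
Qed.

Lemma measurable_Kab_powR x (p : R) (u : 'rV[R]_n -> R) : continuous u ->
  measurable_fun setT (fun t : n.-tuple (measurableTypeR R) =>
    (Kab alpha beta (x - rV_of_tuple t) * u (rV_of_tuple t) `^ p)%:E).
Proof.
move=> cu; apply/measurable_EFinP; apply: measurable_funM; first exact: measurable_Kab.
apply: (measurableT_comp (measurable_powR p)).
exact: measurable_continuous_rV.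
Qed.

End kernel.
Section integral_bounds.
Context {R : realType} {n : nat}.
Local Notation tupleR := (n.-tuple (measurableTypeR R)).
Local Notation mu := (@lebesgue_measure_tuple R n).
Implicit Types (f g u : 'rV[R]_n -> R).

Lemma integral_cube_ge (F : tupleR -> R) c (r k : R) : measurable_fun setT F ->
  (forall t, 0 <= F t) -> 0 <= r -> (forall t, cube c r t -> k <= F t) -> 0 <= k ->
  ((k * (2 * r) ^+ n)%:E <= \int[mu]_t (F t)%:E)%E.
Proof.
move=> mF F0 r0 kF k0; have mc := measurable_cube c r.
rewrite EFinM -(measure_cube c r0) -(integral_cst mu mc).
apply: (@le_trans _ _ (\int[mu]_(t in cube c r) (F t)%:E)%E); last first.
  apply: ge0_subset_integral => //; first exact/measurable_EFinP.
  by move=> t _; rewrite lee_fin.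
apply: ge0_le_integral => //.
by apply/measurable_EFinP; exact: measurable_funTS.
Qed.

Lemma cubeP c (r : R) (t : tupleR) :
  cube c r t <-> forall i, `|(rV_of_tuple t - c) 0 i| <= r.
Proof.
by split=> H i; have := H i; rewrite /= in_itv/= !mxE ler_distl.
Qed.

Lemma EFin_Rint f M : continuous f -> supp_in M f ->
  ((Rint f)%:E = \int[mu]_t (f (rV_of_tuple t))%:E)%E.
Proof.
move=> cf sf; rewrite /Rint /Rintegral fineK//.
by apply: integrable_fin_num => //; exact: integrable_compact_support cf sf.
Qed.

Lemma Rint_gt0 f M z : continuous f -> supp_in M f -> (forall x, 0 <= f x) ->
  0 < f z -> 0 < Rint f.
Proof.
move=> cf sf f0 fz; have fz2 : f z / 2 < f z by rewrite ltr_pdivrMr// ltr_pMr// ltr1n.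
have near_z : \forall y \near z, f z / 2 < f y by exact: (cvgr_gt _ (cf z)).
have /nbhs_ballP[r /= r0 Hr] := near_z.
have r2 : 0 < r / 2 by rewrite divr_gt0.
rewrite -lte_fin (EFin_Rint cf sf).
apply: (@lt_le_trans _ _ (f z / 2 * (2 * (r / 2)) ^+ n)%:E).
  by rewrite lte_fin mulr_gt0 ?divr_gt0// exprn_gt0// mulr_gt0.
apply: (@integral_cube_ge (fun t => f (rV_of_tuple t)) z) => //.
- exact: measurable_continuous_rV.
- exact: ltW.
- move=> t /cubeP tz; apply/ltW/Hr; split=> // i j.
  rewrite /ball/= ord1 (le_lt_trans (y := r / 2))//.
    by have := tz j; rewrite !mxE distrC.
  by rewrite ltr_pdivrMr// ltr_pMr// ltr1n.
- by rewrite divr_ge0// ltW.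
Qed.

Lemma Rint_le_on f g M (A : set tupleR) : continuous f -> supp_in M f -> continuous g ->
  measurable A -> (forall t, A t -> `|f (rV_of_tuple t)| <= g (rV_of_tuple t)) ->
  (forall t, ~ A t -> f (rV_of_tuple t) = 0) ->
  ((Rint f)%:E <= \int[mu]_(t in A) (g (rV_of_tuple t))%:E)%E.
Proof.
move=> cf sf cg mA fg f0.
have mf := measurable_continuous_rV cf. have mg := measurable_continuous_rV cg.
rewrite (EFin_Rint cf sf); apply: (le_trans (lee_abs _)).
apply: (@le_trans _ _ (\int[mu]_t `|(f (rV_of_tuple t))%:E|)%E).
  by apply: le_abse_integral => //; exact/measurable_EFinP.
rewrite [leLHS](_ : _ = \int[mu]_(t in A) `|(f (rV_of_tuple t))%:E|)%E; last first.
  rewrite [RHS]integral_mkcond; apply: eq_integral => t _.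
  rewrite patchE; case: ifPn => //; rewrite notin_setE => /f0 -> //.
  by rewrite abse0.
apply: ge0_le_integral => //.
- by apply/measurable_EFinP; apply: (measurableT_comp (@normr_measurable _ setT));
    exact: measurable_funTS.
- by apply/measurable_EFinP; exact: measurable_funTS.
Qed.

End integral_bounds.

(** * Nonnegativity from small averages *)

Section superharmonic_nonneg.
Context {R : realType} {n : nat}.
Local Notation tupleR := (n.-tuple (measurableTypeR R)).
Local Notation mu := (@lebesgue_measure_tuple R n).
Implicit Types (u w : 'rV[R]_n -> R).
Local Notation h := (n%:R / 2 : R).

Definition annulus (x0 : 'rV[R]_n) (b : R) : set tupleR :=
  [set t | b <= sqn (rV_of_tuple t - x0) <= 2 * b].

Lemma measurable_sqn (x0 : 'rV[R]_n) :
  measurable_fun setT (fun t : tupleR => sqn (rV_of_tuple t - x0)).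
Proof. exact: (measurable_continuous_rV (@continuous_sqn _ _ x0)). Qed.

Lemma measurable_annulus x0 b : measurable (annulus x0 b).
Proof.
have := @measurable_sqn x0 measurableT _ (measurable_itv `[b, 2 * b]).
rewrite setTI; congr measurable; apply/seteqP; split=> t /=;
  by rewrite in_itv/=.
Qed.

Lemma measure_annulus x0 (r : R) : 0 < r ->
  (mu (annulus x0 (r ^+ 2)) <= ((3 ^+ n) * r ^+ n)%:E)%E.
Proof.
move=> r0; have q : Num.sqrt (2 * r ^+ 2) <= 3 / 2 * r.
  have r3 : 0 <= 3 / 2 * r by rewrite mulr_ge0// ltW.
  rewrite -(ger0_norm r3) -sqrtr_sqr ler_sqrt ?sqr_ge0//.
  by rewrite exprMn; have := exprn_gt0 2 r0; lra.
have q0 : 0 <= 3 / 2 * r by rewrite mulr_ge0// ltW.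
apply: (@le_trans _ _ (mu (cube x0 (3 / 2 * r)))).
  apply: le_measure; rewrite ?inE; [exact: measurable_annulus|exact: measurable_cube|].
  move=> t /andP[_ tb]; apply/cubeP => i; apply: le_trans q.
  by rewrite (le_trans (coord_le_enorm _ _))// /enorm ler_wsqrtr.
by rewrite measure_cube// lee_fin -exprMn (_ : 2 * (3 / 2 * r) = 3 * r)//; field.
Qed.

(** Where u > eta one has u <= eta^(1-p) u^p, and u^p is controlled by the finite integral of K u^p
    divided by kappa(r). Since alpha < n, r^n kappa(r) tends to infinity whatever [beta] is, so this
    part is o(r^n); where u <= eta the volume of the annulus suffices. *)
Lemma annulus_average_small alpha beta (p : R) u x0 : 0 <= alpha -> alpha < n%:R -> 1 <= p ->
  continuous u -> (forall x, 0 <= u x) -> (Kconv alpha beta p u x0 < +oo)%E ->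
  forall eps B, 0 < eps -> exists r, [/\ B <= r, 1 <= r &
    (\int[mu]_(t in annulus x0 (r ^+ 2)) (u (rV_of_tuple t))%:E <= (eps * r ^+ n)%:E)%E].
Proof.
move=> a0 an p1 cu u0 Kfin eps B eps0.
pose Kf t := Kab alpha beta (x0 - rV_of_tuple t) * u (rV_of_tuple t) `^ p.
have Kf0 t : 0 <= Kf t by rewrite mulr_ge0 ?Kab_ge0 ?powR_ge0.
have mKf : measurable_fun setT (fun t => (Kf t)%:E) by exact: measurable_Kab_powR.
have IKge0 : (0 <= Kconv alpha beta p u x0)%E.
  by rewrite /Kconv /integral_rV; apply: integral_ge0 => t _; rewrite lee_fin; exact: Kf0.
pose I := fine (Kconv alpha beta p u x0).
have IE : Kconv alpha beta p u x0 = I%:E by rewrite fineK// ge0_fin_numE.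
have I0 : 0 <= I by rewrite -lee_fin -IE.
have [c c0 Kc] := @Kab_lower R n alpha beta a0.
(* The annulus has measure at most 3^n r^n, so the part u <= eta uses half of [eps]; [C] is chosen
   to fit the other half. *)
pose eta := eps / (2 * 3 ^+ n).
have t0 : 0 < (3 : R) ^+ n by rewrite exprn_gt0.
have eta0 : 0 < eta by rewrite divr_gt0// mulr_gt0.
pose C := eta `^ (1 - p) * I / c * (2 / eps).
have na : 0 < n%:R - alpha by rewrite subr_gt0.
have [r0 r01 Hr] := ln_powR_small C (- beta) na.
pose r := Num.max B r0; have rr0 : r0 <= r by rewrite le_max lexx orbT.
have r1 : 1 <= r by exact: le_trans rr0.
have rp : 0 < r by exact: lt_le_trans r1.
exists r; split=> //; first by rewrite le_max lexx.
have kr := kappa_gt0 alpha beta rp.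
pose d := eta `^ (1 - p) / (c * kappa alpha beta r).
have d0 : 0 <= d by rewrite divr_ge0 ?powR_ge0// mulr_ge0 ?ltW.
have ub t : annulus x0 (r ^+ 2) t -> u (rV_of_tuple t) <= eta + d * Kf t.
  move=> /andP[tb1 tb2]; set y := rV_of_tuple t; set z := x0 - y.
  have ez : enorm z = Num.sqrt (sqn (y - x0)) by rewrite -enormN opprB.
  have z1 : r / 4 <= enorm z.
    rewrite ez; apply: (@le_trans _ _ r).
      by rewrite ler_pdivrMr// ler_peMr ?ler1n// ltW.
    by rewrite -[leLHS](ger0_norm (ltW rp)) -sqrtr_sqr ler_wsqrtr.
  have z2 : enorm z <= 2 * r.
    have r2 : 0 <= 2 * r by rewrite mulr_ge0// ltW.
    rewrite ez -(ger0_norm r2) -sqrtr_sqr ler_wsqrtr// (le_trans tb2)//.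
    by rewrite exprMn; have := exprn_gt0 2 rp; lra.
  have Kz := Kc _ _ rp z1 z2.
  have [ue|ue] := leP (u y) eta.
    by rewrite (le_trans ue)// lerDl mulr_ge0.
  have up : 0 < u y by exact: lt_trans ue.
  have U : u y <= eta `^ (1 - p) * u y `^ p.
    have E1 : u y = u y `^ (1 - p) * u y `^ p.
      by rewrite -powR_addE// subrK powRr1// ltW.
    rewrite {1}E1 ler_wpM2r ?powR_ge0//; apply: powR_le_le0 => //; last exact: ltW.
    by rewrite subr_le0.
  apply: (le_trans U); apply: (@le_trans _ _ (d * Kf t)); last by rewrite lerDr ltW.
  rewrite /d /Kf -/y -/z -mulrA ler_wpM2l ?powR_ge0//.
  have ckr := mulr_gt0 c0 kr.
  rewrite ler_pdivlMl//.
  by rewrite ler_wpM2r ?powR_ge0.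
have mA := measurable_annulus x0 (r ^+ 2).
apply: (@le_trans _ _ (\int[mu]_(t in annulus x0 (r ^+ 2)) (eta%:E + d%:E * (Kf t)%:E))%E).
  apply: ge0_le_integral => //.
  - by move=> t _; rewrite lee_fin.
  - apply/measurable_EFinP; apply: measurable_funTS; exact: measurable_continuous_rV.
  - apply: emeasurable_funD; first exact: measurable_cst.
    by apply: measurable_funeM; exact: measurable_funTS.
have e1 t : annulus x0 (r ^+ 2) t -> (0 <= eta%:E)%E by rewrite lee_fin ltW.
have e2 t : annulus x0 (r ^+ 2) t -> (0 <= d%:E * (Kf t)%:E)%E.
  by rewrite -EFinM lee_fin mulr_ge0.
have e3 t : annulus x0 (r ^+ 2) t -> (0 <= (Kf t)%:E)%E by rewrite lee_fin.
have mKA : measurable_fun (annulus x0 (r ^+ 2)) (fun t => (Kf t)%:E).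
  exact: measurable_funTS.
rewrite (ge0_integralD mu mA e1 (measurable_cst _) e2 (measurable_funeM _ mKA)).
rewrite integral_cst// (ge0_integralZl_EFin mu mA e3 mKA d0).
have -> : eps * r ^+ n = eta * (3 ^+ n * r ^+ n) + eps / 2 * r ^+ n.
  by rewrite /eta; field; rewrite gt_eqF.
rewrite EFinD leeD//.
  have e0 : (0 <= eta%:E)%E by rewrite lee_fin ltW.
  by rewrite [leRHS]EFinM; exact: (lee_wpmul2l e0 (measure_annulus x0 rp)).
apply: (@le_trans _ _ (d%:E * I%:E)%E).
  have ed : (0 <= d%:E)%E by rewrite lee_fin.
  apply: (lee_wpmul2l ed); rewrite -IE /Kconv /integral_rV; apply: ge0_subset_integral => // t _.
  by rewrite lee_fin; exact: Kf0.
rewrite -EFinM lee_fin.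
have := Hr _ rr0; rewrite -powR_mulrn; last exact: ltW.
have -> : r `^ (n%:R - alpha) = r `^ n%:R * r `^ (- alpha) by rewrite -powR_addE.
move=> H; rewrite /d.
have lr := ln_gt0_1D rp.
have lb := powR_gt0 beta lr.
have rna := powR_gt0 (- alpha) rp.
rewrite powRN in H.
have {}H : C <= r `^ n%:R * (r `^ (- alpha) * ln (1 + r) `^ beta).
  by move: H; rewrite ler_pdivrMr// mulrA.
rewrite -/(kappa alpha beta r) in H.
have ckr := mulr_gt0 c0 kr.
rewrite mulrAC ler_pdivrMr//.
have {}H : C * (eps / 2 * c) <= r `^ n%:R * kappa alpha beta r * (eps / 2 * c).
  by rewrite ler_wpM2r// mulr_ge0 ?divr_ge0// ltW.
have E : C * (eps / 2 * c) = eta `^ (1 - p) * I.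
  by rewrite /C; field; rewrite !gt_eqF.
by rewrite -E (le_trans H)// le_eqVlt; apply/orP; left; apply/eqP; ring.
Qed.

(** If w(x0) < 0, the shell integrals of [w] around [x0] stay below a fixed negative number as the
    shell grows. But by Green's formula and lam u >= 0 such an integral is at least - int u
    Delta(shell), which is bounded by r^(-2) times an annulus average of [u], up to a constant,
    hence small. *)
Lemma screened_superharmonic_nonneg (i0 : 'I_n) (lam : R) u : 0 <= lam -> classC 4 u ->
  (forall x, 0 <= u x) ->
  (forall x0 eps B, 0 < eps -> exists r, [/\ B <= r, 1 <= r &
    (\int[mu]_(t in annulus x0 (r ^+ 2)) (u (rV_of_tuple t))%:E <= (eps * r ^+ n)%:E)%E]) ->
  (forall x, laplacian (fun y => lam * u y - laplacian u y) x <= 0) ->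
  forall x, 0 <= lam * u x - laplacian u x.
Proof.
move=> lam0 cu u0 small lw x0.
have cu2 : classC 2 u by do 2 apply: classCS.
pose w := fun y => lam * u y - laplacian u y.
have cw : classC 2 w.
  rewrite (_ : w = fun y => lam * u y + -1 * laplacian u y).
    exact: (classCD (classCZ lam cu2) (classCZ (-1) (classC_laplacian cu))).
  by apply/funext => y; rewrite mulN1r.
have lw' : forall x, laplacian w x <= 0 by [].
have wE y : w y = lam * u y - laplacian u y by [].
rewrite -wE; move: w cw lw' wE => w cw {}lw wE.
rewrite leNgt; apply/negP => w0.
have [chi [chi1 [chi2 [dchi dchi1 cchi2 [chi_ge0 chi_mid] chi_out]]]] := @C2_bump R.
have cwc := classC_continuous cw.
have near_x0 : \forall y \near x0, w y < 0 by exact: (cvgr_lt _ (cwc x0)).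
have /nbhs_ballP[e /= e0 He] := near_x0.
(* The shell of parameter [a] lives where |x - x0|^2 <= 2 a < e^2, inside the neighbourhood on which
   w < 0. *)
pose a := e ^+ 2 / 4; have a0 : 0 < a by rewrite divr_gt0// exprn_gt0.
have wneg x : sqn (x - x0) <= 2 * a -> w x < 0.
  move=> xa; apply: He; split=> // i j; rewrite ord1 /ball/= distrC.
  have := coord_le_enorm (x - x0) j; rewrite !mxE => /le_lt_trans; apply.
  rewrite /enorm -/(sqn _) -(ger0_norm (ltW e0)) -sqrtr_sqr ltr_sqrt ?exprn_gt0//.
  apply: (le_lt_trans xa); have := exprn_gt0 2 e0; rewrite /a; lra.
pose sh r := shell chi x0 r.
have csh r : classC 2 (sh r) := classC_shell dchi dchi1 cchi2 x0 r.
have cshc r := classC_continuous (csh r).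
pose M r := enorm x0 + Num.sqrt (2 * r).
have ssh r : 0 < r -> supp_in (M r) (sh r).
  by move=> r0; exact: (supp_in_shell chi_out).
have sh_out r x : 0 < r -> ~ (r <= sqn (x - x0) <= 2 * r) ->
    sh r x = 0 /\ laplacian (sh r) x = 0.
  move=> r0 out; have rn0 : r != 0 by rewrite gt_eqF.
  have [|c0 c1 c2] := chi_out (sqn (x - x0) / r).
    have [rs|sr] := leP r (sqn (x - x0)); last by left; rewrite ler_pdivrMr// mul1r ltW.
    right; rewrite ler_pdivlMr// leNgt; apply/negP => s2; apply: out.
    by rewrite rs ltW.
  split; first by rewrite /sh /shell c0 mulr0.
  by rewrite (laplacian_shell dchi dchi1) c1 c2 !mulr0 addr0 mulr0.
pose J := Rint (fun x => -1 * (w x * sh a x)).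
have swa : supp_in (M a) (fun x => w x * sh a x) by apply: supp_inMr; exact: ssh.
have cwa := contM cwc (cshc a).
have J0 : 0 < J.
  pose z := x0 + Num.sqrt (3 / 2 * a) *: dirv i0.
  have za : sqn (z - x0) = 3 / 2 * a.
    rewrite /z addrC addKr /sqn (bigD1 i0)//= big1 => [|j /negbTE ji].
      by rewrite !mxE !eqxx mulr1 addr0 sqr_sqrtr// mulr_ge0 ?ltW.
    by rewrite !mxE eqxx ji mulr0 expr0n.
  apply: (@Rint_gt0 _ _ _ (M a) z).
  - exact: (contM (@cst_continuous _ _ _) cwa).
  - by apply: supp_inMr.
  - move=> x; rewrite mulN1r oppr_ge0.
    have [xa|xa] := leP (sqn (x - x0)) (2 * a).
      by apply: mulr_le0_ge0; [exact/ltW/wneg|exact: (shell_ge0 chi_ge0)].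
    have [|-> _] := sh_out a x a0; last by rewrite mulr0.
    by move=> /andP[_]; rewrite leNgt xa.
  - rewrite mulN1r oppr_gt0 pmulr_llt0; first by apply: wneg; rewrite za; lra.
    rewrite /sh /shell za (_ : 3 / 2 * a / a = 3 / 2); last by rewrite mulfK ?gt_eqF.
    by rewrite mulr_gt0// powR_gt0.
have JE : Rint (fun x => w x * sh a x) = - J.
  by rewrite /J (RintZ (-1) cwa swa) mulN1r opprK.
(* [q] is the modulus of the rescaled Laplacian of a shell; being continuous and supported in
   [1, 2], it has a bound [C1] valid for all radii at once. *)
pose q t := `|4 * t * chi2 t + 2 * n%:R * chi1 t|.
have cq : continuous q.
  move=> t; apply: (@continuous_comp _ _ _
    (fun t : R => 4 * t * chi2 t + 2 * n%:R * chi1 t) Num.norm); last exact: norm_continuous.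
  apply: (contD (contM (contM (@cst_continuous _ _ _) _) cchi2)
    (contM (@cst_continuous _ _ _) (isd_continuous dchi1))) => s; exact: cvg_id.
have [tm _ qm] := EVT_max (ler1n R 2) (continuous_subspaceT cq).
pose C1 := q tm; have C10 : 0 <= C1 by rewrite /C1 /q.
have qC t : q t <= C1.
  have [t1|t1] := leP t 1.
    by have [_ e1 e2] := chi_out t (or_introl t1); rewrite {1}/q e1 e2 !mulr0 addr0 normr0.
  have [t2|t2] := leP 2 t.
    by have [_ e1 e2] := chi_out t (or_intror t2); rewrite {1}/q e1 e2 !mulr0 addr0 normr0.
  by apply: qm; rewrite in_itv/= !ltW.
have [|r [ar r1 Hr]] := small x0 (J / (C1 + 1)) a; first by rewrite divr_gt0// ltr_wpDl.
have rp : 0 < r by exact: lt_le_trans r1.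
pose b := r ^+ 2; have b0 : 0 < b by rewrite exprn_gt0.
have b1 : 1 <= b by rewrite exprn_ege1.
have ab : a <= b by rewrite (le_trans ar)// /b expr2 ler_peMl// ltW.
have H1 := shell_le dchi dchi1 cchi2 chi_ge0 chi_out x0 cw lw a0 ab.
rewrite -/(sh b) -/(sh a) in H1.
have clu := continuous_laplacian cu2.
have cuc := classC_continuous cu2.
have s1 : supp_in (M b) (fun x => u x * sh b x) by apply: supp_inMr; exact: ssh.
have s2 : supp_in (M b) (fun x => sh b x * laplacian u x) by apply: supp_inMl; exact: ssh.
have H2 : Rint (fun x => w x * sh b x) =
    lam * Rint (fun x => u x * sh b x) - Rint (fun x => u x * laplacian (sh b) x).
  rewrite -(green (csh b) cu2 (ssh b b0)).
  have s1' : supp_in (M b) (fun x => lam * (u x * sh b x)) by apply: supp_inMr.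
  rewrite -(RintZ lam (contM cuc (cshc b)) s1).
  rewrite -(RintB (contM (@cst_continuous _ _ lam) (contM cuc (cshc b)))
    (contM (cshc b) clu) s1' s2).
  congr Rint; apply/funext => x; rewrite wE mulrBl mulrA; congr (_ - _); exact: mulrC.
have H3 : 0 <= Rint (fun x => u x * sh b x).
  by apply: Rintegral_ge0 => t _; rewrite mulr_ge0 ?(shell_ge0 chi_ge0).
have E : b `^ (- h) = r ^- n.
  by rewrite /b -powR_mulrn ?ltW// -powRrM mulrN mulrC divfK// powR_invn// ltW.
have H4 : ((Rint (fun x => u x * laplacian (sh b) x))%:E <=
    \int[mu]_(t in annulus x0 (r ^+ 2)) ((b `^ (- h) / b * C1) * u (rV_of_tuple t))%:E)%E.
  apply: (@Rint_le_on _ _ (fun x => u x * laplacian (sh b) x)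
    (fun x => (b `^ (- h) / b * C1) * u x) (M b)).
  - exact: (contM cuc (continuous_laplacian (csh b))).
  - have sl := supp_in_laplacian (csh b) (ssh b b0).
    by move=> x i Mx; rewrite (sl _ _ Mx) mulr0.
  - exact: (contM (@cst_continuous _ _ _) cuc).
  - exact: measurable_annulus.
  - move=> t _; rewrite normrM ger0_norm// mulrC ler_wpM2r//.
    rewrite (laplacian_shell dchi dchi1) normrM ger0_norm; last first.
      by rewrite mulr_ge0 ?powR_ge0// invr_ge0 ltW.
    by rewrite ler_wpM2l ?mulr_ge0 ?powR_ge0 ?invr_ge0 ?(ltW b0)//; exact: qC.
  - by move=> t out; have [_ ->] := sh_out b _ b0 out; rewrite mulr0.
have k0 : 0 <= b `^ (- h) / b * C1.
  by rewrite mulr_ge0// mulr_ge0 ?powR_ge0// invr_ge0 ltW.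
have H5 : Rint (fun x => u x * laplacian (sh b) x) <= C1 * (J / (C1 + 1)).
  rewrite -lee_fin (le_trans H4)//.
  under eq_integral do rewrite EFinM.
  rewrite ge0_integralZl_EFin//; last 3 first.
  - exact: measurable_annulus.
  - by move=> t _; rewrite lee_fin.
  - apply/measurable_EFinP; apply: measurable_funTS; exact: measurable_continuous_rV.
  apply: (@le_trans _ _ ((b `^ (- h) / b * C1)%:E * (J / (C1 + 1) * r ^+ n)%:E)%E).
    have ek : (0 <= (b `^ (- h) / b * C1)%:E)%E by rewrite lee_fin.
    exact: (lee_wpmul2l ek Hr).
  rewrite -EFinM lee_fin E.
  have rn : 0 < r ^+ n by rewrite exprn_gt0.
  have JC : 0 <= J / (C1 + 1) by rewrite divr_ge0 ?ltW// ltr_wpDl.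
  rewrite (_ : _ * _ = b^-1 * (C1 * (J / (C1 + 1)))); last by field; rewrite !gt_eqF// ltr_wpDl.
  have bi : b^-1 <= 1 by rewrite invf_le1.
  by apply: ler_piMl => //; exact: mulr_ge0.
have : C1 * (J / (C1 + 1)) < J.
  by rewrite mulrA ltr_pdivrMr ?ltr_wpDl// mulrC ltr_pM2l// ltrDl.
move: H1; rewrite H2 JE; move: H5 H3; move: (Rint _) (Rint _) => A B AC B0.
by have := mulr_ge0 lam0 B0; lra.
Qed.

End superharmonic_nonneg.
Lemma contB_at (R : realType) (T : topologicalType) (f g : T -> R) (x : T) :
  {for x, continuous f} -> {for x, continuous g} -> {for x, continuous (fun y => f y - g y)}.
Proof. by move=> cf cg; apply: continuousB; [exact: cf|exact: cg]. Qed.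

(** * Comparison principles *)

Section comparison.
Context {R : realType} {n : nat}.
Implicit Types (u w g : 'rV[R]_n -> R) (x c : 'rV[R]_n).

Lemma compact_annulus c (a b : R) : compact [set x : 'rV[R]_n | a <= sqn (x - c) <= b].
Proof.
apply: (subclosed_compact _ (compact_cube (r := Num.sqrt b) (c := c))).
  have -> : [set x : 'rV[R]_n | a <= sqn (x - c) <= b] =
      (fun x => sqn (x - c)) @^-1` `[a, b].
    by apply/seteqP; split=> x /=; rewrite in_itv.
  apply: closed_comp; last exact: itv_closed.
  by move=> x _; exact: continuous_sqn.
move=> x /andP[_ xb] i /=; rewrite in_itv/=.
rewrite -ler_distl; have := coord_le_enorm (x - c) i; rewrite !mxE => H.
by apply: (le_trans H); rewrite /enorm ler_wsqrtr.
Qed.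

Lemma nbhs_annulus c (a b : R) x : a < sqn (x - c) < b ->
  nbhs x [set y : 'rV[R]_n | a <= sqn (y - c) <= b].
Proof.
move=> /andP[ax xb].
have H1 : \forall y \near x, a < sqn (y - c) by exact: (cvgr_gt _ (@continuous_sqn _ _ c x)).
have H2 : \forall y \near x, sqn (y - c) < b by exact: (cvgr_lt _ (@continuous_sqn _ _ c x)).
by apply: filterS2 H1 H2 => y /ltW ay /ltW yb /=; rewrite ay.
Qed.

(** With a = -1 the set is a closed ball, the inner sphere being empty, so one statement serves
    balls and annuli. *)
Lemma minimum_principle_annulus g c (a b : R) :
  (forall x, a <= sqn (x - c) <= b -> {for x, continuous g}) ->
  (forall x, a <= sqn (x - c) <= b -> g x < 0 ->
    a < sqn (x - c) < b /\ exists2 L : R, is_lap g x L & L < 0) ->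
  forall x, a <= sqn (x - c) <= b -> 0 <= g x.
Proof.
move=> cg H x Dx; apply: (minimum_principle (@compact_annulus c a b)) => //.
  by apply: continuous_in_subspaceT => y; rewrite inE => /cg.
by move=> y /= Dy /(H _ Dy)[/nbhs_annulus ? ?].
Qed.

Lemma is_lap_paraboloid (k l : R) c x :
  is_lap (fun y : 'rV[R]_n => k + l * sqn (y - c)) x (2 * n%:R * l).
Proof.
have -> : 2 * n%:R * l = 4 * sqn (x - c) * 0 + 2 * n%:R * l by rewrite mulr0 add0r.
have D (s : R) : is_derive s (1 : R) (fun s => k + l * s) l.
  apply: (is_derive_eq (isdD (isd_cst k s (1 : R)) (isdZ l (is_derive_id s (1 : R))))).
  by rewrite add0r mulr1.
have near_D : \forall s \near sqn (x - c), is_derive (s : R) (1 : R) (fun s => k + l * s) l.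
  by near=> s; exact: D.
exact: (is_lap_radial (h := fun s => k + l * s) near_D (isd_cst l _ _)).
Unshelve. all: by end_near. Qed.

Lemma continuous_paraboloid (k l : R) c : continuous (fun y : 'rV[R]_n => k + l * sqn (y - c)).
Proof.
exact: (contD (@cst_continuous _ _ _) (contM (@cst_continuous _ _ _) (@continuous_sqn _ _ c))).
Qed.

(** [w] is compared with the paraboloid equal to [b0] on the sphere and of Laplacian -F. *)
Lemma superharmonic_ball w c (rho F b0 : R) : (0 < n)%N -> 0 <= rho -> classC 2 w ->
  (forall x, sqn (x - c) <= rho -> F <= - laplacian w x) ->
  (forall x, sqn (x - c) = rho -> b0 <= w x) ->
  forall x, sqn (x - c) <= rho -> b0 + F * (rho - sqn (x - c)) / (2 * n%:R) <= w x.
Proof.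
move=> n0 rho0 cw wF wb x xr.
have n2 : 0 < 2 * n%:R :> R by rewrite mulr_gt0// ltr0n.
apply/ler_addgt0Pr => e e0.
(* Lowering [F] by [eta] makes the inequality between the Laplacians strict, as the minimum
   principle requires; the loss on the ball is at most [e]. *)
pose eta := e * (2 * n%:R) / (rho + 1); have r1 : 0 < rho + 1 by rewrite ltr_wpDl.
have eta0 : 0 < eta by rewrite divr_gt0// mulr_gt0.
pose F' := F - eta; pose l := F' / (2 * n%:R).
pose g y := w y - (b0 + l * rho + (- l) * sqn (y - c)).
have G : 0 <= g x.
  have Dx : -1 <= sqn (x - c) <= rho by rewrite xr (le_trans _ (sqn_ge0 _)).
  apply: (@minimum_principle_annulus g c (-1) rho) Dx.
  - have cg : continuous g.
      exact: (contB (classC_continuous cw) (@continuous_paraboloid _ _ _)).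
    by move=> y _; exact: cg.
  move=> y /andP[_ yr] gy; have ynr : sqn (y - c) != rho.
    apply/eqP => E; have := wb _ E; move: gy; rewrite /g E mulNr addrK.
    by rewrite subr_lt0 ltNge => /negP.
  have ylt : sqn (y - c) < rho by rewrite lt_neqAle ynr.
  have L := is_lapB (classC_lap y cw) (is_lap_paraboloid (b0 + l * rho) (- l) c y).
  have Llt : laplacian w y - 2 * n%:R * - l < 0.
    have := wF _ yr; rewrite mulrN opprK /l [2 * _ * _]mulrC divfK ?gt_eqF//.
    by rewrite /F'; move: (laplacian w y) => D; lra.
  split; last by exists (laplacian w y - 2 * n%:R * - l).
  by rewrite ylt (lt_le_trans _ (sqn_ge0 _))// oppr_lt0.
have s0 := sqn_ge0 (x - c).
have key : eta * (rho - sqn (x - c)) / (2 * n%:R) <= e.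
  have -> : eta * (rho - sqn (x - c)) / (2 * n%:R) = e * ((rho - sqn (x - c)) / (rho + 1)).
    by rewrite /eta; field; rewrite !gt_eqF// ltr0n.
  by apply: ler_piMr; [exact: ltW|rewrite ler_pdivrMr// mul1r; lra].
move: G; rewrite /g /l /F'.
have -> : b0 + (F - eta) / (2 * n%:R) * rho + - ((F - eta) / (2 * n%:R)) * sqn (x - c) =
  b0 + F * (rho - sqn (x - c)) / (2 * n%:R) - eta * (rho - sqn (x - c)) / (2 * n%:R).
  by field; rewrite gt_eqF// ltr0n.
move: (eta * _ / _) (F * _ / _) (w x) key => A B W; lra.
Qed.

(** [u] is compared with the paraboloid k (1 - |x - c|^2), zero on the unit sphere, with [k] fixed
    by k (2 n + lam) = mu0. Where [u] lies below it, Delta u <= lam u - mu0 < -2 n k, the Laplacian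
    of the paraboloid. *)
Lemma screened_lower_bound (lam mu0 : R) u c : 0 < lam -> 0 <= mu0 -> classC 2 u ->
  (forall x, 0 <= u x) ->
  (forall x, sqn (x - c) <= 1 -> mu0 <= lam * u x - laplacian u x) ->
  mu0 / (2 * n%:R + lam) <= u c.
Proof.
move=> lam0 mu00 cu u0 um; pose k := mu0 / (2 * n%:R + lam).
have N0 : 0 < 2 * n%:R + lam by rewrite ltr_wpDl// mulr_ge0.
have k0 : 0 <= k by rewrite divr_ge0// ltW.
have kE : k * (2 * n%:R + lam) = mu0 by rewrite /k divfK// gt_eqF.
pose g y := u y - (k + - k * sqn (y - c)).
have cg : continuous g.
  exact: (contB (classC_continuous cu) (@continuous_paraboloid _ _ _)).
suff : 0 <= g c by rewrite /g subrr sqn0 mulr0 addr0 subr_ge0.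
apply: (@minimum_principle_annulus g c (-1) 1); last by rewrite subrr sqn0; lra.
  by move=> y _; exact: cg.
move=> y /andP[_ y1] gy; have s0 := sqn_ge0 (y - c).
split.
  apply/andP; split; first by apply: lt_le_trans s0; lra.
  rewrite lt_neqAle y1 andbT; apply/eqP => E; move: gy; rewrite /g E.
  by rewrite mulr1 subrr subr0 ltNge u0.
exists (laplacian u y - 2 * n%:R * - k).
  exact: (is_lapB (classC_lap y cu) (is_lap_paraboloid k (- k) c y)).
have := um _ y1; move: gy; rewrite /g; move: (u y) (laplacian u y) => U D gy H.
have H1 : 0 <= k * sqn (y - c) by rewrite mulr_ge0.
have H2 : 0 < lam * (k - k * sqn (y - c) - U) by rewrite mulr_gt0//; lra.
have H3 := mulr_ge0 (ltW lam0) H1.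
rewrite -kE in H; nra.
Qed.

(** The minimum principle is applied to w + d - h on an annulus whose outer sphere lies where h <=
    d, so that w >= 0 settles the outer boundary; then d tends to 0. *)
Lemma exterior_comparison w c (a : R) (h h1 h2 : R -> R) : classC 2 w ->
  (forall x, 0 <= w x) ->
  (forall s, a <= s -> is_derive s (1 : R) h (h1 s)) ->
  (forall s, a < s -> is_derive s (1 : R) h1 (h2 s)) ->
  (forall x, a < sqn (x - c) -> laplacian w x <
     4 * sqn (x - c) * h2 (sqn (x - c)) + 2 * n%:R * h1 (sqn (x - c))) ->
  (forall d, 0 < d -> exists S, forall s, S <= s -> h s <= d) ->
  (forall x, sqn (x - c) = a -> h a <= w x) ->
  forall x, a <= sqn (x - c) -> h (sqn (x - c)) <= w x.
Proof.
move=> cw w0 dh dh1 lw hd ha x ax; apply/ler_addgt0Pr => d d0.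
have [S HS] := hd d d0.
pose b := Num.max S (sqn (x - c) + 1).
have xb : sqn (x - c) <= b by rewrite le_max lerDl ler01 orbT.
pose g y := w y + d - h (sqn (y - c)).
suff : 0 <= g x by rewrite /g subr_ge0.
apply: (@minimum_principle_annulus g c a b); last by rewrite ax.
  move=> y /andP[ay _].
  apply: (@contB_at _ _ (fun y => w y + d) (fun y : 'rV[R]_n => h (sqn (y - c))) y).
    exact: (contD (classC_continuous cw) (@cst_continuous _ _ _)).
  apply: (@continuous_comp _ _ _ (fun y : 'rV[R]_n => sqn (y - c)) h).
    exact: continuous_sqn.
  by apply/differentiable_continuous/derivable1_diffP; have [] := dh _ ay.
move=> y /andP[ay yb] gy.
have ay' : a < sqn (y - c).
  rewrite lt_neqAle ay andbT; apply/eqP => E; have := ha y (esym E).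
  by rewrite E; move: gy; rewrite /g; lra.
split.
  rewrite ay' /= lt_neqAle yb andbT; apply/eqP => E.
  have : h (sqn (y - c)) <= d by apply: HS; rewrite E le_max lexx.
  by have := w0 y; move: gy; rewrite /g; lra.
exists (laplacian w y + 0 - (4 * sqn (y - c) * h2 (sqn (y - c)) + 2 * n%:R * h1 (sqn (y - c)))).
  apply: (is_lapB (is_lapD (classC_lap y cw) (is_lap_cst d y))).
  apply: is_lap_radial; last exact: dh1.
  have near_a : \forall s \near sqn (y - c), a < s by exact: lt_nbhsr.
  by apply: filterS near_a => s /ltW; exact: dh.
by rewrite addr0 subr_lt0; exact: lw.
Qed.

Lemma sphere_minimum w c (r : R) : (0 < n)%N -> 0 <= r -> continuous w ->
  exists2 z, sqn (z - c) = r & forall x, sqn (x - c) = r -> w z <= w x.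
Proof.
move=> n0 r0 cw.
have [|z] := @EVT_min_rV R n w _ _ (@compact_annulus c r r) (continuous_subspaceT cw).
  exists (c + Num.sqrt r *: dirv (Ordinal n0)) => /=.
  rewrite addrC addKr (_ : sqn _ = r) ?lexx// /sqn (bigD1 (Ordinal n0))//= big1.
    by rewrite !mxE !eqxx mulr1 addr0 sqr_sqrtr.
  by move=> j /negbTE ji; rewrite !mxE eqxx ji mulr0 expr0n.
rewrite inE /= => rz zmin; exists z; first by apply/eqP; rewrite eq_le andbC.
by move=> x xr; apply: zmin; rewrite inE /= xr lexx.
Qed.
End comparison.

(** * Barriers at infinity *)

Section barriers.
Context {R : realType} {n : nat}.
Implicit Types (w : 'rV[R]_n -> R) (x c : 'rV[R]_n).
Local Notation m := (n%:R / 2 - 1 : R).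

Lemma isd_powR (e s : R) : 0 < s -> is_derive s (1 : R) (fun t => t `^ e) (e * s `^ (e - 1)).
Proof. exact: is_derive1_powR. Qed.

(** For k > m the power s^(-k) is strictly subharmonic, which provides the strict inequality of the
    comparison. *)
Lemma superharmonic_decay_above (k : R) w c (a mu0 : R) : 0 < a -> 0 < mu0 -> m < k -> 0 < k ->
  classC 2 w -> (forall x, 0 <= w x) -> (forall x, laplacian w x <= 0) ->
  (forall x, sqn (x - c) = a -> mu0 <= w x) ->
  forall x, a <= sqn (x - c) -> mu0 * (sqn (x - c) / a) `^ (- k) <= w x.
Proof.
move=> a0 mu00 mk k0 cw w0 lw wa x ax.
have s0 : 0 < sqn (x - c) by exact: lt_le_trans ax.
pose A := mu0 * a `^ k; have A0 : 0 < A by rewrite mulr_gt0// powR_gt0.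
have -> : mu0 * (sqn (x - c) / a) `^ (- k) = A * sqn (x - c) `^ (- k).
  by rewrite powR_divE// [a `^ (- k)]powRN invrK /A; ring.
apply: (@exterior_comparison _ _ w c a (fun s => A * s `^ (- k))
  (fun s => A * (- k * s `^ (- k - 1)))
  (fun s => A * (- k * ((- k - 1) * s `^ (- k - 1 - 1)))) cw w0 _ _ _ _ _ x ax).
- by move=> s as_; apply: isdZ; apply: isd_powR; exact: lt_le_trans as_.
- by move=> s as_; do 2 apply: isdZ; apply: isd_powR; exact: lt_trans as_.
- move=> y ay; apply: (le_lt_trans (lw y)); set s := sqn (y - c).
  have sp : 0 < s by exact: lt_trans ay.
  have -> : s `^ (- k - 1) = s `^ (- k - 1 - 1) * s by rewrite -powR_add1// subrK.
  rewrite (_ : 4 * s * _ + _ = A * k * (s `^ (- k - 1 - 1) * s) * (4 * (k + 1) - 2 * n%:R)); last by ring.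
  rewrite !mulr_gt0// ?powR_gt0//; lra.
- move=> d d0; have [r0 r01 Hr] := ln_powR_small (A / d) 0 k0.
  exists r0 => s /[dup] rs /Hr; rewrite powRr0 mulr1.
  have sp : 0 < s by rewrite (lt_le_trans _ rs)// (lt_le_trans _ r01).
  by rewrite ler_pdivrMr// => H; rewrite powRN ler_pdivrMr ?powR_gt0// mulrC.
- move=> y /wa; rewrite /A -mulrA -powR_addE// subrr powRr0 mulr1; exact.
Qed.

(** s^(-m) is the fundamental solution |x - c|^(2-n), harmonic and therefore not a strict barrier;
    it is reached as the limit of the exponents m + d. *)
Lemma superharmonic_decay w c (a mu0 : R) : (2 < n)%N -> 0 < a -> 0 < mu0 ->
  classC 2 w -> (forall x, 0 <= w x) -> (forall x, laplacian w x <= 0) ->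
  (forall x, sqn (x - c) = a -> mu0 <= w x) ->
  forall x, a <= sqn (x - c) -> mu0 * (sqn (x - c) / a) `^ (- m) <= w x.
Proof.
move=> n2 a0 mu00 cw w0 lw wa x ax.
have nR : 3 <= n%:R :> R by rewrite ler_nat.
set t := sqn (x - c) / a.
have t1 : 1 <= t by rewrite ler_pdivlMr// mul1r.
have t0 : 0 < t by exact: lt_le_trans t1.
have lt0 : 0 <= ln t by exact: ln_ge0.
set K := mu0 * t `^ (- m); have K0 : 0 < K by rewrite mulr_gt0// powR_gt0.
(* By t^(-d) >= 1 - d ln t, this [d] loses at most [e] against the limiting barrier. *)
apply/ler_addgt0Pr => e e0; pose d := e / (K * ln t + 1).
have Kl : 0 <= K * ln t by rewrite mulr_ge0// ltW.
have d0 : 0 < d by rewrite divr_gt0// ltr_wpDl.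
have k0 : 0 < m + d by lra.
have km : m < m + d by lra.
have := superharmonic_decay_above a0 mu00 km k0 cw w0 lw wa ax.
rewrite -/t opprD powR_addE// mulrA -/K => H.
have : 1 - d * ln t <= t `^ (- d).
  rewrite /powR gt_eqF// -mulNr; exact: expR_ge1Dx.
move=> H2; have H3 : K * (1 - d * ln t) <= w x by apply: le_trans H; rewrite ler_pM2l.
have : d * (K * ln t) <= e.
  by rewrite /d mulrAC ler_pdivrMr ?ltr_wpDl// ler_pM2l// lerDl.
lra.
Qed.

(** The barrier s^(-m) (ln s)^(b+1) has -Laplacian of order s^(-m-1) (ln s)^b: the pure power is
    harmonic, so only terms with a derivative of the logarithm survive. The condition b > -1 makes
    the logarithm a gain. *)
Lemma superharmonic_log_bound w c (a b c0 mu0 : R) : (2 < n)%N -> -1 < b -> b <= 0 ->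
  expR 1 <= a -> 0 < c0 -> 0 < mu0 ->
  classC 2 w -> (forall x, 0 <= w x) ->
  (forall x, a <= sqn (x - c) ->
     c0 * (sqn (x - c) `^ (- m - 1) * ln (sqn (x - c)) `^ b) <= - laplacian w x) ->
  (forall x, sqn (x - c) = a -> mu0 <= w x) ->
  exists2 c1, 0 < c1 & forall x, a <= sqn (x - c) ->
    c1 * (sqn (x - c) `^ (- m) * ln (sqn (x - c)) `^ (b + 1)) <= w x.
Proof.
move=> n2 b1 b0 ea c00 mu00 cw w0 lw wa.
have nR : 3 <= n%:R :> R by rewrite ler_nat.
have m0 : 0 < m by lra.
have a0 : 0 < a by apply: lt_le_trans ea; exact: expR_gt0.
have la s : a <= s -> 1 <= ln s.
  move=> as_; rewrite -[leLHS](expRK 1) ler_ln ?posrE ?expR_gt0//.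
    exact: le_trans as_.
  exact: lt_le_trans as_.
pose ha := a `^ (- m) * ln a `^ (b + 1).
have ha0 : 0 < ha by rewrite mulr_gt0 ?powR_gt0// (lt_le_trans _ (la _ (lexx a))).
(* As ln s >= 1, [k] bounds -Laplacian of the barrier relative to s^(-m-1) (ln s)^b. The first term
   of the amplitude [A] respects the boundary value, the second the equation, with a factor 2 for
   strictness. *)
pose k := 4 * (b + 1) * (m + 1); have k0 : 0 < k by rewrite !mulr_gt0//; lra.
pose A := Num.min (mu0 / ha) (c0 / (2 * k)).
have A0 : 0 < A by rewrite lt_min !divr_gt0// mulr_gt0.
have Ac : A * k < c0.
  have : A <= c0 / (2 * k) by rewrite ge_min lexx orbT.
  rewrite ler_pdivlMr ?mulr_gt0//; have := mulr_gt0 A0 k0; lra.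
exists A => // x ax.
apply: (@exterior_comparison _ _ w c a (fun s => A * (s `^ (- m) * ln s `^ (b + 1)))
  (fun s => A * (s `^ (- m - 1) * ((b + 1) * ln s `^ b - m * ln s `^ (b + 1))))
  (fun s => A * (s `^ (- m - 1) * ((b + 1) * (b * ln s `^ (b - 1) * s^-1)
       - m * ((b + 1) * ln s `^ b * s^-1))
     + ((b + 1) * ln s `^ b - m * ln s `^ (b + 1)) * ((- m - 1) * s `^ (- m - 1 - 1)))) cw w0 _ _ _ _ _ x ax).
- move=> s as_; have sp : 0 < s by exact: lt_le_trans as_.
  have lp : 0 < ln s by exact: lt_le_trans (la _ as_).
  have D := isdM (isd_powR (- m) sp) (isd_comp (is_derive1_ln sp) (isd_powR (b + 1) lp)).
  apply: (is_derive_eq (isdZ A D)).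
  have -> : s `^ (- m) = s `^ (- m - 1) * s by rewrite -powR_add1// subrK.
  by rewrite addrK; field; rewrite gt_eqF.
- move=> s as_; have sp : 0 < s by exact: lt_trans as_.
  have lp : 0 < ln s by exact: lt_le_trans (la _ (ltW as_)).
  have D1 := isd_comp (is_derive1_ln sp) (isd_powR b lp).
  have D2 := isd_comp (is_derive1_ln sp) (isd_powR (b + 1) lp).
  have D := isdM (isd_powR (- m - 1) sp) (isdB (isdZ (b + 1) D1) (isdZ m D2)).
  by apply: (is_derive_eq (isdZ A D)); rewrite addrK.
- move=> y ay; set s := sqn (y - c).
  have sp : 0 < s by exact: lt_trans ay.
  have l1 : 1 <= ln s by exact/la/ltW.
  have lp : 0 < ln s by exact: lt_le_trans l1.
  have := lw y (ltW ay); rewrite -/s; move: (laplacian w y) => D HD.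
  have -> : ln s `^ (b + 1) = ln s `^ b * ln s by rewrite powR_add1.
  have lbE : ln s `^ b = ln s `^ (b - 1) * ln s by rewrite -powR_add1// subrK.
  have -> : s `^ (- m - 1 - 1) = s `^ (- m - 1) / s.
    rewrite -[in X in _ = X / _](subrK 1 (- m - 1)) powR_add1// mulfK// gt_eqF//.
  have H1 : ln s `^ (b - 1) <= ln s `^ b.
    by rewrite lbE ler_peMr// powR_ge0.
  have sm := powR_gt0 (- m - 1) sp. have lb := powR_gt0 b lp.
  rewrite (_ : 4 * s * _ + _ = - (A * (4 * (b + 1)) * s `^ (- m - 1) *
      (m * ln s `^ b + (- b) * ln s `^ (b - 1)))); last by field; rewrite gt_eqF.
  have H2 : m * ln s `^ b + (- b) * ln s `^ (b - 1) <= (m + 1) * ln s `^ b.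
    have : (- b) * ln s `^ (b - 1) <= 1 * ln s `^ b.
      by apply: ler_pM; rewrite ?powR_ge0 ?oppr_ge0//; lra.
    lra.
  rewrite ltrNr; apply: lt_le_trans HD.
  apply: (@le_lt_trans _ _ (A * (4 * (b + 1)) * s `^ (- m - 1) * ((m + 1) * ln s `^ b))).
    by rewrite ler_wpM2l// !mulr_ge0 ?ltW//; lra.
  rewrite (_ : _ * ((m + 1) * _) = A * k * (s `^ (- m - 1) * ln s `^ b)); last by rewrite /k; ring.
  by rewrite ltr_pM2r// mulr_gt0.
- move=> d d0; have [r0 r01 Hr] := ln_powR_small (A / d) (b + 1) m0.
  exists (Num.max a r0) => s; rewrite ge_max => /andP[as_ rs].
  have sp : 0 < s by exact: lt_le_trans as_.
  have lp : 0 < ln s by exact: lt_le_trans (la _ as_).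
  have H1 : ln s `^ (b + 1) <= ln (1 + s) `^ (b + 1).
    apply: powR_le_ge0; [lra|exact: ltW|rewrite ler_ln ?posrE//; [lra|lra]].
  have := Hr _ rs; rewrite mulrAC ler_pdivrMr// => H2.
  have sm := powR_gt0 m sp.
  rewrite powRN mulrA mulrAC ler_pdivrMr// mulrC [d * _]mulrC.
  by apply: le_trans H2; rewrite mulrC ler_pM2l.
- move=> y /wa; apply: le_trans.
  rewrite -/ha -ler_pdivlMr//; by rewrite ge_min lexx.
Qed.

End barriers.

(** * Lower bounds for the convolution *)

Section kernel_convolution_lower_bounds.
Context {R : realType} {n : nat}.
Variables (alpha beta p : R).
Hypothesis n0 : (0 < n)%N.
Hypothesis alpha0 : 0 <= alpha.
Local Notation tupleR := (n.-tuple (measurableTypeR R)).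
Local Notation mu := (@lebesgue_measure_tuple R n).
Implicit Types (u : 'rV[R]_n -> R) (x y c : 'rV[R]_n).

Lemma Kconv_ge0 u x : (0 <= Kconv alpha beta p u x)%E.
Proof.
rewrite /Kconv /integral_rV; apply: integral_ge0 => t _.
by rewrite lee_fin mulr_ge0 ?Kab_ge0 ?powR_ge0.
Qed.

Lemma cube_enorm c (r : R) (t : tupleR) : cube c (r / n%:R) t ->
  enorm (rV_of_tuple t - c) <= r.
Proof.
move=> /cubeP H; apply: (le_trans (enorm_le_sum _)).
apply: (@le_trans _ _ (\sum_(i < n) (r / n%:R))); first exact: ler_sum.
by rewrite sumr_const card_ord -[X in X <= _]mulr_natr divfK// pnatr_eq0 -lt0n.
Qed.

Definition unit_dir : 'rV[R]_n := dirv (Ordinal n0).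

Lemma enorm_unit_dir (r : R) : 0 <= r -> enorm (r *: unit_dir) = r.
Proof.
move=> r0; rewrite /enorm (bigD1 (Ordinal n0))//= big1 => [|j /negbTE ji].
  by rewrite !mxE !eqxx mulr1 addr0 sqrtr_sqr ger0_norm.
by rewrite !mxE eqxx ji mulr0 expr0n.
Qed.

(** The cube is kept at distance comparable to [d] from [x], so its points see the kernel at scale
    [d] and never near its singularity. *)
Lemma kernel_cube_lower : exists2 C, 0 < C &
  forall u x y0 (d rho v : R), 0 <= p -> 0 < d -> rho <= d / 4 -> 0 <= v ->
  d / 2 <= enorm (x - y0) -> enorm (x - y0) <= 3 / 2 * d ->
  (forall y, enorm (y - y0) <= rho -> v <= u y) ->
  forall t, cube y0 (rho / n%:R) t ->
  C * kappa alpha beta d * v `^ p <=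
    Kab alpha beta (x - rV_of_tuple t) * u (rV_of_tuple t) `^ p.
Proof.
have [C C0 HC] := @Kab_lower R n alpha beta alpha0; exists C => //.
move=> u x y0 d rho v p0 d0 rd v0 xy1 xy2 uv t /cube_enorm ty.
set y := rV_of_tuple t in ty *.
have E : x - y = (x - y0) - (y - y0) by rewrite opprB addrA subrK.
apply: ler_pM.
- by rewrite mulr_ge0 ?ltW// kappa_gt0.
- exact: powR_ge0.
- apply: HC => //.
    by rewrite E; apply: le_trans (enormB_ge _ _); lra.
  rewrite E; apply: (le_trans (enorm_triangle _ _)); rewrite enormN; lra.
- by apply: powR_le_ge0 => //; exact: uv.
Qed.

Lemma Kconv_ge_cube : exists2 C, 0 < C &
  forall u x y0 (d rho v : R), continuous u -> 0 <= p -> 0 < d -> 0 < rho ->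
  rho <= d / 4 -> 0 <= v ->
  d / 2 <= enorm (x - y0) -> enorm (x - y0) <= 3 / 2 * d ->
  (forall y, enorm (y - y0) <= rho -> v <= u y) ->
  ((C * kappa alpha beta d * rho ^+ n * v `^ p)%:E <= Kconv alpha beta p u x)%E.
Proof.
have [C C0 HC] := kernel_cube_lower.
have nR : 0 < n%:R :> R by rewrite ltr0n.
exists (C * (2 / n%:R) ^+ n); first by rewrite mulr_gt0// exprn_gt0// divr_gt0.
move=> u x y0 d rho v cu p0 d0 rho0 rd v0 xy1 xy2 uv.
have -> : C * (2 / n%:R) ^+ n * kappa alpha beta d * rho ^+ n * v `^ p =
    C * kappa alpha beta d * v `^ p * (2 * (rho / n%:R)) ^+ n.
  by rewrite !exprMn; ring.
apply: (@integral_cube_ge _ _ (fun t => Kab alpha beta (x - rV_of_tuple t) *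
    u (rV_of_tuple t) `^ p) y0).
- by apply/measurable_EFinP; exact: measurable_Kab_powR.
- by move=> t; rewrite mulr_ge0 ?Kab_ge0 ?powR_ge0.
- by rewrite divr_ge0 ?ltW.
- exact: (HC u x y0 d rho v).
- by rewrite !mulr_ge0 ?powR_ge0 ?ltW// kappa_gt0.
Qed.

Lemma integral_cubes_ge (F : tupleR -> R) (c : nat -> 'rV[R]_n) (r k : nat -> R) :
  measurable_fun setT F -> (forall t, 0 <= F t) -> (forall j, 0 <= r j) ->
  (forall j, 0 <= k j) -> (forall j t, cube (c j) (r j) t -> k j <= F t) ->
  trivIset setT (fun j => cube (c j) (r j)) ->
  forall J, ((\sum_(j < J) k j * (2 * r j) ^+ n)%:E <= \int[mu]_t (F t)%:E)%E.
Proof.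
move=> mF F0 r0 k0 kF tI J.
have mc j : measurable (cube (c j) (r j)) by exact: measurable_cube.
have mU : measurable (\big[setU/set0]_(j <- iota 0 J) cube (c j) (r j)).
  exact: bigsetU_measurable.
apply: (@le_trans _ _
    (\int[mu]_(t in \big[setU/set0]_(j <- iota 0 J) cube (c j) (r j)) (F t)%:E)%E); last first.
  apply: ge0_subset_integral => //; first exact/measurable_EFinP.
  by move=> t _; rewrite lee_fin.
rewrite ge0_integral_bigsetU//; last 4 first.
- exact: iota_uniq.
- by apply: sub_trivIset tI.
- by apply/measurable_EFinP; exact: measurable_funTS.
- by move=> t _; rewrite lee_fin.
rewrite -(big_mkord xpredT (fun j => k j * (2 * r j) ^+ n)) -sumEFin /index_iota subn0.
apply: lee_sum => j _.
rewrite EFinM -(measure_cube (c j) (r0 j)) -(integral_cst mu (mc j)).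
apply: ge0_le_integral => //.
- by move=> t _; rewrite /= lee_fin.
- by apply/measurable_EFinP; exact: measurable_funTS.
- by move=> t ct; rewrite /= lee_fin; exact: kF ct.
Qed.

End kernel_convolution_lower_bounds.

Section unbounded_growth.
Context {R : realType}.

Lemma powR_ln_unbounded (A B C R0 : R) : 0 < A \/ A = 0 /\ 0 < B ->
  exists r, [/\ R0 <= r, 1 <= r & C < r `^ A * ln (1 + r) `^ B].
Proof.
move=> [A0|[-> B0]].
  have [r0 r01 Hr] := ln_powR_small (C + 1) (- B) A0.
  exists (Num.max R0 r0); set r := Num.max _ _.
  have rr0 : r0 <= r by rewrite le_max lexx orbT.
  have r1 : 1 <= r by exact: le_trans rr0.
  split=> //; first by rewrite le_max lexx.
  have lp : 0 < ln (1 + r) by apply: ln_gt0_1D; exact: lt_le_trans r1.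
  have := Hr _ rr0; rewrite powRN ler_pdivrMr ?powR_gt0//.
  by apply: lt_le_trans; rewrite ltrDl.
pose L := `|C| `^ B^-1 + 1.
have L0 : 0 <= `|C| `^ B^-1 by exact: powR_ge0.
have L1 : 0 < L by rewrite ltr_wpDl.
pose r := Num.max (Num.max R0 1) (expR L); exists r.
have r1 : 1 <= r by rewrite !le_max lexx orbT.
split=> //; first by rewrite !le_max lexx.
rewrite powRr0 mul1r.
have Lr : L <= ln (1 + r).
  rewrite -{1}(expRK L) ler_ln ?posrE ?expR_gt0//.
    by apply: (@le_trans _ _ r); rewrite ?lerDr// le_max lexx orbT.
  by rewrite addr_gt0// (lt_le_trans _ r1).
apply: (@lt_le_trans _ _ (L `^ B)); last by rewrite powR_le_ge0// ltW.
apply: (le_lt_trans (ler_norm C)).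
have -> : `|C| = (`|C| `^ B^-1) `^ B by rewrite -powRrM mulVf ?gt_eqF// powRr1.
by apply: gt0_ltr_powR; rewrite ?nnegrE// ?ltW// /L ltrDl.
Qed.

Lemma harmonic_sum_unbounded (C : R) : exists J, C < \sum_(j < J) (j.+1%:R)^-1.
Proof.
apply/not_existsP => H; apply: (@dvg_harmonic R).
apply: nondecreasing_is_cvgn.
  apply/nondecreasing_seqP => J; rewrite /series/= big_nat_recr//= lerDl.
  by rewrite /harmonic invr_ge0.
exists C => _ [J _ <-]; rewrite /series/= leNgt big_mkord; apply/negP.
exact: H.
Qed.

End unbounded_growth.
Section enorm_sqn.
Context {R : realType} {n : nat}.
Implicit Types x : 'rV[R]_n.

Lemma sqn_le_sqr x (r : R) : 0 <= r -> (sqn x <= r ^+ 2) = (enorm x <= r).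
Proof. by move=> r0; rewrite -sqr_enorm ler_sqr ?nnegrE ?enorm_ge0. Qed.

Lemma sqr_le_sqn x (r : R) : 0 <= r -> (r ^+ 2 <= sqn x) = (r <= enorm x).
Proof. by move=> r0; rewrite -sqr_enorm ler_sqr ?nnegrE ?enorm_ge0. Qed.

Lemma powR_sqr (r e : R) : 0 <= r -> (r ^+ 2) `^ e = r `^ (2 * e).
Proof. by move=> r0; rewrite -powR_mulrn// -powRrM. Qed.

End enorm_sqn.

(** * Necessity *)

Section necessity.
Context {R : realType} {n : nat}.
Variables (alpha beta p q lam : R) (u : 'rV[R]_n -> R).
Hypotheses (n2 : (2 < n)%N) (p1 : 1 <= p) (q1 : 1 <= q).
Hypotheses (alpha0 : 0 <= alpha) (alphan : alpha < n%:R) (lam0 : 0 < lam).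
Hypotheses (cu : classC 4 u) (u0 : forall x, 0 <= u x).
Hypothesis Kfin : forall x, (Kconv alpha beta p u x < +oo)%E.
Hypothesis ineq : forall x, (Kconv alpha beta p u x * (u x `^ q)%:E <=
                 (bilaplacian u x - lam * laplacian u x)%:E)%E.

Let n0 : (0 < n)%N. Proof. by apply: leq_trans n2. Qed.
Let p0 : 0 <= p. Proof. by apply: le_trans p1. Qed.
Let q0 : 0 <= q. Proof. by apply: le_trans q1. Qed.
Let cuc : continuous u. Proof. exact: classC_continuous cu. Qed.
Let cu2 : classC 2 u. Proof. by do 2 apply: classCS. Qed.

Definition screened x := lam * u x - laplacian u x.
Local Notation w := screened.
Local Notation D := (n%:R - 2 : R).
Local Notation L r := (ln (1 + r)).

Lemma classC_screened : classC 2 w.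
Proof.
rewrite (_ : w = fun y => lam * u y + -1 * laplacian u y).
  exact: (classCD (classCZ lam cu2) (classCZ (-1) (classC_laplacian cu))).
by apply/funext => y; rewrite mulN1r.
Qed.

Lemma laplacian_screened x : - laplacian w x = bilaplacian u x - lam * laplacian u x.
Proof.
have cl : classC 2 (laplacian u) := classC_laplacian cu.
have H := is_lapB (is_lapZ lam (classC_lap x cu2)) (classC_lap x cl).
by rewrite (is_lap_laplacian H) opprB.
Qed.

Lemma screened_ge (k : R) x : 0 <= k -> (k%:E <= Kconv alpha beta p u x)%E ->
  k * u x `^ q <= - laplacian w x.
Proof.
move=> k0 kK; rewrite laplacian_screened -lee_fin; apply: le_trans (ineq x).
rewrite EFinM; apply: lee_wpmul2r => //; by rewrite lee_fin powR_ge0.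
Qed.

Lemma screened_superharmonic x : laplacian w x <= 0.
Proof.
have := screened_ge (lexx 0) (Kconv_ge0 alpha beta p u x).
by rewrite mul0r oppr_ge0.
Qed.

Lemma screened_ge0 x : 0 <= w x.
Proof.
apply: (screened_superharmonic_nonneg (Ordinal n0) (ltW lam0) cu u0).
  move=> x0 eps B eps0.
  exact: (annulus_average_small alpha0 alphan p1 cuc u0 (Kfin x0) B eps0).
exact: screened_superharmonic.
Qed.

Lemma solution_ge_screened mu0 x : 0 <= mu0 -> (forall y, sqn (y - x) <= 1 -> mu0 <= w y) ->
  mu0 / (2 * n%:R + lam) <= u x.
Proof. by move=> m0; exact: (screened_lower_bound lam0 m0 cu2 u0). Qed.

End necessity.

(* [w] stands for [lam u - Delta u]. *)
Section around_a_positivity_point.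
Context {R : realType} {n : nat}.
Variables (alpha beta p q lam : R) (u w : 'rV[R]_n -> R) (c : 'rV[R]_n).
Hypotheses (n2 : (2 < n)%N) (p1 : 1 <= p) (q1 : 1 <= q).
Hypotheses (alpha0 : 0 <= alpha) (lam0 : 0 < lam).
Hypotheses (cuc : continuous u) (cw : classC 2 w).
Hypothesis w0 : forall x, 0 <= w x.
Hypothesis sw : forall x, laplacian w x <= 0.
Hypothesis w_ge : forall (k : R) x, 0 <= k -> (k%:E <= Kconv alpha beta p u x)%E ->
  k * u x `^ q <= - laplacian w x.
Hypothesis u_ge : forall mu0 x, 0 <= mu0 -> (forall y, sqn (y - x) <= 1 -> mu0 <= w y) ->
  mu0 / (2 * n%:R + lam) <= u x.
Hypothesis uc : 0 < u c.

Local Notation D := (n%:R - 2 : R).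
Local Notation L r := (ln (1 + r)).
Let n0 : (0 < n)%N. Proof. by apply: leq_trans n2. Qed.
Let nR3 : 3 <= n%:R :> R. Proof. by rewrite ler_nat. Qed.
Let p0 : 0 <= p. Proof. by apply: le_trans p1. Qed.
Let q0 : 0 <= q. Proof. by apply: le_trans q1. Qed.

Lemma positive_ball : exists2 rho, 0 < rho & forall y, enorm (y - c) <= rho -> u c / 2 <= u y.
Proof.
have uc2 : u c / 2 < u c by rewrite ltr_pdivrMr// ltr_pMr// ltr1n.
have near_c : \forall y \near c, u c / 2 < u y by exact: (cvgr_gt _ (@cuc c)).
have /nbhs_ballP[e /= e0 He] := near_c.
exists (e / 2); first by rewrite divr_gt0.
move=> y yc; apply/ltW/He; split=> // i j; rewrite ord1 /ball/= distrC.
have := coord_le_enorm (y - c) j; rewrite !mxE => /le_lt_trans; apply.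
by apply: (le_lt_trans yc); rewrite ltr_pdivrMr// ltr_pMr// ltr1n.
Qed.

(** u(c) > 0 makes the right-hand side of the inequality positive at [c], so -Delta w > 0 on a small
    ball; the paraboloid comparison with boundary value 0 then gives a positive bound inside. *)
Lemma screened_positive_sphere : exists a0 mu0 : R, [/\ 0 < a0, 0 < mu0 &
  forall x, sqn (x - c) = a0 -> mu0 <= w x].
Proof.
have [rho rho0 Hrho] := positive_ball.
have [C C0 HC] := @Kconv_ge_cube R n alpha beta p n0 alpha0.
have d0 : 0 < rho / 2 by rewrite divr_gt0.
have uc2 : 0 < u c / 2 by rewrite divr_gt0.
(* The cube is centred off [c], at distance rho/2, so that the lower bound on the kernel applies at
   [c] itself. *)
pose y0 := c + (rho / 2) *: unit_dir n0.
have ey0 : enorm (c - y0) = rho / 2.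
  by rewrite -enormN opprB /y0 addrC addKr enorm_unit_dir// ltW.
have := HC u c y0 (rho / 2) (rho / 8) (u c / 2) cuc p0 d0 _ _ (ltW uc2).
rewrite ey0 => /(_ _ _ _ _ _) HK.
set k := C * _ * _ * _ in HK.
have k0 : 0 < k.
  by rewrite !mulr_gt0 ?powR_gt0 ?exprn_gt0 ?divr_gt0 ?kappa_gt0// ln_gt0_1D.
have {}HK : (k%:E <= Kconv alpha beta p u c)%E.
  apply: HK; [by rewrite divr_gt0|lra|lra|lra|].
  move=> y yy; apply: Hrho.
  have -> : y - c = (y - y0) - (c - y0) by rewrite opprB addrA subrK.
  by apply: (le_trans (enorm_triangle _ _)); rewrite enormN ey0; lra.
pose F := k * u c `^ q; have F0 : 0 < F by rewrite mulr_gt0// powR_gt0.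
have lF := w_ge (ltW k0) HK; rewrite -/F in lF.
have clw : continuous (fun x => - laplacian w x).
  by move=> x; apply: continuousN; exact: (continuous_laplacian cw).
have F2 : F / 2 < - laplacian w c.
  by apply: lt_le_trans lF; rewrite ltr_pdivrMr// ltr_pMr// ltr1n.
have near_c : \forall y \near c, F / 2 < - laplacian w y by exact: (cvgr_gt _ (clw c)).
have /nbhs_ballP[e /= e0 He] := near_c.
pose r := (e / 2) ^+ 2; have r0 : 0 < r by rewrite exprn_gt0// divr_gt0.
have rF x : sqn (x - c) <= r -> F / 2 <= - laplacian w x.
  rewrite sqn_le_sqr; last by rewrite divr_ge0// ltW.
  move=> xc; apply/ltW/He; split=> // i j; rewrite ord1 /ball/= distrC.
  have := coord_le_enorm (x - c) j; rewrite !mxE => /le_lt_trans; apply.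
  by apply: (le_lt_trans xc); rewrite ltr_pdivrMr// ltr_pMr// ltr1n.
have H := superharmonic_ball n0 (ltW r0) cw rF (fun x _ => w0 x).
exists (r / 2), (F / 2 * (r / 2) / (2 * n%:R)).
have n20 : 0 < 2 * n%:R :> R by rewrite mulr_gt0// ltr0n; exact: n0.
split; [by rewrite divr_gt0|by apply: divr_gt0 => //; rewrite mulr_gt0// divr_gt0|].
move=> x xr; have := H x; rewrite xr add0r (_ : r - r / 2 = r / 2); last by lra.
by apply; lra.
Qed.

Lemma screened_lower : exists cw r0 : R, [/\ 0 < cw, 0 < r0 &
  forall x, r0 <= enorm (x - c) -> cw * enorm (x - c) `^ (- D) <= w x].
Proof.
have [a0 [mu0 [a00 mu00 H]]] := screened_positive_sphere.
have W := superharmonic_decay n2 a00 mu00 cw w0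
  sw H.
exists (mu0 * a0 `^ (n%:R / 2 - 1)), (Num.sqrt a0); split.
- by rewrite mulr_gt0// powR_gt0.
- by rewrite sqrtr_gt0.
move=> x xr; have r0 : 0 < enorm (x - c) by apply: lt_le_trans xr; rewrite sqrtr_gt0.
have ax : a0 <= sqn (x - c) by rewrite -(sqr_sqrtr (ltW a00)) sqr_le_sqn ?sqrtr_ge0.
have := W x ax; rewrite powR_divE//; last by rewrite -sqr_enorm exprn_gt0.
rewrite [a0 `^ (- _)]powRN invrK -sqr_enorm powR_sqr ?enorm_ge0//.
rewrite (_ : 2 * - (n%:R / 2 - 1) = - D); last by field.
by rewrite [X in mu0 * X]mulrC mulrA.
Qed.

Definition min_on_sphere (r : R) z :=
  enorm (z - c) = r /\ forall x, enorm (x - c) = r -> w z <= w x.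

Lemma min_on_sphere_exists r : 0 <= r -> exists z, min_on_sphere r z.
Proof.
move=> r0; have r20 : 0 <= r ^+ 2 by exact: sqr_ge0.
have [z zr zmin] := sphere_minimum c n0 r20 (classC_continuous cw).
have E x : (sqn (x - c) = r ^+ 2) <-> (enorm (x - c) = r).
  rewrite -sqr_enorm; split=> [|->//] H.
  by apply/eqP; rewrite -(eqrXn2 (n := 2))// ?enorm_ge0//; apply/eqP.
by exists z; split=> [|x /E]; [exact/E|exact: zmin].
Qed.

(** Inside the sphere this is the minimum principle; between radii [r] and 2r the decay of
    superharmonic functions costs at most the factor 2^(-D). *)
Lemma screened_min_lower r z x : 0 < r -> 0 < w z -> min_on_sphere r z ->
  enorm (x - c) <= 2 * r -> w z * 2 `^ (- D) <= w x.
Proof.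
move=> r0 M0 [zr zmin] x2r.
have sE y : sqn (y - c) = r ^+ 2 -> w z <= w y.
  by move=> H; apply: zmin; rewrite /enorm -/(sqn _) H sqrtr_sqr gtr0_norm.
have r2 : 0 < r ^+ 2 by rewrite exprn_gt0.
have [xr|xr] := leP (enorm (x - c)) r.
  have lw0 y : sqn (y - c) <= r ^+ 2 -> 0 <= - laplacian w y.
    by move=> _; rewrite oppr_ge0.
  have := superharmonic_ball n0 (ltW r2) cw lw0 sE.
  move=> /(_ x); rewrite sqn_le_sqr ?(ltW r0)// mul0r mul0r addr0 => /(_ xr).
  apply: le_trans; apply: ler_piMr; first exact: ltW.
  rewrite -[leRHS](powRr0 2); apply: ler_powR; rewrite ?ler1n//.
  have := nR3; lra.
have ax : r ^+ 2 <= sqn (x - c) by rewrite sqr_le_sqn ?ltW.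
have := superharmonic_decay n2 r2 M0 cw w0
  sw sE ax.
apply: le_trans; rewrite ler_pM2l//.
have -> : 2 `^ (- D) = (2 ^+ 2) `^ (- (n%:R / 2 - 1)) :> R.
  by rewrite powR_sqr//; congr (_ `^ _); field.
apply: powR_le_le0; first by have := nR3; lra.
  by rewrite divr_gt0// (lt_le_trans _ ax).
by rewrite ler_pdivrMr// -exprMn sqn_le_sqr// mulr_ge0// ltW.
Qed.

Definition cv : R := 2 `^ (- D) / (2 * n%:R + lam).

Let N0 : 0 < 2 * n%:R + lam. Proof. by apply: addr_gt0 => //; rewrite mulr_gt0// ltr0n; exact: n0. Qed.

Lemma cv_gt0 : 0 < cv. Proof. by rewrite divr_gt0// powR_gt0. Qed.

(** As r >= 2, the unit ball around [x] stays within radius 2r of [c], where [w] is bounded below;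
    [cv] combines this loss with that of passing from [w] to [u]. *)
Lemma solution_min_lower r z x : 2 <= r -> 0 < w z -> min_on_sphere r z ->
  enorm (x - c) <= 3 / 2 * r -> cv * w z <= u x.
Proof.
move=> r2 M0 mz xr; have r0 : 0 < r by lra.
have -> : cv * w z = (w z * 2 `^ (- D)) / (2 * n%:R + lam) by rewrite /cv; ring.
apply: u_ge; first by rewrite mulr_ge0 ?powR_ge0// ltW.
move=> y yx1; have yx : enorm (y - x) <= 1 by rewrite -sqn_le_sqr// expr1n.
apply: (screened_min_lower r0 M0 mz).
have -> : y - c = (y - x) + (x - c) by rewrite addrA subrK.
by apply: (le_trans (enorm_triangle _ _)); lra.
Qed.

(** The paraboloid on the ball of radius r/4 around [z] is evaluated at the centre: (r/4)^2 / (2 n)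
    = r^2 / (32 n). *)
Lemma superharmonic_gain r z F : 0 < r ->
  (forall x, enorm (x - z) <= r / 4 -> F <= - laplacian w x) ->
  F * r ^+ 2 / (32 * n%:R) <= w z.
Proof.
move=> r0 HF; have r4 : 0 <= r / 4 by rewrite divr_ge0// ltW.
have r40 : 0 <= (r / 4) ^+ 2 by rewrite sqr_ge0.
have HF' x : sqn (x - z) <= (r / 4) ^+ 2 -> F <= - laplacian w x.
  by rewrite sqn_le_sqr//; exact: HF.
have := superharmonic_ball n0 r40 cw HF' (fun x _ => w0 x).
move=> /(_ z); rewrite subrr sqn0 subr0 add0r => /(_ r40).
apply: le_trans; rewrite le_eqVlt; apply/orP; left; apply/eqP.
by field; rewrite gt_eqF// ltr0n; exact: n0.
Qed.

(** The mass is that of a fixed ball around [c], seen from distance about [r]. *)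
Lemma Kconv_far : exists C r1 : R, [/\ 0 < C, 0 < r1 &
  forall r x, r1 <= r -> r / 2 <= enorm (x - c) -> enorm (x - c) <= 3 / 2 * r ->
  ((C * kappa alpha beta r)%:E <= Kconv alpha beta p u x)%E].
Proof.
have [rho rho0 Hrho] := positive_ball.
have [C C0 HC] := @Kconv_ge_cube R n alpha beta p n0 alpha0.
have uc2 : 0 < u c / 2 by rewrite divr_gt0.
exists (C * rho ^+ n * (u c / 2) `^ p), (4 * rho); split.
- by rewrite !mulr_gt0 ?powR_gt0 ?exprn_gt0.
- by rewrite mulr_gt0.
move=> r x rr xr1 xr2; have r0 : 0 < r by apply: lt_le_trans rr; rewrite mulr_gt0.
have rr4 : rho <= r / 4 by lra.
have := HC u x c r rho (u c / 2) cuc p0 r0 rho0 rr4 (ltW uc2) xr1 xr2 Hrho.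
apply: le_trans; rewrite lee_fin le_eqVlt; apply/orP; left; apply/eqP; ring.
Qed.

(** The mass is that of the ball of radius r/4 around [c], on which [u] is bounded below by a
    multiple of [w z]; points at distance at least r/2 from [c] see it at scale [r]. *)
Lemma Kconv_near : exists2 C : R, 0 < C &
  forall r x z, 2 <= r -> 0 < w z -> min_on_sphere r z ->
  r / 2 <= enorm (x - c) -> enorm (x - c) <= 3 / 2 * r ->
  ((C * kappa alpha beta r * r ^+ n * w z `^ p)%:E <= Kconv alpha beta p u x)%E.
Proof.
have [C C0 HC] := @Kconv_ge_cube R n alpha beta p n0 alpha0.
have cv0 := cv_gt0.
exists (C * 4^-1 ^+ n * cv `^ p).
  by rewrite !mulr_gt0 ?powR_gt0 ?exprn_gt0 ?invr_gt0.
move=> r x z r2 M0 mz xr1 xr2; have r0 : 0 < r by lra.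
have r40 : 0 < r / 4 by rewrite divr_gt0.
have v0 : 0 <= cv * w z by rewrite mulr_ge0 ?ltW.
have uv y : enorm (y - c) <= r / 4 -> cv * w z <= u y.
  by move=> yr; apply: (solution_min_lower r2 M0 mz); lra.
have := HC u x c r (r / 4) (cv * w z) cuc p0 r0 r40 (lexx _) v0 xr1 xr2 uv.
apply: le_trans; rewrite lee_fin powRM_gt0// exprMn le_eqVlt.
by apply/orP; left; apply/eqP; ring.
Qed.

(** On the ball of radius r/4 around [z] both the kernel bound and u >= cv w(z) hold, so -Delta w is
    bounded below there and [superharmonic_gain] closes the loop: w(z) is bounded below by a power
    of itself. *)
Lemma gain_from_kernel (E Q K : R) : 0 < K -> exists2 C, 0 < C &
  forall r z (k : R), 2 <= r -> 0 < w z -> min_on_sphere r z -> 0 <= k ->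
  (forall x, r / 2 <= enorm (x - c) -> enorm (x - c) <= 3 / 2 * r ->
     (k%:E <= Kconv alpha beta p u x)%E) ->
  K * kappa alpha beta r * r `^ E * w z `^ Q <= k ->
  C * kappa alpha beta r * r `^ (E + 2) * w z `^ (Q + q) <= w z.
Proof.
move=> K0; have cv0 := cv_gt0; have n32 : 0 < 32 * n%:R :> R by rewrite mulr_gt0// ltr0n; exact: n0.
exists (K * cv `^ q / (32 * n%:R)); first by rewrite divr_gt0// mulr_gt0// powR_gt0.
move=> r z k r2 M0 mz k0 Hk Kk; have r0 : 0 < r by lra.
have [zr _] := mz.
have HF x : enorm (x - z) <= r / 4 -> k * (cv * w z) `^ q <= - laplacian w x.
  move=> xz; have x1 : r / 2 <= enorm (x - c).
    have -> : x - c = (z - c) - (z - x) by rewrite opprB [RHS]addrC addrA subrK.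
    by apply: le_trans (enormB_ge _ _); rewrite -(enormN (z - x)) opprB zr; lra.
  have x2 : enorm (x - c) <= 3 / 2 * r.
    have -> : x - c = (x - z) + (z - c) by rewrite addrA subrK.
    by apply: (le_trans (enorm_triangle _ _)); rewrite zr; lra.
  apply: le_trans (w_ge k0 (Hk x x1 x2)); apply: ler_wpM2l => //.
  apply: powR_le_ge0 => //; first by rewrite mulr_ge0 ?ltW.
  by apply: (solution_min_lower r2 M0 mz); lra.
apply: le_trans (superharmonic_gain r0 HF).
rewrite powRM_gt0// (powR_addE _ _ M0) (powR_addE _ _ r0).
have -> : r `^ 2 = r ^+ 2 by rewrite -powR_mulrn// ltW.
set P := w z `^ Q in Kk *; set S := w z `^ q.
rewrite (_ : K * cv `^ q / (32 * n%:R) * kappa alpha beta r * (r `^ E * r ^+ 2) * (P * S) =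
  (K * kappa alpha beta r * r `^ E * P) * (cv `^ q * S * r ^+ 2 / (32 * n%:R))); last by ring.
rewrite (_ : k * (cv `^ q * S) * r ^+ 2 / (32 * n%:R) = 
  k * (cv `^ q * S * r ^+ 2 / (32 * n%:R))); last by ring.
apply: ler_wpM2r => //; rewrite divr_ge0 ?ltW//.
by rewrite mulr_gt0 ?exprn_gt0// mulr_gt0// powR_gt0.
Qed.

(** The two sources of mass are treated at once: (E, Q) = (0, 0) for a fixed ball around [c], (E, Q)
    = (n, p) for the ball of radius r/4. *)
Definition kernel_gain (E Q : R) := exists K r1 : R, [/\ 0 < K, 0 <= Q &
  forall r z, r1 <= r -> 0 < w z -> min_on_sphere r z -> exists k : R, [/\ 0 <= k,
  (forall x, r / 2 <= enorm (x - c) -> enorm (x - c) <= 3 / 2 * r ->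
     (k%:E <= Kconv alpha beta p u x)%E) &
  K * kappa alpha beta r * r `^ E * w z `^ Q <= k]].

Lemma kernel_gain_far : kernel_gain 0 0.
Proof.
have [C [r1 [C0 r10 H]]] := Kconv_far.
exists C, r1; split=> // r z rr M0 mz; exists (C * kappa alpha beta r); split.
- by rewrite mulr_ge0 ?(ltW C0)// ltW// kappa_gt0// (lt_le_trans r10).
- by move=> x; exact: H.
- by rewrite !powRr0 !mulr1.
Qed.

Lemma kernel_gain_near : kernel_gain n%:R p.
Proof.
have [C C0 H] := Kconv_near.
exists C, 2; split=> //.
move=> r z rr M0 mz; have r0 : 0 < r by lra.
exists (C * kappa alpha beta r * r ^+ n * w z `^ p); split.
- rewrite mulr_ge0 ?powR_ge0// mulr_ge0 ?exprn_ge0 ?(ltW r0)//.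
  by rewrite mulr_ge0 ?(ltW C0)// ltW// kappa_gt0.
- by move=> x; exact: H.
- by rewrite powR_mulrn ?(ltW r0).
Qed.

Definition sphere_lower (theta : R) := exists c3 r1 : R, [/\ 0 < c3, 1 <= r1 &
  forall x, r1 <= enorm (x - c) ->
    c3 * enorm (x - c) `^ (- D) * L (enorm (x - c)) `^ theta <= w x].

Lemma sphere_lower0 : sphere_lower 0.
Proof.
have [c3 [r0 [c30 r00 H]]] := screened_lower.
exists c3, (Num.max r0 1); split=> //; first by rewrite le_max lexx orbT.
by move=> x; rewrite ge_max => /andP[xr _]; rewrite powRr0 mulr1; exact: H.
Qed.

Lemma growth_identity (E Q theta r : R) : 0 < r ->
  kappa alpha beta r * r `^ (E + 2) * (r `^ (- D) * L r `^ theta) `^ (Q + q - 1) =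
  r `^ (n%:R + E - alpha - D * (Q + q)) * L r `^ (beta + theta * (Q + q - 1)).
Proof.
move=> r0; have L0 := ln_gt0_1D r0.
rewrite powRM_gt0 ?powR_gt0// -!powRrM /kappa (powR_addE _ _ L0).
have -> : r `^ (n%:R + E - alpha - D * (Q + q)) =
    r `^ (- alpha) * r `^ (E + 2) * r `^ (- D * (Q + q - 1)).
  by rewrite -!(powR_addE _ _ r0); congr (_ `^ _); ring.
by ring.
Qed.

(** Divided by w(z), the bound of [gain_from_kernel] reads C kappa(r) r^(E+2) w(z)^(Q+q-1) <= 1. As
    Q + q - 1 >= 0, the lower bound on w(z) may be inserted, and the left side becomes, up to a
    constant, r^A times a power of the logarithm, which is unbounded. *)
Lemma no_growth (E Q theta : R) : kernel_gain E Q -> sphere_lower theta ->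
  let A := n%:R + E - alpha - D * (Q + q) in
  ~ (0 < A \/ A = 0 /\ 0 < beta + theta * (Q + q - 1)).
Proof.
move=> [K [r1 [K0 Q0 HK]]] [c3 [r2 [c30 r21 Hw]]] A HA.
have [C C0 HC] := gain_from_kernel E Q K0.
pose e := Q + q - 1; have e0 : 0 <= e by rewrite /e -addrA addr_ge0// subr_ge0.
have [r [rr r1' Hr]] := powR_ln_unbounded (C * c3 `^ e)^-1
  (Num.max (Num.max r1 r2) 2) HA.
move: rr; rewrite !ge_max => /andP[/andP[rr1 rr2] rr3].
have r0 : 0 < r by lra.
have [z mz] := min_on_sphere_exists (ltW r0).
have [zr _] := mz.
have L0 := ln_gt0_1D r0.
have lz : c3 * (r `^ (- D) * L r `^ theta) <= w z.
  by rewrite mulrA -zr; apply: Hw; rewrite zr.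
have P0 : 0 < r `^ (- D) * L r `^ theta by rewrite mulr_gt0 ?powR_gt0.
have M0 : 0 < w z by apply: lt_le_trans lz; rewrite mulr_gt0.
have [k [k0 Hk Kk]] := HK r z rr1 M0 mz.
have := HC r z k rr3 M0 mz k0 Hk Kk.
rewrite (_ : Q + q = e + 1); last by rewrite /e subrK.
rewrite (powR_addE _ _ M0) powRr1 ?(ltW M0)// mulrA ger_pMl//.
apply/negP; rewrite -ltNge.
have lM : c3 `^ e * (r `^ (- D) * L r `^ theta) `^ e <= w z `^ e.
  by rewrite -powRM_gt0//; apply: powR_le_ge0 => //; rewrite mulr_ge0 ?ltW.
have k1 : 0 < C * kappa alpha beta r * r `^ (E + 2).
  by rewrite !mulr_gt0 ?powR_gt0 ?kappa_gt0.
apply: lt_le_trans (ler_wpM2l (ltW k1) lM).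
move: Hr; rewrite -growth_identity// -/e -div1r ltr_pdivrMr ?mulr_gt0 ?powR_gt0//.
by move=> H; apply: (lt_le_trans H); rewrite le_eqVlt; apply/orP; left; apply/eqP; ring.
Qed.

Lemma solution_lower : exists c' r2 : R, [/\ 0 < c', 1 <= r2 &
  forall x, r2 <= enorm (x - c) -> c' * enorm (x - c) `^ (- D) <= u x].
Proof.
have [c3 [r0 [c30 r00 H]]] := screened_lower.
exists (c3 * cv), (r0 + 1); split; [by rewrite mulr_gt0// cv_gt0|by lra|].
move=> x xr; set r := enorm (x - c) in xr *; have r1 : 0 < r by lra.
have -> : c3 * cv * r `^ (- D) = c3 * (2 * r) `^ (- D) / (2 * n%:R + lam).
  by rewrite powRM_gt0// /cv; ring.
apply: u_ge; first by rewrite mulr_ge0 ?powR_ge0 ?ltW.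
move=> y yx1; have yx : enorm (y - x) <= 1 by rewrite -sqn_le_sqr// expr1n.
have y1 : r0 <= enorm (y - c).
  have -> : y - c = (x - c) - (x - y) by rewrite opprB [RHS]addrC addrA subrK.
  by apply: le_trans (enormB_ge _ _); rewrite -(enormN (x - y)) opprB -/r; lra.
have y2 : enorm (y - c) <= 2 * r.
  have -> : y - c = (y - x) + (x - c) by rewrite addrA subrK.
  by apply: (le_trans (enorm_triangle _ _)); rewrite -/r; lra.
apply: le_trans (H y y1); rewrite ler_pM2l//; apply: powR_le_le0 => //.
- by have := nR3; lra.
- exact: lt_le_trans y1.
Qed.

(** When the power of [r] is critical, the plain bounds w, u >= c r^(-D) give -Delta w >= c s^(-n/2)
    (ln s)^beta with s = |x - c|^2, the source term for which the logarithmic barrier was built. *)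
Lemma sphere_lower_log (E Q : R) : kernel_gain E Q ->
  n%:R + E - alpha - D * (Q + q) = 0 -> -1 < beta -> beta <= 0 ->
  sphere_lower (beta + 1).
Proof.
move=> [K [r1 [K0 Q0 HK]]] HA b1 b0.
have [c3 [r2 [c30 r21 Hw]]] := sphere_lower0.
have [c' [r3 [c'0 r31 Hu]]] := solution_lower.
pose rho := Num.max (Num.max r1 r2) (Num.max r3 (expR 1)).
have rho1 : r1 <= rho by rewrite /rho !le_max lexx.
have rho2 : r2 <= rho by rewrite /rho !le_max lexx orbT.
have rho3 : r3 <= rho by rewrite /rho !le_max lexx !orbT.
have rho4 : expR 1 <= rho by rewrite /rho !le_max lexx !orbT.
have e2 : 2 <= expR 1 :> R by have := expR_ge1Dx (1 : R); lra.
have rho0 : 0 < rho by lra.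
pose c0 := K * c3 `^ Q * c' `^ q.
have c00 : 0 < c0 by rewrite !mulr_gt0 ?powR_gt0.
(* Used in both directions: the power beta <= 0 decreases when [L r] is replaced by ln(r^2), and the
   power beta + 1 > 0 of ln(r^2) dominates that of [L r]. That r >= 2 gives 1 + r <= r^2. *)
have lsqr r : rho <= r -> L r <= ln (r ^+ 2).
  move=> rr; rewrite ler_ln ?posrE ?exprn_gt0 ?addr_gt0//; [|lra|lra].
  by have : 2 * r <= r * r; [rewrite ler_wpM2r//; lra|rewrite expr2; lra].
have key x : rho ^+ 2 <= sqn (x - c) ->
    c0 * (sqn (x - c) `^ (- (n%:R / 2 - 1) - 1) * ln (sqn (x - c)) `^ beta) <= - laplacian w x.
  rewrite -sqr_enorm ler_sqr ?nnegrE ?enorm_ge0 ?(ltW rho0)//.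
  move Er : (enorm (x - c)) => r rr; have r0 : 0 < r by lra.
  have [z mz] := min_on_sphere_exists (ltW r0).
  have [zr _] := mz.
  have lz : c3 * r `^ (- D) <= w z.
    have := Hw z; rewrite zr powRr0 mulr1; apply; lra.
  have M0 : 0 < w z by apply: lt_le_trans lz; rewrite mulr_gt0 ?powR_gt0.
  have rr1 : r1 <= r by lra.
  have [k [k0 Hk Kk]] := HK r z rr1 M0 mz.
  have x1 : r / 2 <= enorm (x - c) by rewrite Er; lra.
  have x2 : enorm (x - c) <= 3 / 2 * r by rewrite Er; lra.
  apply: le_trans (w_ge k0 (Hk x x1 x2)).
  have lu : (c' * r `^ (- D)) `^ q <= u x `^ q.
    apply: powR_le_ge0 => //; first by rewrite mulr_ge0 ?powR_ge0 ?ltW.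
    by rewrite -Er; apply: Hu; rewrite Er; lra.
  have lM : (c3 * r `^ (- D)) `^ Q <= w z `^ Q.
    by apply: powR_le_ge0 => //; rewrite mulr_ge0 ?powR_ge0 ?ltW.
  have k1 : 0 <= K * kappa alpha beta r * r `^ E.
    by rewrite !mulr_ge0 ?powR_ge0 ?(ltW K0)// ltW// kappa_gt0.
  have := ler_pM (mulr_ge0 k1 (powR_ge0 _ _)) (powR_ge0 _ _) 
    (le_trans (ler_wpM2l k1 lM) Kk) lu.
  apply: le_trans.
  have rD : 0 < r `^ (- D) by rewrite powR_gt0.
  rewrite powR_sqr ?(ltW r0)// (powRM_gt0 _ c30 rD) (powRM_gt0 _ c'0 rD) -!powRrM /kappa.
  have -> : r `^ (2 * (- (n%:R / 2 - 1) - 1)) =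
     r `^ (- alpha) * r `^ E * r `^ (- D * Q) * r `^ (- D * q).
    rewrite -!(powR_addE _ _ r0); congr (_ `^ _).
    by rewrite (_ : - alpha = - n%:R - E + D * (Q + q)); [field|lra].
  have lL : ln (r ^+ 2) `^ beta <= L r `^ beta.
    apply: powR_le_le0 => //; first exact: ln_gt0_1D.
    exact: lsqr.
  rewrite (_ : K * (r `^ (- alpha) * L r `^ beta) * r `^ E * (c3 `^ Q * r `^ (- D * Q)) *
     (c' `^ q * r `^ (- D * q)) = c0 * (r `^ (- alpha) * r `^ E * r `^ (- D * Q) * r `^ (- D * q)
     * L r `^ beta)); last by rewrite /c0; ring.
  by rewrite ler_pM2l// ler_wpM2l// !mulr_ge0 ?powR_ge0.
have a1 : expR 1 <= rho ^+ 2.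
  by apply: (le_trans rho4); rewrite expr2 ler_peMl ?(ltW rho0)//; lra.
have [z mz] := min_on_sphere_exists (ltW rho0).
have [zr zmin] := mz.
have M0 : 0 < w z.
  have := Hw z; rewrite zr => /(_ rho2); apply: lt_le_trans.
  by rewrite !mulr_gt0 ?powR_gt0// ln_gt0_1D.
have wa x : sqn (x - c) = rho ^+ 2 -> w z <= w x.
  by move=> xr; apply: zmin; rewrite /enorm -/(sqn _) xr sqrtr_sqr gtr0_norm.
have [c1 c10 H] := superharmonic_log_bound n2 b1 b0 a1 c00 M0 cw w0 key wa.
exists c1, rho; split=> //; first by lra.
move=> x xr; have r0 : 0 < enorm (x - c) by lra.
have xr2 : rho ^+ 2 <= sqn (x - c) by rewrite sqr_le_sqn// ltW.
apply: le_trans (H x xr2) => {H key wa}; rewrite -mulrA ler_pM2l// -sqr_enorm powR_sqr ?enorm_ge0//.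
rewrite (_ : 2 * - (n%:R / 2 - 1) = - D); last by field.
rewrite ler_wpM2l ?powR_ge0//; apply: powR_le_ge0; [lra|exact/ltW/ln_gt0_1D|exact: lsqr].
Qed.

(** A supercritical power of [r] contradicts [no_growth] without any logarithm; a critical one does
    so directly if beta > 0, and after the logarithmic improvement of [w] if beta <= 0. *)
Lemma kernel_exponent (E Q : R) : kernel_gain E Q ->
  n%:R + E - alpha <= D * (Q + q) /\
  (- 1 + 1 / q < beta -> n%:R + E - alpha < D * (Q + q)).
Proof.
move=> HK; have noA := no_growth HK sphere_lower0.
have AD : n%:R + E - alpha <= D * (Q + q).
  by rewrite -subr_le0 leNgt; apply/negP => A0; apply: noA; left.
split=> // hb; rewrite lt_neqAle AD andbT; apply/eqP => A0.
have A0' : n%:R + E - alpha - D * (Q + q) = 0 by rewrite A0 subrr.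
have [b0|b0] := ltP 0 beta.
  by apply: noA; right; rewrite mul0r addr0.
have q10 : 0 < q by apply: lt_le_trans q1.
have iq : 0 < 1 / q by rewrite divr_gt0.
have b1 : -1 < beta by lra.
apply: (no_growth HK (sphere_lower_log HK A0' b1 b0)); right; split=> //.
have [_ [_ [_ Q0 _]]] := HK.
(* The power of the logarithm is beta + (beta + 1) (Q + q - 1) = (beta + 1) (Q + q) - 1; as Q >= 0,
   it is positive once (beta + 1) q > 1. *)
have bq : 1 < (beta + 1) * q by rewrite -ltr_pdivrMr//; lra.
have : (beta + 1) * q <= (beta + 1) * (Q + q) by rewrite ler_pM2l; lra.
lra.
Qed.

(* The convolution at [c] diverges already on the cubes [cube (c + R e0) (R / (4n))]. *)
Lemma solution_shell_lower : exists C r1 : R, [/\ 0 < C, 1 <= r1 &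
  forall r, r1 <= r -> forall t, cube (c + r *: unit_dir n0) (r / 4 / n%:R) t ->
  C * (r `^ (- alpha - D * p) * L r `^ beta) <=
    Kab alpha beta (c - rV_of_tuple t) * u (rV_of_tuple t) `^ p].
Proof.
have [C C0 HC] := @kernel_cube_lower R n alpha beta p n0 alpha0.
have [c' [r2 [c'0 r21 Hu]]] := solution_lower.
exists (C * (c' * 2 `^ (- D)) `^ p), (2 * r2); split.
- by rewrite !mulr_gt0 ?powR_gt0// mulr_gt0 ?powR_gt0.
- lra.
move=> r rr t ct; have r0 : 0 < r by lra.
have eu : enorm (r *: unit_dir n0) = r by rewrite enorm_unit_dir ?ltW.
have er : enorm (c - (c + r *: unit_dir n0)) = r by rewrite opprD addrA subrr add0r enormN.
have H1 : 0 <= c' * (2 * r) `^ (- D) by rewrite mulr_ge0 ?powR_ge0 ?ltW.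
have H2 y : enorm (y - (c + r *: unit_dir n0)) <= r / 4 -> c' * (2 * r) `^ (- D) <= u y.
  set e := r *: _ in eu *; move=> yr.
  have E : y - c = (y - (c + e)) + e by rewrite opprD addrA subrK.
  have y2 : enorm (y - c) <= 2 * r.
    by rewrite E; apply: (le_trans (enorm_triangle _ _)); rewrite eu; lra.
  have y1 : r2 <= enorm (y - c).
    rewrite E addrC -[X in _ + X]opprK; apply: le_trans (enormB_ge _ _).
    by rewrite enormN eu; lra.
  apply: le_trans (Hu y y1); rewrite ler_pM2l//; apply: powR_le_le0 => //.
  - by have := nR3; lra.
  - by lra.
have := HC u c _ r (r / 4) _ p0 r0 (lexx _) H1 _ _ H2 t ct.
rewrite er => /(_ _ _) H; apply: le_trans (H _ _); [|lra|lra].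
have d0 : 0 < 2 `^ (- D) :> R by rewrite powR_gt0.
have rD : 0 < r `^ (- D) by rewrite powR_gt0.
rewrite (powRM_gt0 (- D) (ltr0Sn R 1) r0) (mulrA c') (powRM_gt0 p (mulr_gt0 c'0 d0) rD).
rewrite -[X in _ <= _ * (_ * X)]powRrM (powR_addE _ _ r0) -mulNr /kappa.
rewrite le_eqVlt; apply/orP; left; apply/eqP; move: (c' * _) => K; ring.
Qed.

Lemma powR_shell_volume (C r : R) : 0 < r ->
  C * (r `^ (- alpha - D * p) * L r `^ beta) * (2 * (r / 4 / n%:R)) ^+ n =
  C * (2 * n%:R)^-1 ^+ n * (r `^ (n%:R - alpha - D * p) * L r `^ beta).
Proof.
move=> r0; have -> : r `^ (n%:R - alpha - D * p) = r `^ (- alpha - D * p) * r ^+ n.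
  by rewrite -(powR_mulrn _ (ltW r0)) -(powR_addE _ _ r0); congr (_ `^ _); ring.
have -> : 2 * (r / 4 / n%:R) = (2 * n%:R)^-1 * r.
  by field; rewrite gt_eqF// ltr0n; exact: n0.
rewrite exprMn; ring.
Qed.

Hypothesis Kfinc : (Kconv alpha beta p u c < +oo)%E.

(** A single cube of size proportional to [r] already contributes a multiple of r^(n-alpha-Dp)
    (ln(1+r))^beta to the convolution at [c], and this is unbounded. *)
Lemma Kconv_p_exponent : ~ (0 < n%:R - alpha - D * p \/ n%:R - alpha - D * p = 0 /\ 0 < beta).
Proof.
move=> HA; have [C [r1 [C0 r11 H]]] := solution_shell_lower.
have nR : 0 < n%:R :> R by rewrite ltr0n; exact: n0.
have V0 : 0 < C * (2 * n%:R)^-1 ^+ n by rewrite mulr_gt0 ?exprn_gt0 ?invr_gt0// mulr_gt0.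
have [M HM] : exists M : R, Kconv alpha beta p u c = M%:E.
  exists (fine (Kconv alpha beta p u c)); rewrite fineK// ge0_fin_numE//.
  exact: Kconv_ge0.
have [r [rr r1' Hr]] := powR_ln_unbounded (M / (C * (2 * n%:R)^-1 ^+ n)) r1 HA.
have r0 : 0 < r by lra.
have : ((C * (r `^ (- alpha - D * p) * L r `^ beta) * (2 * (r / 4 / n%:R)) ^+ n)%:E <=
    Kconv alpha beta p u c)%E.
  apply: (@integral_cube_ge _ _ (fun t => Kab alpha beta (c - rV_of_tuple t) *
    u (rV_of_tuple t) `^ p) (c + r *: unit_dir n0)).
  - by apply/measurable_EFinP; exact: measurable_Kab_powR.
  - by move=> t; rewrite mulr_ge0 ?Kab_ge0 ?powR_ge0.
  - by rewrite !divr_ge0 ?ltW.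
  - exact: H.
  - by rewrite !mulr_ge0 ?powR_ge0 ?ltW.
rewrite HM lee_fin powR_shell_volume// leNgt => /negP; apply.
by rewrite mulrC -ltr_pdivrMr.
Qed.

(** With the power of [r] gone, the cube at radius r_j = r1 4^j contributes at least a multiple of
    1/(j+1), because beta > -1; the divergent harmonic series then contradicts finiteness. *)
Lemma Kconv_p_critical : n%:R - alpha - D * p = 0 -> -1 < beta -> beta <= 0 -> False.
Proof.
move=> A0 b1 b0; have [C [r1 [C0 r11 H]]] := solution_shell_lower.
have nR : 0 < n%:R :> R by rewrite ltr0n; exact: n0.
have V0 : 0 < C * (2 * n%:R)^-1 ^+ n by rewrite mulr_gt0 ?exprn_gt0 ?invr_gt0// mulr_gt0.
have [M HM] : exists M : R, Kconv alpha beta p u c = M%:E.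
  exists (fine (Kconv alpha beta p u c)); rewrite fineK// ge0_fin_numE//.
  exact: Kconv_ge0.
(* The cube at radius [r j] lies at distances between 3/4 r_j and 5/4 r_j from [c]; the ratio 4
   makes these cubes disjoint. *)
pose r j : R := r1 * 4 ^+ j.
have rge j : r1 <= r j by rewrite ler_peMr ?exprn_ege1 ?ler1n//; lra.
have r0 j : 0 < r j by have := rge j; lra.
pose l0 : R := ln (1 + r1) + ln 4.
have l00 : 0 < l0 by rewrite addr_gt0 ?ln_gt0_1D ?ln_gt0 ?ltr1n//; lra.
have Lj j : L (r j) <= l0 * j.+1%:R.
  apply: (@le_trans _ _ (ln ((1 + r1) * 4 ^+ j))).
    have r10 : 0 < r1 by lra.
    have r110 : 0 < 1 + r1 by lra.
    rewrite ler_ln ?posrE ?addr_gt0 ?mulr_gt0 ?exprn_gt0 ?r0//.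
    by rewrite (mulrDl 1) mul1r lerD2r exprn_ege1 ?ler1n.
  have r10 : 0 < 1 + r1 by lra.
  rewrite lnM ?posrE ?exprn_gt0// lnXn// -[ln 4 *+ j]mulr_natr.
  have l1 : 0 <= ln (1 + r1) by rewrite ltW// ln_gt0_1D; lra.
  have l4 : 0 <= ln 4 :> R by rewrite ltW// ln_gt0// ltr1n.
  rewrite -[j.+1%:R]natr1 /l0 mulrDr mulr1 mulrDl.
  have := mulr_ge0 l1 (ler0n R j); lra.
have Lb j : l0 `^ beta * j.+1%:R^-1 <= L (r j) `^ beta.
  have Ljp : 0 < L (r j) by apply: ln_gt0_1D.
  apply: le_trans (powR_le_le0 b0 Ljp (Lj j)).
  rewrite powRM_gt0// ler_pM2l ?powR_gt0// -powR_inv1//.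
  by apply: ler_powR; rewrite ?ler1n// ltW.
have [J HJ] := harmonic_sum_unbounded (M / (C * (2 * n%:R)^-1 ^+ n * l0 `^ beta)).
pose k j := C * (r j `^ (- alpha - D * p) * L (r j) `^ beta).
have := @integral_cubes_ge R n (fun t => Kab alpha beta (c - rV_of_tuple t) *
    u (rV_of_tuple t) `^ p) (fun j => c + r j *: unit_dir n0) (fun j => r j / 4 / n%:R) k.
move=> /(_ _ _ _ _ _ _ J) HS.
have {}HS : ((\sum_(j < J) k j * (2 * (r j / 4 / n%:R)) ^+ n)%:E <= Kconv alpha beta p u c)%E.
  apply: HS.
  - by apply/measurable_EFinP; exact: measurable_Kab_powR.
  - by move=> t; rewrite mulr_ge0 ?Kab_ge0 ?powR_ge0.
  - by move=> j; rewrite !divr_ge0 ?ltW.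
  - by move=> j; rewrite !mulr_ge0 ?powR_ge0 ?ltW.
  - by move=> j t; apply: H.
  have cubed j t : cube (c + r j *: unit_dir n0) (r j / 4 / n%:R) t ->
      3 / 4 * r j <= enorm (rV_of_tuple t - c) <= 5 / 4 * r j.
    move=> /(cube_enorm n0); set y := rV_of_tuple t => yr.
    have eu : enorm (r j *: unit_dir n0) = r j by rewrite enorm_unit_dir ?ltW.
    set e := r j *: _ in eu yr *.
    have E : y - c = (y - (c + e)) + e by rewrite opprD addrA subrK.
    rewrite E; apply/andP; split.
      rewrite addrC -[X in _ + X]opprK; apply: le_trans (enormB_ge _ _).
      by rewrite enormN eu; lra.
    by apply: (le_trans (enorm_triangle _ _)); rewrite eu; lra.
  have sep i j t : (i < j)%N -> cube (c + r i *: unit_dir n0) (r i / 4 / n%:R) t ->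
      cube (c + r j *: unit_dir n0) (r j / 4 / n%:R) t -> False.
    move=> ij /cubed/andP[_ ti] /cubed/andP[tj _].
    have : r i * 4 <= r j.
      by rewrite /r -mulrA -exprSr ler_pM2l ?ler_weXn2l ?ler1n//; lra.
    by have := r0 i; lra.
  apply/trivIsetP => i j _ _ ij; rewrite -subset0 => t [ti tj].
  by move: ij; rewrite neq_ltn => /orP[/sep|/sep]; [move=> /(_ t ti tj)|move=> /(_ t tj ti)].
move: HS; rewrite HM lee_fin leNgt => /negP; apply.
have {}HJ : M < C * (2 * n%:R)^-1 ^+ n * l0 `^ beta * \sum_(j < J) (j.+1%:R)^-1.
  by rewrite mulrC -ltr_pdivrMr// mulr_gt0// powR_gt0.
apply: (lt_le_trans HJ); rewrite mulr_sumr; apply: ler_sum => j _.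
by rewrite /k powR_shell_volume// A0 powRr0 mul1r -[X in X <= _]mulrA ler_pM2l.
Qed.

Lemma exponents_necessary :
  [/\ n%:R - alpha <= D * p, n%:R - alpha <= D * q & 2 * n%:R - alpha <= D * (p + q)] /\
  (- 1 + 1 / q < beta ->
  [/\ n%:R - alpha < D * p, n%:R - alpha < D * q & 2 * n%:R - alpha < D * (p + q)]).
Proof.
have [] := kernel_exponent kernel_gain_far; rewrite addr0 add0r => F1 F2.
have [] := kernel_exponent kernel_gain_near.
rewrite (_ : n%:R + n%:R = 2 * n%:R); last by ring.
move=> N1 N2; have P1 : n%:R - alpha <= D * p.
  by rewrite -subr_le0 leNgt; apply/negP => A0; apply: Kconv_p_exponent; left.
split=> // hb; split; [|exact: F2|exact: N2].
rewrite lt_neqAle P1 andbT; apply/eqP => A0.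
have A0' : n%:R - alpha - D * p = 0 by rewrite A0 subrr.
have [b0|b0] := ltP 0 beta; first by apply: Kconv_p_exponent; right.
apply: Kconv_p_critical => //; apply: lt_trans hb.
by rewrite ltrDl divr_gt0// (lt_le_trans _ q1).
Qed.

End around_a_positivity_point.

Lemma solution_exponents (R : realType) (n : nat) (alpha beta p q lam : R) (u : 'rV[R]_n -> R) :
  (2 < n)%N -> 1 <= p -> 1 <= q -> 0 <= alpha -> alpha < n%:R -> 0 < lam ->
  nonneg_solution alpha beta p q lam u -> nontrivial u ->
  [/\ n%:R - alpha <= (n%:R - 2) * p, n%:R - alpha <= (n%:R - 2) * q &
      2 * n%:R - alpha <= (n%:R - 2) * (p + q)] /\
  (- 1 + 1 / q < beta ->
  [/\ n%:R - alpha < (n%:R - 2) * p, n%:R - alpha < (n%:R - 2) * q &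
      2 * n%:R - alpha < (n%:R - 2) * (p + q)]).
Proof.
move=> n2 p1 q1 alpha0 alphan lam0 [cu u0 Kfin ineq] [c uc].
have uc0 : 0 < u c by rewrite lt_def uc u0.
exact: (exponents_necessary n2 p1 q1 alpha0 lam0 (classC_continuous cu)
  (classC_screened lam cu) (screened_ge0 n2 p1 alpha0 alphan lam0 cu u0 Kfin ineq)
  (screened_superharmonic cu ineq) (screened_ge cu ineq) (solution_ge_screened lam0 cu u0)
  uc0 (Kfin c)).
Qed.

(** * Upper bound of the convolution *)

Section cube_series.
Context {R : realType} {n : nat}.
Local Notation tupleR := (n.-tuple (measurableTypeR R)).
Local Notation mu := (@lebesgue_measure_tuple R n).

(** Only an upper bound for an integral is wanted, so the cubes may be nested and overlap; extended
    values make convergence at a given point immaterial. *)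
Definition cube_series (c : 'rV[R]_n) (r f : nat -> R) (t : tupleR) : \bar R :=
  (\sum_(0 <= k <oo) (f k * \1_(cube c (r k)) t)%:E)%E.

Variables (c : 'rV[R]_n) (r f : nat -> R).
Hypotheses (r0 : forall k, 0 <= r k) (f0 : forall k, 0 <= f k).

Lemma cube_term_ge0 k t : (0 <= (f k * \1_(cube c (r k)) t)%:E)%E.
Proof. by rewrite lee_fin mulr_ge0 ?f0. Qed.

Lemma cube_series_ge0 t : (0 <= cube_series c r f t)%E.
Proof. by apply: nneseries_ge0 => k _ _; exact: cube_term_ge0. Qed.

Lemma measurable_cube_term k : measurable_fun setT (fun t : tupleR => (f k * \1_(cube c (r k)) t)%:E).
Proof.
apply/measurable_EFinP; apply: measurable_funM => //.
by apply: measurable_indic; exact: measurable_cube.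
Qed.

Lemma measurable_cube_series : measurable_fun setT (cube_series c r f).
Proof.
apply: ge0_emeasurable_sum => [k t _ _|k _]; [exact: cube_term_ge0|exact: measurable_cube_term].
Qed.

Lemma cube_series_ge k t (e : R) : cube c (r k) t -> e <= f k -> (e%:E <= cube_series c r f t)%E.
Proof.
move=> ct ek; apply: (@le_trans _ _ (\sum_(0 <= i < k.+1) (f i * \1_(cube c (r i)) t)%:E)%E).
  rewrite big_nat_recr//= indicE mem_set// mulr1; apply: (@le_trans _ _ (f k)%:E).
    by rewrite lee_fin.
  by rewrite leeDr//; apply: sume_ge0 => i _; exact: cube_term_ge0.
by apply: nneseries_lim_ge => i _ _; exact: cube_term_ge0.
Qed.

Lemma integral_cube_series M : (forall J, \sum_(k < J) f k * (2 * r k) ^+ n <= M) ->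
  (\int[mu]_t cube_series c r f t <= M%:E)%E.
Proof.
move=> HM; rewrite /cube_series (integral_nneseries _ measurableT
  measurable_cube_term (fun k t _ => cube_term_ge0 k t)).
have E k : (\int[mu]_t (f k * \1_(cube c (r k)) t)%:E = (f k * (2 * r k) ^+ n)%:E)%E.
  have mc := measurable_cube c (r k).
  under eq_integral do rewrite EFinM.
  rewrite ge0_integralZl_EFin//; last by apply/measurable_EFinP; exact: measurable_indic.
  by rewrite EFinM -(measure_cube c (r0 k)) integral_indic// setIT.
apply: lime_le.
  by apply: is_cvg_nneseries => k _ _; rewrite E lee_fin mulr_ge0// exprn_ge0// mulr_ge0.
apply: nearW => J; under eq_bigr do rewrite E.
by rewrite sumEFin lee_fin big_mkord.
Qed.

End cube_series.

Section dyadic_radii.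
Context {R : realType}.

Lemma geometric_sum_le (x : R) J : 0 <= x -> x < 1 -> \sum_(k < J) x ^+ k <= (1 - x)^-1.
Proof.
move=> x0 x1; have x10 : 0 < 1 - x by rewrite subr_gt0.
rewrite -[leRHS]mulr1 -ler_pdivrMl ?invr_gt0// invrK.
have : (1 - x) * \sum_(k < J) x ^+ k = 1 - x ^+ J.
  by rewrite -[in RHS](expr1n _ J) subrXX; congr (_ * _); apply: eq_bigr => i _; rewrite expr1n mul1r.
by move=> ->; rewrite gerBl exprn_ge0.
Qed.

Lemma dyadic_down (r s : R) : 0 < s -> s <= r -> exists k, r / 2 ^+ k.+1 < s <= r / 2 ^+ k.
Proof.
move=> s0 sr; have r0 : 0 < r by exact: lt_le_trans sr.
have [N HN] : exists N : nat, r / 2 ^+ N < s.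
  exists (Num.bound (r / s)); rewrite ltr_pdivrMr ?exprn_gt0// mulrC -ltr_pdivrMr//.
  have := archi_boundP (ltW (divr_gt0 r0 s0)) => /lt_trans; apply.
  by rewrite -natrX ltr_nat ltn_expl.
elim: N HN => [|N IH] HN; first by move: HN; rewrite expr0 divr1 ltNge sr.
by have [/IH//|H] := ltP (r / 2 ^+ N) s; exists N; rewrite HN.
Qed.

Lemma dyadic_up (r s : R) : 0 < r -> r < s -> exists k, r * 2 ^+ k < s <= r * 2 ^+ k.+1.
Proof.
move=> r0 rs; have s0 : 0 < s by exact: lt_trans rs.
have [N HN] : exists N : nat, s <= r * 2 ^+ N.
  exists (Num.bound (s / r)); rewrite mulrC -ler_pdivrMr//.
  have := archi_boundP (ltW (divr_gt0 s0 r0)) => /ltW/le_trans; apply.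
  by rewrite -natrX ler_nat ltnW// ltn_expl.
elim: N HN => [|N IH] HN; first by move: HN; rewrite expr0 mulr1 leNgt rs.
by have [/IH//|H] := leP s (r * 2 ^+ N); exists N; rewrite H.
Qed.

(** The terms with 2^k < s number at most 1 + log_2 s; this count is the source of the extra
    logarithm in the convolution. *)
Lemma count_dyadic_le (B s : R) J : 0 <= B -> 1 <= s ->
  \sum_(k < J) (if 2 ^+ k < s then B else 0) <= B * (1 + ln s / ln 2).
Proof.
move=> B0 s1; have l2 : 0 < ln 2 :> R by rewrite ln_gt0// ltr1n.
have ls : 0 <= ln s by rewrite ln_ge0.
have S1 J' : \sum_(k < J') (if 2 ^+ k < s then B else 0) <= B * J'%:R.
  apply: (@le_trans _ _ (\sum_(k < J') B)); first by apply: ler_sum => i _; case: ifP.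
  by rewrite sumr_const card_ord mulr_natr.
elim: J => [|J IH]; first by rewrite big_ord0 mulr_ge0// addr_ge0// divr_ge0// ltW.
have [Hs|Hs] := ltP (2 ^+ J) s.
  apply: (le_trans (S1 _)); apply: ler_wpM2l => //; rewrite -natr1 addrC lerD2l.
  rewrite ler_pdivlMr// mulr_natl -lnXn// ler_ln ?posrE ?exprn_gt0//; first exact: ltW.
  exact: lt_le_trans s1.
by rewrite big_ord_recr/= ltNge Hs addr0.
Qed.

(* [x ^ -b <= L ^ (2 - b) x ^ -2] and the sum of the [x_k ^ -2] telescopes. *)
Lemma sum_arithmetic_powR (L b : R) J : ln 2 <= L -> b <= - 2 ->
  \sum_(k < J) (L + k%:R * ln 2) `^ b <= 2 / ln 2 * L `^ (b + 1).
Proof.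
move=> L2 b2; set l := ln 2 in L2 *; have l0 : 0 < l by rewrite /l ln_gt0// ltr1n.
have L0 : 0 < L by exact: lt_le_trans L2.
pose x k : R := L + k%:R * l.
have xS k : x k.+1 = x k + l by rewrite /x -natr1 mulrDl mul1r addrA.
have xL k : L <= x k by rewrite lerDl mulr_ge0// ltW.
have x0 k : 0 < x k by exact: lt_le_trans (xL k).
have T k : x k `^ b <= L `^ (b + 2) * (x k ^+ 2)^-1.
  have -> : x k `^ b = x k `^ (b + 2) * (x k ^+ 2)^-1.
    by rewrite (powR_addE _ _ (x0 k)) -(powR_mulrn 2 (ltW (x0 k))) mulfK// gt_eqF// powR_gt0.
  rewrite ler_pM2r ?invr_gt0 ?exprn_gt0//; apply: powR_le_le0 => //.
  by rewrite -(addNr 2) lerD2r.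
have S J' : \sum_(k < J'.+1) (x k ^+ 2)^-1 <= L^-2 + l^-1 * (L^-1 - (x J')^-1).
  elim: J' => [|J' IH].
    have x00 : x 0%N = L by rewrite /x mul0r addr0.
    by rewrite big_ord1 x00 subrr mulr0 addr0.
  rewrite big_ord_recr/=; apply: (le_trans (lerD IH (lexx _))).
  suff : (x J'.+1 ^+ 2)^-1 <= l^-1 * ((x J')^-1 - (x J'.+1)^-1) by rewrite !mulrBr; lra.
  have -> : l^-1 * ((x J')^-1 - (x J'.+1)^-1) = (x J' * x J'.+1)^-1.
    by rewrite xS; field; rewrite !gt_eqF// ?x0// -xS x0.
  rewrite lef_pV2 ?posrE ?exprn_gt0 ?mulr_gt0 ?x0// expr2 ler_pM2r ?x0// xS.
  by rewrite lerDl ltW.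
have {}S : \sum_(k < J) (x k ^+ 2)^-1 <= 2 / l / L.
  case: J => [|J']; first by rewrite big_ord0 !divr_ge0 ?ltW.
  apply: (le_trans (S J')).
  have H1 : L^-2 <= l^-1 * L^-1.
    by rewrite expr2 invfM ler_pM2r ?invr_gt0// lef_pV2 ?posrE.
  have : 0 <= l^-1 * (x J')^-1 by rewrite mulr_ge0 ?invr_ge0 ?ltW.
  by rewrite mulrBr -[2 / l / L]mulrA; lra.
apply: (@le_trans _ _ (L `^ (b + 2) * \sum_(k < J) (x k ^+ 2)^-1)).
  by rewrite mulr_sumr; apply: ler_sum => k _; exact: T.
rewrite (_ : b + 1 = b + 2 - 1); last by ring.
by rewrite (powR_addE (b + 2) (-1) L0) powR_inv1 ?(ltW L0)// mulrCA ler_pM2l ?powR_gt0.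
Qed.

End dyadic_radii.

(** * Majorants of the kernel *)

Section kernel_majorant.
Context {R : realType} {n : nat}.
Variables (alpha beta : R).

(** [powR] sends 0 to 0 for every nonzero exponent, so the kernel takes the value 0 at the origin
    unless both exponents vanish, when it is identically 1. *)
Lemma Kab_0_le (r : R) : 0 < r -> Kab alpha beta (0 : 'rV[R]_n) <= kappa alpha beta r.
Proof.
move=> r0; rewrite /Kab /kappa /enorm big1 => [|i _]; last by rewrite mxE expr0n.
rewrite sqrtr0 addr0 ln1.
have [->|a0] := eqVneq alpha 0; last first.
  have -> : 0 `^ (- alpha) = 0 :> R by apply: powR0; rewrite oppr_eq0.
  by rewrite mul0r mulr_ge0 ?powR_ge0.
have [->|b0] := eqVneq beta 0; last first.
  by rewrite (powR0 b0) mulr0 mulr_ge0 ?powR_ge0.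
by rewrite oppr0 !powRr0.
Qed.

Lemma ln_1D_concave (t r : R) : 0 < r -> 0 <= t -> t <= 1 -> t * ln (1 + r) <= ln (1 + t * r).
Proof.
move=> r0 t0 t1; have r10 : 0 < 1 + r by rewrite addr_gt0.
have := @concave_ln R (Itv01 t0 t1) (1 + r) 1 r10 ltr01.
rewrite !convRE/= ln1 mulr0 addr0 => /le_trans; apply.
rewrite le_eqVlt; apply/orP; left; apply/eqP; congr ln; rewrite /unstable.onem; ring.
Qed.

(** For beta >= 0 the logarithm is monotone; for beta < 0, concavity gives ln(1 + t r) >= t ln(1 +
    r) and costs t^beta. The singularity is thus at worst of order max(alpha, alpha - beta), below
    [n] exactly when alpha < n and beta > alpha - n. *)
Lemma Kab_upper (r : R) (z : 'rV[R]_n) : 0 < r -> 0 < enorm z -> enorm z <= r ->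
  Kab alpha beta z <= (enorm z / r) `^ (- Num.max alpha (alpha - beta)) * kappa alpha beta r.
Proof.
move=> r0; rewrite /Kab /kappa; move: (enorm z) => s s0 sr; pose t := s / r.
have t0 : 0 < t by rewrite divr_gt0.
have t1 : t <= 1 by rewrite ler_pdivrMr// mul1r.
have st : s = t * r by rewrite divfK// gt_eqF.
rewrite -/t st powRM_gt0// mulrCA; set g := Num.max _ _.
have Lr : 0 < ln (1 + r) by exact: ln_gt0_1D.
have Ls : 0 < ln (1 + t * r) by apply: ln_gt0_1D; rewrite mulr_gt0.
have pt (e : R) : e <= 0 -> 1 <= t `^ e.
  by move=> e0; have := powR_le_le0 e0 t0 t1; rewrite powR1.
suff : t `^ (- alpha) * ln (1 + t * r) `^ beta <= t `^ (- g) * ln (1 + r) `^ beta.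
  move=> H; rewrite -mulrA mulrCA [leRHS](_ : _ = r `^ (- alpha) * (t `^ (- g) * ln (1 + r) `^ beta)); last by ring.
  by rewrite mulrCA ler_pM2l ?powR_gt0// mulrC.
have [b0|b0] := leP 0 beta.
  apply: ler_pM; rewrite ?powR_ge0//.
    rewrite (_ : - g = - alpha + (alpha - g)); last by ring.
    rewrite (powR_addE _ _ t0) ler_peMr ?powR_ge0// pt// subr_le0.
    by rewrite le_max lexx.
  apply: powR_le_ge0 => //; first exact: ltW.
  have H : 1 + t * r <= 1 + r by rewrite lerD2l ler_piMl// ltW.
  by rewrite ler_ln// posrE ?addr_gt0// mulr_gt0.
have -> : g = alpha - beta by apply/max_r; rewrite lerBrDl -lerBrDr subrr ltW.
rewrite (_ : - (alpha - beta) = - alpha + beta); last by ring.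
rewrite (powR_addE _ _ t0) -mulrA ler_pM2l ?powR_gt0//.
rewrite -powRM_gt0//; apply: powR_le_le0; [exact: ltW|by rewrite mulr_gt0|].
by apply: ln_1D_concave => //; exact: ltW.
Qed.

End kernel_majorant.

Section bracket.
Context {R : realType} {n : nat}.
Implicit Types x y : 'rV[R]_n.

(** The shift by e makes the logarithm of [bracket2 x] at least 1 everywhere, so that its negative
    powers are smooth and bounded. *)
Definition bracket2 x : R := expR 1 + sqn x.
Definition bracket x : R := Num.sqrt (bracket2 x).

Lemma expR1_ge2 : 2 <= expR 1 :> R.
Proof. by have := expR_ge1Dx (1 : R); lra. Qed.

Lemma bracket2_ge x : expR 1 <= bracket2 x.
Proof. by rewrite lerDl sqn_ge0. Qed.

Lemma bracket2_gt0 x : 0 < bracket2 x.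
Proof. exact: lt_le_trans (expR_gt0 1) (bracket2_ge x). Qed.

Lemma bracket_ge1 x : 1 <= bracket x.
Proof.
rewrite -sqrtr1; apply: ler_wsqrtr; apply: le_trans (bracket2_ge x).
by have := expR1_ge2; lra.
Qed.

Lemma bracket_gt0 x : 0 < bracket x.
Proof. exact: lt_le_trans ltr01 (bracket_ge1 x). Qed.

Lemma sqr_bracket x : bracket x ^+ 2 = bracket2 x.
Proof. by rewrite sqr_sqrtr// ltW// bracket2_gt0. Qed.

Lemma enorm_le_bracket x : enorm x <= bracket x.
Proof. by apply: ler_wsqrtr; rewrite lerDr ltW// expR_gt0. Qed.

Lemma bracket_lip x y : bracket x <= bracket y + enorm (x - y).
Proof.
have b0 := bracket_gt0 y; have e0 := enorm_ge0 (x - y).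
rewrite -ler_sqr ?nnegrE ?addr_ge0 ?(ltW b0) ?(ltW (bracket_gt0 x))//.
rewrite sqrrD !sqr_bracket /bracket2 -!sqr_enorm.
have : enorm x <= enorm y + enorm (x - y).
  by rewrite -{1}(subrK y x) addrC; apply: (le_trans (enorm_triangle _ _)); rewrite addrC.
move: (enorm_ge0 x) (enorm_ge0 y) e0 (enorm_le_bracket y) (b0).
move: (enorm x) (enorm y) (enorm (x - y)) (bracket y) => a b d B a0 b0' d0 bB B0 H.
have : a ^+ 2 <= (b + d) ^+ 2 by rewrite ler_sqr ?nnegrE ?addr_ge0.
have := ler_wpM2r d0 bB; rewrite sqrrD; lra.
Qed.

Lemma powR_bracket x e : bracket x `^ e = bracket2 x `^ (e / 2).
Proof.
rewrite -sqr_bracket powR_sqr ?ltW ?bracket_gt0//.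
by congr (_ `^ _); field.
Qed.

End bracket.

(** * Dyadic decomposition of the convolution *)

Section convolution_upper_bound.
Context {R : realType} {n : nat}.
Local Notation tupleR := (n.-tuple (measurableTypeR R)).
Local Notation mu := (@lebesgue_measure_tuple R n).
Local Notation L r := (ln (1 + r)).
Variables (alpha beta p alpha' beta' g CK : R).
Hypotheses (p0 : 0 <= p) (g0 : 0 <= g) (gn : g < n%:R).
Hypotheses (beta'2 : beta' <= - 2) (CK0 : 0 < CK).
Local Notation kap := (kappa alpha' beta').
Hypothesis HK : forall (r : R) (z : 'rV[R]_n), 1 <= r -> 0 < enorm z -> enorm z <= r ->
  Kab alpha beta z <= CK * (enorm z / r) `^ (- g) * kap r.
Hypothesis HK0 : forall r : R, 1 <= r -> Kab alpha beta (0 : 'rV[R]_n) <= CK * kap r.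
Local Notation D := (n%:R - 2 : R).
Local Notation a := (D * p).
Hypotheses (D0 : 0 <= D) (aa' : n%:R <= a + alpha').

(** At distances comparable to [r] the singularity exponent [g] only enters a constant; the decay is
    that of the majorant with exponents [alpha'] and [beta'], which may differ from those of the
    kernel. *)
Lemma kernel_away (e r : R) (z : 'rV[R]_n) : 0 < e -> 1 <= r -> e * r <= enorm z ->
  enorm z <= r -> Kab alpha beta z <= CK * e `^ (- g) * kap r.
Proof.
move=> e0 r1 ez zr; have r0 : 0 < r by exact: lt_le_trans r1.
have z0 : 0 < enorm z by apply: lt_le_trans ez; rewrite mulr_gt0.
apply: (le_trans (HK r1 z0 zr)); rewrite ler_wpM2r ?(ltW (kappa_gt0 _ _ r0))//.
rewrite ler_pM2l//; apply: powR_le_le0; [by rewrite oppr_le0|by []|].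
by rewrite ler_pdivlMr.
Qed.

Lemma kappa_triple (r : R) : 1 <= r -> kap (3 * r) <= 3 `^ (- alpha') * kap r.
Proof.
move=> r1; have r0 : 0 < r by exact: lt_le_trans r1.
rewrite /kappa powRM_gt0// -mulrA ler_pM2l ?powR_gt0// ler_pM2l ?powR_gt0//.
apply: powR_le_le0; [by apply: le_trans beta'2 _; rewrite oppr_le0|exact: ln_gt0_1D|].
have r3 : 1 + r <= 1 + 3 * r by rewrite lerD2l ler_peMl ?(ltW r0)// ler1n.
by rewrite ler_ln// posrE addr_gt0// mulr_gt0.
Qed.

Variables (u : 'rV[R]_n -> R) (v : R).
Hypotheses (v0 : 0 <= v) (u0 : forall y, 0 <= u y).
Hypothesis uv : forall y, u y <= v * bracket y `^ (- D).

Lemma powR_u_le (e : R) y : 0 < e -> e <= bracket y -> u y `^ p <= v `^ p * e `^ (- a).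
Proof.
move=> e0 ey; have by0 := bracket_gt0 y.
apply: (@le_trans _ _ ((v * bracket y `^ (- D)) `^ p)); first exact: powR_le_ge0.
rewrite powRM ?powR_ge0// ler_wpM2l ?powR_ge0// -powRrM mulNr.
by apply: powR_le_le0 => //; rewrite oppr_le0 mulr_ge0.
Qed.

Lemma cube_of_enorm (c : 'rV[R]_n) (s : R) (t : tupleR) : enorm (rV_of_tuple t - c) <= s ->
  cube c s t.
Proof.
by move=> ts; apply/cubeP => i; apply: le_trans ts; exact: coord_le_enorm.
Qed.

Variable x : 'rV[R]_n.
Local Notation r := (bracket x).
Let r1 : 1 <= r := bracket_ge1 x.
Let r0 : 0 < r := bracket_gt0 x.
Local Notation F t := (Kab alpha beta (x - rV_of_tuple t) * u (rV_of_tuple t) `^ p).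

(* The integral is split over [|x - y| <= r / 2], over [|y| <= 2 r] away from
   [x], and over [|y| > 2 r], and each part is dominated by a sum over dyadic
   cubes: shrinking to [x], growing from [0] up to size [4 r], growing from [r]. *)
Definition near_coef : R := CK * 4 `^ g * (2 `^ a * v `^ p) * (kap r * r `^ (- a)).
Definition near_series : tupleR -> \bar R :=
  cube_series x (fun k => r / 2 / 2 ^+ k) (fun k => near_coef * (2 `^ g) ^+ k).

Lemma near_bound t : enorm (x - rV_of_tuple t) <= r / 2 -> ((F t)%:E <= near_series t)%E.
Proof.
move=> tx; set y := rV_of_tuple t in tx *.
have k0 : 0 < kap r by exact: kappa_gt0.
have c0 k : 0 <= near_coef * (2 `^ g) ^+ k.
  by rewrite !mulr_ge0 ?exprn_ge0 ?powR_ge0 ?ltW.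
have br : r / 2 <= bracket y by have := bracket_lip x y; have := r0; lra.
have up : u y `^ p <= v `^ p * (2 `^ a * r `^ (- a)).
  apply: le_trans (powR_u_le _ br) _; first by rewrite divr_gt0.
  by rewrite powR_divE// [2 `^ (- a)]powRN invrK [2 `^ a * _]mulrC.
have ku (k : nat) (K : R) : 0 <= K -> K <= CK * 4 `^ g * (2 `^ g) ^+ k * kap r ->
    K * u y `^ p <= near_coef * (2 `^ g) ^+ k.
  move=> K0 HKk; apply: (le_trans (ler_pM K0 (powR_ge0 _ _) HKk up)).
  rewrite /near_coef le_eqVlt; apply/orP; left; apply/eqP.
  move: (r `^ (- a)) (2 `^ a) (kap r) => X Y Z; ring.
(* At y = x no dyadic scale exists; the value of the kernel at 0 is controlled separately and the
   largest cube is used. *)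
have [z0|z0] := eqVneq (enorm (x - y)) 0.
  have xy : x - y = 0.
    by apply/rowP => i; have := coord_le_enorm (x - y) i; rewrite z0 normr_le0 [RHS]mxE => /eqP.
  apply: (cube_series_ge (k := 0%N) c0).
    by apply: cube_of_enorm; rewrite -/y -enormN opprB z0 !divr_ge0 ?exprn_ge0// (ltW r0).
  apply: ku; first exact: Kab_ge0.
  rewrite xy expr0 mulr1; apply: (le_trans (HK0 r1)).
  rewrite ler_pM2r// ler_peMr ?(ltW CK0)//.
  by rewrite -[leLHS](powRr0 4); apply: ler_powR; rewrite ?ler1n.
have {}z0 : 0 < enorm (x - y) by rewrite lt_def z0 enorm_ge0.
have [k /andP[k1 k2]] := dyadic_down z0 tx.
apply: (cube_series_ge (k := k) c0).
  by apply: cube_of_enorm; rewrite -/y -enormN opprB.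
apply: ku; first exact: Kab_ge0.
have zr : enorm (x - y) <= r by have := r0; lra.
have e0 : 0 < (4 * 2 ^+ k)^-1 :> R by rewrite invr_gt0 mulr_gt0// exprn_gt0.
have ez : (4 * 2 ^+ k)^-1 * r <= enorm (x - y).
  apply: le_trans (ltW k1); rewrite exprS le_eqVlt; apply/orP; left; apply/eqP.
  by field; rewrite expf_neq0.
apply: (le_trans (kernel_away e0 r1 ez zr)).
rewrite ler_pM2r// -mulrA ler_pM2l// -powR_inv1 ?mulr_ge0 ?exprn_ge0//.
rewrite -powRrM mulN1r opprK powRM ?exprn_ge0// ler_pM2l ?powR_gt0//.
by rewrite -(powR_mulrn k (powR_ge0 2 g)) -(powR_mulrn k (ler0n R 2)) -!powRrM mulrC.
Qed.

(** Halving the radius multiplies the kernel bound by 2^g and the volume by 2^(-n); the series is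
    geometric of ratio 2^(g-n) < 1. *)
Lemma near_integral : (\int[mu]_t near_series t <=
  (near_coef * r ^+ n / (1 - 2 `^ (g - n%:R)))%:E)%E.
Proof.
apply: integral_cube_series => [k|k|J].
- by rewrite !divr_ge0 ?exprn_ge0// ltW.
- by rewrite !mulr_ge0 ?exprn_ge0 ?powR_ge0 ?ltW// kappa_gt0.
have q1 : 2 `^ (g - n%:R) < 1 :> R.
  by rewrite /powR pnatr_eq0/= expR_lt1 pmulr_llt0 ?subr_lt0// ln_gt0// ltr1n.
apply: le_trans (ler_wpM2l _ (geometric_sum_le J (powR_ge0 _ _) q1)); last first.
  by rewrite !mulr_ge0 ?exprn_ge0 ?powR_ge0 ?ltW// kappa_gt0.
rewrite mulr_sumr; apply: ler_sum => k _.
have -> : 2 * (r / 2 / 2 ^+ k) = r * (2 ^+ k)^-1 by field; rewrite expf_neq0.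
rewrite (powR_addE _ _ (ltr0Sn R 1)) powRN powR_mulrn// !exprMn !exprVn -!exprM mulnC.
by rewrite le_eqVlt; apply/orP; left; apply/eqP; ring.
Qed.

Definition middle_coef : R := CK * 6 `^ g * (3 `^ (- alpha') * kap r) * (v `^ p * 2 `^ a).
Definition middle_series : tupleR -> \bar R :=
  cube_series 0 (fun k => 2 ^+ k)
    (fun k => if 2 ^+ k < 4 * r then middle_coef * (2 ^+ k) `^ (- a) else 0).

Lemma middle_coef_ge0 : 0 <= middle_coef.
Proof. by rewrite !mulr_ge0 ?powR_ge0 ?(ltW CK0)// ltW// kappa_gt0. Qed.

Lemma middle_bound t : r / 2 < enorm (x - rV_of_tuple t) -> enorm (rV_of_tuple t) <= 2 * r ->
  ((F t)%:E <= middle_series t)%E.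
Proof.
move=> tx ty; set y := rV_of_tuple t in tx ty *.
have k0 : 0 < kap r by exact: kappa_gt0.
have c0 k : 0 <= (if 2 ^+ k < 4 * r then middle_coef * (2 ^+ k) `^ (- a) else 0).
  by case: ifP => // _; rewrite mulr_ge0 ?powR_ge0// middle_coef_ge0.
have ku (k : nat) : 2 ^+ k / 2 <= bracket y -> 2 ^+ k < 4 * r ->
    Kab alpha beta (x - y) * u y `^ p <=
    (if 2 ^+ k < 4 * r then middle_coef * (2 ^+ k) `^ (- a) else 0).
  move=> ky kr; rewrite kr; have pk : 0 < 2 ^+ k :> R by rewrite exprn_gt0.
  have up : u y `^ p <= v `^ p * (2 `^ a * (2 ^+ k) `^ (- a)).
    apply: le_trans (powR_u_le _ ky) _; first by rewrite divr_gt0.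
    by rewrite powR_divE// [2 `^ (- a)]powRN invrK [2 `^ a * _]mulrC.
  have r3 : 1 <= 3 * r by have := r1; lra.
  have zr : enorm (x - y) <= 3 * r.
    apply: (le_trans (enorm_triangle _ _)); rewrite enormN.
    have := enorm_le_bracket x; lra.
  have e0 : 0 < 6^-1 :> R by rewrite invr_gt0.
  have ez : 6^-1 * (3 * r) <= enorm (x - y) by apply: le_trans (ltW tx); lra.
  have Kz := kernel_away e0 r3 ez zr.
  have {}Kz : Kab alpha beta (x - y) <= CK * 6 `^ g * (3 `^ (- alpha') * kap r).
    apply: (le_trans Kz); rewrite -(powR_inv1 (ler0n _ 6)) -powRrM mulN1r opprK.
    by apply: ler_wpM2l (kappa_triple r1); rewrite mulr_ge0 ?powR_ge0 ?(ltW CK0).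
  apply: (le_trans (ler_pM (Kab_ge0 _ _ _) (powR_ge0 _ _) Kz up)).
  rewrite /middle_coef le_eqVlt; apply/orP; left; apply/eqP.
  move: (2 `^ a) ((2 ^+ k) `^ (- a)) (kap r) => X Y Z; ring.
have [y1|y1] := leP (enorm y) 1.
  apply: (cube_series_ge (k := 0%N) c0).
    by apply: cube_of_enorm; rewrite -/y subr0.
  apply: ku; rewrite expr0; last by have := r1; lra.
  by have := bracket_ge1 y; lra.
have [j] := dyadic_up ltr01 y1; rewrite !mul1r => /andP[j1 j2].
apply: (cube_series_ge (k := j.+1) c0).
  by apply: cube_of_enorm; rewrite -/y subr0.
have jE : 2 ^+ j.+1 = 2 * 2 ^+ j :> R by rewrite exprS.
by apply: ku; rewrite jE; have := enorm_le_bracket y; lra.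
Qed.

(** Each scale contributes at most a multiple of (4r)^max(n-a, 0), and about ln r scales occur.
    Counting every scale at the maximum loses at most one logarithm, which the final estimate
    allows. *)
Lemma middle_integral : (\int[mu]_t middle_series t <=
  (2 ^+ n * middle_coef * (4 * r) `^ Num.max (n%:R - a) 0 * (1 + ln (4 * r) / ln 2))%:E)%E.
Proof.
have m0 := middle_coef_ge0; have r4 : 1 <= 4 * r by have := r1; lra.
set e := Num.max _ _; have e0 : 0 <= e by rewrite le_max lexx orbT.
apply: integral_cube_series => [k|k|J].
- by rewrite exprn_ge0.
- by case: ifP => // _; rewrite mulr_ge0 ?powR_ge0.
apply: le_trans (count_dyadic_le J _ r4); last first.
  by rewrite mulr_ge0 ?powR_ge0// mulr_ge0 ?exprn_ge0.
apply: ler_sum => k _; case: ifP => kr; last by rewrite mul0r.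
have pk : 0 < 2 ^+ k :> R by rewrite exprn_gt0.
rewrite exprMn (_ : middle_coef * _ * _ =
  2 ^+ n * middle_coef * ((2 ^+ k) `^ (- a) * (2 ^+ k) ^+ n)); last first.
  by move: ((2 ^+ k) `^ (- a)) => X; ring.
apply: ler_wpM2l; first by apply: mulr_ge0 => //; exact: exprn_ge0.
rewrite -(powR_mulrn n (ltW pk)) -(powR_addE _ _ pk) addrC.
apply: (@le_trans _ _ ((2 ^+ k) `^ e)).
  by apply: ler_powR; rewrite ?exprn_ege1 ?ler1n// le_max lexx.
by apply: powR_le_ge0 => //; exact: ltW.
Qed.

Definition far_coef : R := CK * 8 `^ g * (4 `^ a * v `^ p).
(** For 2r 2^k < |y| <= 2r 2^(k+1), the triangle inequality puts |x - y| between [far_radius k / 8]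
    and [far_radius k], while |y| <= [far_radius k / 2]. *)
Definition far_radius k : R := r * 2 ^+ k.+3.
Definition far_series : tupleR -> \bar R :=
  cube_series 0 (fun k => far_radius k / 2)
    (fun k => far_coef * (kap (far_radius k) * far_radius k `^ (- a))).

Lemma far_radius_ge1 k : r <= far_radius k.
Proof. by rewrite ler_peMr ?(ltW r0)// exprn_ege1 ?ler1n. Qed.

Lemma far_coef_ge0 : 0 <= far_coef.
Proof. by rewrite !mulr_ge0 ?powR_ge0 ?(ltW CK0). Qed.

Lemma far_bound t : 2 * r < enorm (rV_of_tuple t) -> ((F t)%:E <= far_series t)%E.
Proof.
move=> ty; set y := rV_of_tuple t in ty *.
have P1 k : 1 <= far_radius k by apply: le_trans r1 (far_radius_ge1 k).
have P0 k : 0 < far_radius k by exact: lt_le_trans (P1 k).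
have c0 k : 0 <= far_coef * (kap (far_radius k) * far_radius k `^ (- a)).
  by rewrite mulr_ge0 ?far_coef_ge0// mulr_ge0 ?powR_ge0// ltW// kappa_gt0.
have r20 : 0 < 2 * r by rewrite mulr_gt0//; exact: r0.
have [k /andP[k1 k2]] := dyadic_up r20 ty.
have PE : far_radius k = 4 * (2 * r * 2 ^+ k) by rewrite /far_radius !exprS; ring.
have PE2 : far_radius k = 2 * (2 * r * 2 ^+ k.+1) by rewrite /far_radius !exprS; ring.
apply: (cube_series_ge (k := k) c0).
  by apply: cube_of_enorm; rewrite -/y subr0 PE2; lra.
have P := P0 k.
have ry : r < enorm y / 2 by lra.
have xr := enorm_le_bracket x.
have zP : enorm (x - y) <= far_radius k.
  by apply: (le_trans (enorm_triangle _ _)); rewrite enormN; lra.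
have zP2 : 8^-1 * far_radius k <= enorm (x - y).
  rewrite -enormN opprB; apply: le_trans (enormB_ge _ _); lra.
have e0 : 0 < 8^-1 :> R by rewrite invr_gt0.
have Kz := kernel_away e0 (P1 k) zP2 zP.
rewrite -(powR_inv1 (ler0n _ 8)) -powRrM mulN1r opprK in Kz.
have yP : far_radius k / 4 <= bracket y by have := enorm_le_bracket y; lra.
have up : u y `^ p <= v `^ p * (4 `^ a * far_radius k `^ (- a)).
  apply: le_trans (powR_u_le _ yP) _; first by rewrite divr_gt0.
  by rewrite powR_divE// [4 `^ (- a)]powRN invrK [4 `^ a * _]mulrC.
apply: (le_trans (ler_pM (Kab_ge0 _ _ _) (powR_ge0 _ _) Kz up)).
rewrite /far_coef le_eqVlt; apply/orP; left; apply/eqP.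
move: (4 `^ a) (far_radius k `^ (- a)) (kap _) => X Y Z; ring.
Qed.

(** The power of the radius has exponent n - a - alpha' <= 0 and is bounded by its value at [r];
    summability comes from the logarithms, which grow arithmetically in [k] and carry a power beta'
    <= -2. *)
Lemma far_integral : (\int[mu]_t far_series t <=
  (far_coef * r `^ (n%:R - a - alpha') * (2 / ln 2 * L r `^ (beta' + 1)))%:E)%E.
Proof.
have m0 := far_coef_ge0.
have P1 k : 1 <= far_radius k by apply: le_trans r1 (far_radius_ge1 k).
have P0 k : 0 < far_radius k by exact: lt_le_trans (P1 k).
have rr := r0; have rr1 := r1.
have L2 : ln 2 <= L r by rewrite ler_ln ?posrE ?addr_gt0//; lra.
apply: integral_cube_series => [k|k|J].
- by rewrite divr_ge0// ltW.
- by rewrite mulr_ge0// mulr_ge0 ?powR_ge0// ltW// kappa_gt0.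
apply: le_trans (ler_wpM2l _ (sum_arithmetic_powR J L2 beta'2)); last first.
  by rewrite mulr_ge0 ?powR_ge0.
rewrite mulr_sumr; apply: ler_sum => k _.
have P := P0 k.
rewrite (_ : 2 * (far_radius k / 2) = far_radius k); last by field.
rewrite -(powR_mulrn n (ltW P)) /kappa.
rewrite (_ : far_coef * _ * _ = far_coef * (far_radius k `^ (n%:R - a - alpha') *
   L (far_radius k) `^ beta')); last first.
  have -> : far_radius k `^ (n%:R - a - alpha') = 
    far_radius k `^ (- alpha') * far_radius k `^ (- a) * far_radius k `^ n%:R.
    by rewrite -!(powR_addE _ _ P); congr (_ `^ _); ring.
  move: (far_radius k `^ (- a)) (far_radius k `^ (- alpha')) (far_radius k `^ n%:R) => X Y Z; ring.
rewrite -[leRHS]mulrA ler_wpM2l//; apply: ler_pM; rewrite ?powR_ge0//.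
  by apply: powR_le_le0 (far_radius_ge1 k) => //; have := aa'; lra.
have l2 : 0 < ln 2 :> R by rewrite ln_gt0// ltr1n.
apply: powR_le_le0; first by apply: le_trans beta'2 _; rewrite oppr_le0.
  by rewrite ltr_wpDr ?mulr_ge0 ?(ltW l2)// ln_gt0_1D.
have r10 : 0 < 1 + r by lra.
rewrite mulr_natl -lnXn// -lnM ?posrE ?exprn_gt0//.
rewrite ler_ln ?posrE ?mulr_gt0 ?exprn_gt0 ?addr_gt0//.
have p1 : 1 <= 2 ^+ k :> R by rewrite exprn_ege1// ler1n.
have : r * 2 ^+ k.+1 <= far_radius k by rewrite /far_radius ler_pM2l// ler_weXn2l ?ler1n// -(addn2 k.+1) leq_addr.
have := ler_wpM2r (ltW (lt_le_trans ltr01 p1)) rr1; rewrite exprS mulrDl; lra.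
Qed.

Lemma Kconv_le_sum : continuous u -> (Kconv alpha beta p u x <=
  (near_coef * r ^+ n / (1 - 2 `^ (g - n%:R)) +
   2 ^+ n * middle_coef * (4 * r) `^ Num.max (n%:R - a) 0 * (1 + ln (4 * r) / ln 2) +
   far_coef * r `^ (n%:R - a - alpha') * (2 / ln 2 * L r `^ (beta' + 1)))%:E)%E.
Proof.
move=> cu; have k0 : 0 < kap r by exact: kappa_gt0.
have s10 t : (0 <= near_series t)%E.
  apply: cube_series_ge0 => k.
  by rewrite !mulr_ge0 ?exprn_ge0 ?powR_ge0 ?ltW.
have s20 t : (0 <= middle_series t)%E.
  apply: cube_series_ge0 => k.
  by case: ifP => // _; rewrite mulr_ge0 ?powR_ge0// middle_coef_ge0.
have s30 t : (0 <= far_series t)%E.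
  apply: cube_series_ge0 => k; rewrite mulr_ge0 ?far_coef_ge0// mulr_ge0 ?powR_ge0// ltW// kappa_gt0//.
  by rewrite mulr_gt0// exprn_gt0.
have m1 : measurable_fun setT near_series.
  by apply: measurable_cube_series => k; rewrite !mulr_ge0 ?exprn_ge0 ?powR_ge0 ?ltW.
have m2 : measurable_fun setT middle_series.
  apply: measurable_cube_series => k.
  by case: ifP => // _; rewrite mulr_ge0 ?powR_ge0// middle_coef_ge0.
have m3 : measurable_fun setT far_series.
  apply: measurable_cube_series => k; rewrite mulr_ge0 ?far_coef_ge0// mulr_ge0 ?powR_ge0// ltW// kappa_gt0//.
  by rewrite mulr_gt0// exprn_gt0.
rewrite !EFinD; apply: le_trans (leeD (leeD near_integral middle_integral) far_integral).
rewrite -!ge0_integralD//; last by exact: emeasurable_funD.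
  apply: ge0_le_integral => //.
  - by move=> t _; rewrite lee_fin mulr_ge0 ?Kab_ge0 ?powR_ge0.
  - exact: measurable_Kab_powR.
  - by do 2 apply: emeasurable_funD => //.
  move=> t _ /=; have [tx|tx] := leP (enorm (x - rV_of_tuple t)) (r / 2).
    apply: (le_trans (near_bound tx)); rewrite -addeA leeDl//; exact: adde_ge0.
  have [ty|ty] := leP (enorm (rV_of_tuple t)) (2 * r).
    apply: (le_trans (middle_bound tx ty)); rewrite addeAC leeDr//; exact: adde_ge0.
  by apply: (le_trans (far_bound ty)); rewrite leeDr//; exact: adde_ge0.
by move=> t _; exact: adde_ge0.
Qed.

End convolution_upper_bound.

Section convolution_decay.
Context {R : realType} {n : nat}.
Local Notation L r := (ln (1 + r)).
Local Notation D := (n%:R - 2 : R).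

(** In all three regions the power of [r] is dominated by r^(e-alpha'); the near part lacks a
    logarithm and is raised using ln(1+r) >= ln 2. The constant does not depend on [u], and v^p is
    kept explicit for the later scaling. *)
Lemma Kconv_decay (alpha beta p alpha' beta' g CK : R) : 0 <= p -> 0 <= g ->
  g < n%:R -> beta' <= - 2 -> 0 < CK ->
  (forall (r : R) (z : 'rV[R]_n), 1 <= r -> 0 < enorm z -> enorm z <= r ->
    Kab alpha beta z <= CK * (enorm z / r) `^ (- g) * kappa alpha' beta' r) ->
  (forall r : R, 1 <= r -> Kab alpha beta (0 : 'rV[R]_n) <= CK * kappa alpha' beta' r) ->
  0 <= D -> n%:R <= D * p + alpha' ->
  exists2 C, 0 < C & forall (u : 'rV[R]_n -> R) v, 0 <= v -> (forall y, 0 <= u y) ->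
    (forall y, u y <= v * bracket y `^ (- D)) -> continuous u -> forall x,
    (Kconv alpha beta p u x <=
     (C * v `^ p * (bracket x `^ (Num.max (n%:R - D * p) 0 - alpha') *
        L (bracket x) `^ (beta' + 1)))%:E)%E.
Proof.
move=> p0 g0 gn b2 CK0 HK HK0 D0 aa'; set a := D * p; set e := Num.max _ _.
have e0 : 0 <= e by rewrite le_max lexx orbT.
have l2 : 0 < ln 2 :> R by rewrite ln_gt0// ltr1n.
have q1 : 2 `^ (g - n%:R) < 1 :> R.
  by rewrite /powR pnatr_eq0/= expR_lt1 pmulr_llt0 ?subr_lt0// ln_gt0// ltr1n.
have q10 : 0 < 1 - 2 `^ (g - n%:R) :> R by rewrite subr_gt0.
pose C1 : R := CK * 4 `^ g * 2 `^ a / (1 - 2 `^ (g - n%:R)) / ln 2.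
pose C2 : R := 2 ^+ n * (CK * 6 `^ g * 3 `^ (- alpha') * 2 `^ a) * 4 `^ e * (4 / ln 2).
pose C3 : R := CK * 8 `^ g * 4 `^ a * (2 / ln 2).
have C10 : 0 < C1 by rewrite !(divr_gt0, mulr_gt0) ?powR_gt0.
have C20 : 0 < C2.
  apply: mulr_gt0; last exact: divr_gt0.
  apply: mulr_gt0; last exact: powR_gt0.
  by apply: mulr_gt0; [exact: exprn_gt0|rewrite !mulr_gt0 ?powR_gt0].
have C30 : 0 < C3 by apply: mulr_gt0; [rewrite !mulr_gt0 ?powR_gt0|exact: divr_gt0].
have ea : n%:R - a <= e by rewrite le_max lexx.
exists (C1 + C2 + C3); first by rewrite !addr_gt0.
move=> u v v0 u0 uv cu x.
apply: (le_trans (Kconv_le_sum p0 g0 gn b2 CK0 HK HK0 D0 aa' v0 u0 uv x cu)).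
rewrite lee_fin /near_coef /middle_coef /far_coef /kappa -/a -/e.
have := bracket_ge1 x; have := bracket_gt0 x; move: (bracket x) => r r0 r1.
have L2 : ln 2 <= L r by rewrite ler_ln ?posrE ?addr_gt0//; lra.
have L0 : 0 < L r by exact: lt_le_trans L2.
set lb := L r `^ beta'; have lb0 : 0 < lb by rewrite powR_gt0.
have -> : L r `^ (beta' + 1) = lb * L r by rewrite powR_add1.
have v00 : 0 <= v `^ p by exact: powR_ge0.
have ra : r `^ (- alpha') * r `^ (- a) * r ^+ n <= r `^ (e - alpha').
  rewrite -(powR_mulrn n (ltW r0)) -!(powR_addE _ _ r0); by apply: ler_powR => //; lra.
have rb : r `^ (- alpha') * r `^ e = r `^ (e - alpha') by rewrite -powR_addE// addrC.
have rc : r `^ (n%:R - a - alpha') <= r `^ (e - alpha').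
  by apply: ler_powR => //; lra.
have X0 : 0 < r `^ (e - alpha') by rewrite powR_gt0.
have G1 : CK * 4 `^ g * (2 `^ a * v `^ p) * (r `^ (- alpha') * lb * r `^ (- a)) *
    r ^+ n / (1 - 2 `^ (g - n%:R)) <= C1 * v `^ p * (r `^ (e - alpha') * (lb * L r)).
  rewrite (_ : CK * _ * _ * _ * _ / _ = CK * 4 `^ g * 2 `^ a / (1 - 2 `^ (g - n%:R)) * v `^ p * lb *
    (r `^ (- alpha') * r `^ (- a) * r ^+ n)); last by move: (r `^ (- a)) (2 `^ a) => Y Z; ring.
  rewrite (_ : C1 * _ * _ = CK * 4 `^ g * 2 `^ a / (1 - 2 `^ (g - n%:R)) * v `^ p * lb *
    (r `^ (e - alpha') * (L r / ln 2))); last by rewrite /C1; move: (r `^ (e - alpha')) => Y; ring.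
  apply: ler_wpM2l.
    by rewrite !mulr_ge0 ?invr_ge0 ?powR_ge0 ?(ltW CK0) ?(ltW q10) ?(ltW lb0).
  by apply: (le_trans ra); rewrite ler_peMr ?(ltW X0)// ler_pdivlMr// mul1r.
have G2 : 2 ^+ n * (CK * 6 `^ g * (3 `^ (- alpha') * (r `^ (- alpha') * lb)) * (v `^ p * 2 `^ a)) *
    (4 * r) `^ e * (1 + ln (4 * r) / ln 2) <= C2 * v `^ p * (r `^ (e - alpha') * (lb * L r)).
  rewrite powRM_gt0// -rb.
  set B := 2 ^+ n * (CK * 6 `^ g * 3 `^ (- alpha') * 2 `^ a) * 4 `^ e.
  have B0 : 0 <= B.
    apply: mulr_ge0; last exact: powR_ge0.
    by apply: mulr_ge0; [exact: exprn_ge0|rewrite !mulr_ge0 ?powR_ge0 ?(ltW CK0)].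
  rewrite (_ : 2 ^+ n * _ * _ * _ = B * v `^ p * (r `^ (- alpha') * r `^ e * lb) *
     (1 + ln (4 * r) / ln 2)); last first.
    rewrite /B; move: (r `^ (- alpha')) (r `^ e) (2 `^ a) (4 `^ e) (3 `^ _) => Y Z Y1 Y2 Y3; ring.
  rewrite (_ : C2 * _ * _ = B * v `^ p * (r `^ (- alpha') * r `^ e * lb) *
     (4 / ln 2 * L r)); last first.
    rewrite /C2 -/B; move: (r `^ (- alpha')) (r `^ e) => Y Z; ring.
  apply: ler_wpM2l; first by rewrite !mulr_ge0 ?powR_ge0// ltW.
  have l4 : ln (4 * r) <= 3 * L r.
    rewrite lnM ?posrE// (_ : 4 = 2 ^+ 2 :> R); last by rewrite -natrX.
    rewrite lnXn//.
    have : ln r <= L r by rewrite ler_ln ?posrE ?addr_gt0// lerDr.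
    clear -L2; lra.
  have -> : 1 + ln (4 * r) / ln 2 = (ln 2 + ln (4 * r)) / ln 2 by field; rewrite gt_eqF.
  by rewrite mulrAC ler_pM2r ?invr_gt0//; lra.
have G3 : CK * 8 `^ g * (4 `^ a * v `^ p) * r `^ (n%:R - a - alpha') * (2 / ln 2 * (lb * L r)) <=
    C3 * v `^ p * (r `^ (e - alpha') * (lb * L r)).
  rewrite (_ : CK * _ * _ * _ * _ = C3 * v `^ p * (lb * L r) * r `^ (n%:R - a - alpha')); last first.
    by rewrite /C3; move: (4 `^ a) (r `^ _) => Y Z; ring.
  rewrite [r `^ (e - alpha') * _]mulrC [leRHS]mulrA; apply: ler_wpM2l => //.
  exact: (mulr_ge0 (mulr_ge0 (ltW C30) v00) (mulr_ge0 (ltW lb0) (ltW L0))).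
rewrite [(C1 + C2 + C3) * _]mulrDl [(C1 + C2) * _]mulrDl [leRHS]mulrDl [(_ + _) * (r `^ _ * _)]mulrDl.
exact: lerD (lerD G1 G2) G3.
Qed.

End convolution_decay.

(** * An explicit solution *)

Section log_powers.
Context {R : realType} {n : nat}.
Implicit Types x c : 'rV[R]_n.

Lemma classC_coord k (i : 'I_n) : classC k (fun x : 'rV[R]_n => x 0 i).
Proof.
case: k => [|k]; first by split=> //; exact: continuous_coord.
apply: (@classC_intro _ _ _ _ (fun j _ => (i == j)%:R)) => [|j x|j].
- exact: continuous_coord.
- exact: isd_coord.
- exact: classC_cst.
Qed.

Lemma classCM k (f g : 'rV[R]_n -> R) : classC k f -> classC k g -> classC k (fun x => f x * g x).
Proof.
elim: k f g => [|k IH] f g cf cg.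
  by split=> //; apply: contM; [exact: classC_continuous cf|exact: classC_continuous cg].
apply: (@classC_intro _ _ _ _ (fun i x => f x * partial i g x + g x * partial i f x)).
- by apply: contM; [exact: classC_continuous cf|exact: classC_continuous cg].
- move=> i x; exact: (isdM (classC_derive i x cf) (classC_derive i x cg)).
- move=> i; apply: classCD; apply: IH.
  + exact: classCS.
  + exact: classC_partial.
  + exact: classCS.
  + exact: classC_partial.
Qed.

(** Up to linear combinations this family is closed under differentiation and multiplication by [s],
    so iterated Laplacians stay inside it. *)
Definition lprof (a b s : R) : R := s `^ (- a) * ln s `^ (- b).
Definition lpow (a b : R) x : R := lprof a b (bracket2 x).

Lemma ln_ge1 (s : R) : expR 1 <= s -> 1 <= ln s.
Proof.
move=> es; rewrite -[leLHS](expRK 1) ler_ln ?posrE ?expR_gt0//.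
exact: lt_le_trans (expR_gt0 1) es.
Qed.

Lemma lprof_gt0 (a b s : R) : 1 < s -> 0 < lprof a b s.
Proof. by move=> s1; rewrite mulr_gt0 ?powR_gt0 ?ln_gt0// (lt_trans ltr01). Qed.

Lemma isd_lprof (a b s : R) : 1 < s ->
  is_derive s (1 : R) (lprof a b) (- (a * lprof (a + 1) b s + b * lprof (a + 1) (b + 1) s)).
Proof.
move=> s1; have s0 : 0 < s by exact: lt_trans s1.
have l0 : 0 < ln s by exact: ln_gt0.
have H := isdM (isd_powR (- a) s0) (isd_comp (is_derive1_ln s0) (isd_powR (- b) l0)).
apply: (is_derive_eq H); rewrite /lprof.
rewrite (_ : - (a + 1) = - a - 1); last by ring.
rewrite (_ : - (b + 1) = - b - 1); last by ring.
rewrite {1}(_ : - a = - a - 1 + 1); last by ring.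
rewrite (powR_add1 _ s0); field; exact: lt0r_neq0.
Qed.

Lemma bracket2_gt1 x : 1 < bracket2 x.
Proof. by apply: lt_le_trans (bracket2_ge x); have := @expR1_ge2 R; lra. Qed.

Lemma bracket2E : bracket2 = (fun x : 'rV[R]_n => expR 1 + sqn (x - 0)).
Proof. by apply/funext => x; rewrite subr0. Qed.

Lemma isd_bracket2 (i : 'I_n) x : is_derive x (dirv i) bracket2 (2 * x 0 i).
Proof.
rewrite bracket2E; have H := isdD (isd_cst (expR 1) x (dirv i)) (isd_sqn i x 0).
by apply: (is_derive_eq H); rewrite add0r subr0.
Qed.

Lemma isd_lpow (a b : R) (i : 'I_n) x : is_derive x (dirv i) (lpow a b)
  (2 * (x 0 i * - (a * lpow (a + 1) b x + b * lpow (a + 1) (b + 1) x))).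
Proof.
have H := isd_comp (isd_bracket2 i x) (isd_lprof a b (bracket2_gt1 x)).
by apply: (is_derive_eq H); rewrite /lpow; ring.
Qed.

Lemma continuous_lpow (a b : R) : continuous (lpow a b).
Proof.
move=> x; apply: (@continuous_comp _ _ _ bracket2 (lprof a b)).
  rewrite bracket2E; exact: (contD (@cst_continuous _ _ _) (@continuous_sqn _ _ 0)).
apply/differentiable_continuous/derivable1_diffP.
by have [] := isd_lprof a b (bracket2_gt1 x).
Qed.

Lemma classC_lpow k (a b : R) : classC k (lpow a b).
Proof.
elim: k a b => [|k IH] a b; first by split=> //; exact: continuous_lpow.
apply: (@classC_intro _ _ _ _ (fun i x =>
  2 * (x 0 i * (- 1 * (a * lpow (a + 1) b x + b * lpow (a + 1) (b + 1) x))))).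
- exact: continuous_lpow.
- by move=> i x; rewrite mulN1r; exact: isd_lpow.
move=> i; apply: classCZ; apply: classCM; first exact: classC_coord.
by apply: classCZ; apply: classCD; apply: classCZ; exact: IH.
Qed.

(** The second derivative of [lprof a b]. *)
Definition lprof2 (a b s : R) : R := a * (a + 1) * lprof (a + 2) b s +
  b * (2 * a + 1) * lprof (a + 2) (b + 1) s + b * (b + 1) * lprof (a + 2) (b + 2) s.

Lemma laplacian_lpow (a b : R) x : laplacian (lpow a b) x =
  4 * sqn x * lprof2 a b (bracket2 x) -
  2 * n%:R * (a * lpow (a + 1) b x + b * lpow (a + 1) (b + 1) x).
Proof.
pose h t := lprof a b (expR 1 + t).
pose h1 t := - (a * lprof (a + 1) b (expR 1 + t) + b * lprof (a + 1) (b + 1) (expR 1 + t)).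
have sh (t : R) : is_derive t (1 : R) (fun t => expR 1 + t) (1 : R).
  by have H := isdD (isd_cst (expR 1) t (1 : R)) (is_derive_id t 1); apply: (is_derive_eq H); rewrite add0r.
have t1 (t : R) : -1 < t -> 1 < expR 1 + t by have := @expR1_ge2 R; lra.
have lE : lpow a b = fun y => h (sqn (y - 0)) by rewrite /lpow bracket2E.
have dh (t : R) : -1 < t -> is_derive t (1 : R) h (h1 t).
  move=> tt; have H := isd_comp (sh t) (isd_lprof a b (t1 t tt)).
  by apply: (is_derive_eq H); rewrite mulr1.
have dh1 : is_derive (sqn (x - 0)) (1 : R) h1 (lprof2 a b (bracket2 x)).
  have tt : -1 < sqn (x - 0) by apply: lt_le_trans (sqn_ge0 _); rewrite oppr_lt0.
  have Ha := isd_comp (sh _) (isd_lprof (a + 1) b (t1 _ tt)).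
  have Hb := isd_comp (sh _) (isd_lprof (a + 1) (b + 1) (t1 _ tt)).
  have H := isdN (isdD (isdZ a Ha) (isdZ b Hb)).
  apply: (is_derive_eq H); rewrite /lprof2 /bracket2 subr0 -!addrA.
  rewrite (_ : 1 + 1 = 2 :> R)//; ring.
have near_h : \forall s \near sqn (x - 0), is_derive (s : R) (1 : R) h (h1 s).
  have : \forall s \near sqn (x - 0), -1 < (s : R).
    by apply: lt_nbhsr; apply: lt_le_trans (sqn_ge0 _); rewrite oppr_lt0.
  by apply: filterS => s; exact: dh.
rewrite lE (is_lap_laplacian (is_lap_radial near_h dh1)) subr0 /h1 -/(bracket2 x) -/(lpow _ _ x).
by rewrite -/(lpow (a + 1) (b + 1) x); ring.
Qed.

End log_powers.

(** * The profile with a logarithmic correction *)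

Section log_profile.
Context {R : realType} {n : nat}.
Implicit Types x : 'rV[R]_n.
Hypothesis n2 : (2 < n)%N.
Local Notation A := (expR 1 : R).
Local Notation m := (n%:R / 2 - 1 : R).

Lemma lprof_mul (a b s : R) : 0 < s -> s * lprof (a + 2) b s = lprof (a + 1) b s.
Proof.
move=> s0; rewrite /lprof (_ : - (a + 1) = - (a + 2) + 1); last by ring.
by rewrite (powR_add1 _ s0); ring.
Qed.

Lemma lprof_le (a b a' b' s : R) : A <= s -> a <= a' -> b <= b' -> lprof a' b' s <= lprof a b s.
Proof.
move=> es aa bb; have s1 : 1 <= s by apply: le_trans es; have := @expR1_ge2 R; lra.
have l1 := ln_ge1 es; apply: ler_pM; rewrite ?powR_ge0//; apply: ler_powR => //; rewrite lerN2//.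
Qed.

(** Writing |x|^2 = s - e sorts the terms by powers of [s]: exponent a + 1 for the part containing
    s, a + 2 for the remainder left by the shift. For a = m the coefficient of the leading term
    vanishes. *)
Lemma laplacian_lpowE (a b : R) x : laplacian (lpow a b) x =
  (4 * a * (a + 1) - 2 * n%:R * a) * lpow (a + 1) b x +
  (4 * b * (2 * a + 1) - 2 * n%:R * b) * lpow (a + 1) (b + 1) x +
  4 * b * (b + 1) * lpow (a + 1) (b + 2) x - 4 * A * lprof2 a b (bracket2 x).
Proof.
rewrite laplacian_lpow /lprof2 /lpow -!(lprof_mul a _ (bracket2_gt0 x)).
rewrite (_ : sqn x = bracket2 x - A); last by rewrite /bracket2 addrC addKr.
by move: (bracket2 x) => s; ring.
Qed.

(** A linear class suited to the second application of the Laplacian: the order s^(-m-2) is one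
    power of [s] below the source s^(-m-1), which outweighs any logarithm. *)
Definition small_laplacian (f : 'rV[R]_n -> R) := classC 2 f /\
  exists2 C, 0 <= C & forall x, `|laplacian f x| <= C * lpow (m + 2) 0 x.

Lemma small_laplacianD f g : small_laplacian f -> small_laplacian g ->
  small_laplacian (fun x => f x + g x).
Proof.
move=> [cf [C C0 Hf]] [cg [K K0 Hg]]; split; first exact: classCD.
exists (C + K); first exact: addr_ge0.
move=> x; rewrite (is_lap_laplacian (is_lapD (classC_lap x cf) (classC_lap x cg))).
by rewrite mulrDl (le_trans (ler_normD _ _))// lerD.
Qed.

Lemma small_laplacianZ k f : small_laplacian f -> small_laplacian (fun x => k * f x).
Proof.
move=> [cf [C C0 Hf]]; split; first exact: classCZ.
exists (`|k| * C); first exact: mulr_ge0.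
move=> x; rewrite (is_lap_laplacian (is_lapZ k (classC_lap x cf))).
by rewrite normrM -mulrA ler_wpM2l.
Qed.

Lemma norm_lincomb6 (k1 k2 k3 k4 k5 k6 x1 x2 x3 x4 x5 x6 B T : R) :
  0 <= x1 <= T -> 0 <= x2 <= T -> 0 <= x3 <= T -> 0 <= x4 <= T -> 0 <= x5 <= T ->
  0 <= x6 <= T -> 0 <= B ->
  `|k1 * x1 + k2 * x2 + k3 * x3 - B * (k4 * x4 + k5 * x5 + k6 * x6)| <=
  (`|k1| + `|k2| + `|k3| + B * (`|k4| + `|k5| + `|k6|)) * T.
Proof.
have N k y : 0 <= y <= T -> `|k * y| <= `|k| * T.
  by move=> /andP[y0 yT]; rewrite normrM (ger0_norm y0) ler_wpM2l.
have N3 l1 l2 l3 y1 y2 y3 : 0 <= y1 <= T -> 0 <= y2 <= T -> 0 <= y3 <= T ->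
    `|l1 * y1 + l2 * y2 + l3 * y3| <= (`|l1| + `|l2| + `|l3|) * T.
  move=> h1 h2 h3; rewrite 2!mulrDl; apply: (le_trans (ler_normD _ _)).
  by apply: lerD (N _ _ h3); apply: (le_trans (ler_normD _ _)); apply: lerD; exact: N.
move=> h1 h2 h3 h4 h5 h6 B0; rewrite mulrDl; apply: (le_trans (ler_normB _ _)).
apply: lerD; first exact: N3.
by rewrite normrM (ger0_norm B0) -[leRHS]mulrA ler_wpM2l// N3.
Qed.

Lemma small_lpow (a b : R) : m + 1 <= a -> 0 <= b -> small_laplacian (lpow a b).
Proof.
move=> ma b0; split; first exact: classC_lpow.
exists (`|4 * a * (a + 1) - 2 * n%:R * a| + `|4 * b * (2 * a + 1) - 2 * n%:R * b| +
  `|4 * b * (b + 1)| + 4 * A * (`|a * (a + 1)| + `|b * (2 * a + 1)| + `|b * (b + 1)|)).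
  by rewrite !addr_ge0// !mulr_ge0// ?addr_ge0// ltW// expR_gt0.
move=> x; rewrite laplacian_lpowE /lprof2 /lpow.
have As := bracket2_ge x; have s1 := bracket2_gt1 x.
move: (bracket2 x) As s1 => s As s1.
have T0 c d : 0 <= lprof c d s by rewrite ltW// lprof_gt0.
have le1 c d : m + 2 <= c -> 0 <= d -> lprof c d s <= lprof (m + 2) 0 s.
  by move=> *; exact: lprof_le.
have A0 : 0 <= 4 * A by rewrite mulr_ge0// ltW// expR_gt0.
by apply: norm_lincomb6; rewrite ?T0 ?le1//; lra.
Qed.

Lemma lpow_log_absorb (d : R) : 0 < d -> exists2 C, 0 < C & forall x,
  lpow (m + 2) 0 x <= C * lpow (m + 1) d x.
Proof.
(* From ln s <= d s^(1/d) raised to the power [d]: (ln s)^d <= d^d s. *)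
move=> d0; exists (d `^ d); first exact: powR_gt0.
move=> x; rewrite /lpow -(lprof_mul m _ (bracket2_gt0 x)).
have As := bracket2_ge x; have s1 := bracket2_gt1 x; move: (bracket2 x) As s1 => s As s1.
have s0 : 0 < s by lra.
have l0 : 0 < ln s by exact: ln_gt0.
have ld : 0 < ln s `^ d by rewrite powR_gt0.
have -> : lprof (m + 2) 0 s = s `^ (- (m + 2)) by rewrite /lprof oppr0 powRr0 mulr1.
have -> : d `^ d * (s * lprof (m + 2) d s) = s `^ (- (m + 2)) * (d `^ d * s / ln s `^ d).
  by rewrite /lprof (powRN (ln s)); ring.
rewrite ler_peMr ?powR_ge0//.
rewrite ler_pdivlMr// mul1r.
have d10 : 0 < d^-1 by rewrite invr_gt0.
apply: (@le_trans _ _ ((s `^ d^-1 / d^-1) `^ d)).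
  apply: powR_le_ge0 (ln_le_powR d10 s0) => //; exact: ltW.
rewrite powRM_gt0 ?invrK ?powR_gt0// -powRrM mulVf ?gt_eqF// powRr1 ?(ltW s0)//.
by rewrite mulrC.
Qed.

Variable delta : R.
Hypothesis delta0 : 0 < delta.

(* With this constant the [lpow (m + 2) _] part of the Laplacian is nonpositive. *)
Definition profile_coef : R :=
  2 + (delta * (2 * m + 1) + delta * (delta + 1)) / (m * (m + 1)).
(** s^(-m) is harmonic up to order s^(-m-2). Subtracting its product with (ln s)^(-delta) creates
    the positive source 4 m delta s^(-m-1) (ln s)^(-delta-1) in -Delta, while the decay rate of the
    fundamental solution is kept. *)
Definition profile x : R := profile_coef * lpow m 0 x + -1 * lpow m delta x.
Definition profile_laplacian x : R :=
  profile_coef * (- (4 * A * (m * (m + 1))) * lpow (m + 2) 0 x) +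
  -1 * (4 * m * delta * lpow (m + 1) (delta + 1) x +
   4 * delta * (delta + 1) * lpow (m + 1) (delta + 2) x +
   - (4 * A) * (m * (m + 1) * lpow (m + 2) delta x +
     delta * (2 * m + 1) * lpow (m + 2) (delta + 1) x +
     delta * (delta + 1) * lpow (m + 2) (delta + 2) x)).

Lemma half_dim_gt0 : 0 < m.
Proof. have : 3 <= n%:R :> R by rewrite ler_nat. lra. Qed.

Lemma profile_coef_ge : 2 <= profile_coef.
Proof.
have m0 := half_dim_gt0; have d0 := delta0.
by rewrite lerDl divr_ge0 ?addr_ge0 ?mulr_ge0//; lra.
Qed.

Lemma classC_profile k : classC k profile.
Proof. by apply: classCD; apply: classCZ; exact: classC_lpow. Qed.

Lemma laplacian_profile : laplacian profile = profile_laplacian.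
Proof.
apply/funext => x.
have H (a b : R) : is_lap (lpow a b) x (laplacian (lpow a b) x) by exact/classC_lap/classC_lpow.
rewrite (is_lap_laplacian (is_lapD (is_lapZ profile_coef (H m 0)) (is_lapZ (-1) (H m delta)))).
rewrite !laplacian_lpowE /lprof2 /profile_laplacian -/(lpow _ _ x).
rewrite -/(lpow (m + 2) (delta + 1) x) -/(lpow (m + 2) (delta + 2) x).
rewrite -/(lpow (m + 2) delta x) !mul0r !mulr0 !mul0r !addr0.
rewrite (_ : 4 * m * (m + 1) - 2 * n%:R * m = 0); last by field.
congr (_ * _ + _ * _); first by ring.
rewrite (_ : 4 * delta * (2 * m + 1) - 2 * n%:R * delta = 4 * m * delta); last by field.
ring.
Qed.

Lemma profile_superharmonic x :
  4 * m * delta * lpow (m + 1) (delta + 1) x <= - laplacian profile x.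
Proof.
rewrite laplacian_profile /profile_laplacian; have m0 := half_dim_gt0.
have As := bracket2_ge x; rewrite /lpow; move: (bracket2 x) As => s As.
have s1 : 1 < s by have := @expR1_ge2 R; lra.
have T0 : 0 < lprof (m + 2) 0 s by exact: lprof_gt0.
have le1 d : 0 <= d -> lprof (m + 2) d s <= lprof (m + 2) 0 s.
  by move=> d0; apply: lprof_le.
have := le1 _ (ltW delta0).
have dd := delta0.
have d1 : 0 <= delta + 1 by lra.
have d2 : 0 <= delta + 2 by lra.
have := le1 _ d1; have := le1 _ d2.
have : 0 <= 4 * delta * (delta + 1) * lprof (m + 1) (delta + 2) s.
  apply: mulr_ge0; last exact/ltW/lprof_gt0.
  by apply: mulr_ge0 => //; apply: mulr_ge0 => //; exact: ltW.
have mm : 0 < m * (m + 1) by rewrite mulr_gt0//; lra.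
have E : profile_coef * (m * (m + 1)) = 2 * (m * (m + 1)) + delta * (2 * m + 1) + delta * (delta + 1).
  by rewrite /profile_coef; field; rewrite !gt_eqF//; lra.
rewrite (_ : profile_coef * _ = - (4 * A) * (profile_coef * (m * (m + 1)) * lprof (m + 2) 0 s)); last by ring.
rewrite E; move: (lprof (m + 2) 0 s) (lprof (m + 2) delta s) (lprof (m + 2) (delta + 1) s)
  (lprof (m + 2) (delta + 2) s) (lprof (m + 1) (delta + 2) s) (lprof (m + 1) (delta + 1) s) T0
   => X0 X1 X2 X3 X4 X5 X00 X4p h3 h2 h1.
have k1 : 0 <= delta * (2 * m + 1) by rewrite mulr_ge0//; lra.
have k2 : 0 <= delta * (delta + 1) by rewrite mulr_ge0//; lra.
have G1 := ler_wpM2l (ltW mm) h1. have G2 := ler_wpM2l k1 h2. have G3 := ler_wpM2l k2 h3.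
have G0 := mulr_ge0 (ltW mm) (ltW X00).
have : 0 <= 4 * A * ((2 * (m * (m + 1)) + delta * (2 * m + 1) + delta * (delta + 1)) * X0
  - (m * (m + 1) * X1 + delta * (2 * m + 1) * X2 + delta * (delta + 1) * X3)).
  apply: mulr_ge0; first by apply: mulr_ge0 => //; exact/ltW/expR_gt0.
  move: (delta * (2 * m + 1)) (delta * (delta + 1)) (m * (m + 1)) G0 G1 G2 G3 => a b c; lra.
move: X4p; move: (delta * (2 * m + 1)) (delta * (delta + 1)) (m * (m + 1)) => a b c; lra.
Qed.

(** Each term of the Laplacian of the profile has exponent at least m + 1, so one more Laplacian
    gives order s^(-m-2), and this is absorbed into s^(-m-1) (ln s)^(-delta-1). *)
Lemma profile_bilaplacian : exists2 C, 0 < C & forall x,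
  - (C * lpow (m + 1) (delta + 1) x) <= bilaplacian profile x.
Proof.
have m0 := half_dim_gt0; have d0 := delta0.
have S : small_laplacian profile_laplacian.
  have S1 : small_laplacian (lpow (m + 2) 0) by apply: small_lpow; lra.
  have S2 : small_laplacian (lpow (m + 1) (delta + 1)) by apply: small_lpow; lra.
  have S3 : small_laplacian (lpow (m + 1) (delta + 2)) by apply: small_lpow; lra.
  have S4 : small_laplacian (lpow (m + 2) delta) by apply: small_lpow; lra.
  have S5 : small_laplacian (lpow (m + 2) (delta + 1)) by apply: small_lpow; lra.
  have S6 : small_laplacian (lpow (m + 2) (delta + 2)) by apply: small_lpow; lra.
  have Z := small_laplacianZ.
  exact: (small_laplacianD (Z _ _ (Z _ _ S1)) (Z _ _ (small_laplacianD (small_laplacianD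
    (Z _ _ S2) (Z _ _ S3)) (Z _ _ (small_laplacianD (small_laplacianD (Z _ _ S4) (Z _ _ S5))
    (Z _ _ S6)))))).
have [_ [C C0 HC]] := S.
have d1 : 0 < delta + 1 by lra.
have [K K0 HKl] := lpow_log_absorb d1.
exists (C * K + 1); first by rewrite ltr_wpDl// mulr_ge0// ltW.
move=> x; rewrite /bilaplacian laplacian_profile lerNl.
have T0 : 0 < lpow (m + 1) (delta + 1) x by apply: lprof_gt0; exact: bracket2_gt1.
apply: le_trans (ler_norm _) _; rewrite normrN; apply: (le_trans (HC x)).
apply: (@le_trans _ _ (C * K * lpow (m + 1) (delta + 1) x)).
  by rewrite -mulrA ler_wpM2l.
by rewrite ler_wpM2r ?(ltW T0)// lerDl.
Qed.

Lemma profile_screened : exists2 lam, 0 < lam & forall x,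
  lpow (m + 1) (delta + 1) x <= bilaplacian profile x - lam * laplacian profile x.
Proof.
have [C C0 HC] := profile_bilaplacian; have m0 := half_dim_gt0.
have k0 : 0 < 4 * m * delta by rewrite !mulr_gt0.
(* Against the source 4 m delta of -Delta, the part [C] compensates the bilaplacian and the 1 is
   what remains. *)
exists ((C + 1) / (4 * m * delta)); first by rewrite divr_gt0// addr_gt0.
move=> x; have H1 := HC x; have H2 := profile_superharmonic x.
have c0 : 0 <= (C + 1) / (4 * m * delta) by rewrite divr_ge0 ?(ltW k0)// addr_ge0// ltW.
have := ler_wpM2l c0 H2; rewrite mulrA divfK ?gt_eqF// mulrN.
move: H1; move: (bilaplacian profile x) (laplacian profile x) (lpow _ _ x) => X Y Z; lra.
Qed.

Lemma profile_bounds x : 0 < profile x <= profile_coef * bracket x `^ (- (n%:R - 2)).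
Proof.
rewrite /profile powR_bracket (_ : - (n%:R - 2) / 2 = - m); last by field.
have s1 := bracket2_gt1 x; have As := bracket2_ge x.
have E : lpow m 0 x = bracket2 x `^ (- m) by rewrite /lpow /lprof oppr0 powRr0 mulr1.
have T0 : 0 < lpow m 0 x by exact: lprof_gt0.
have Td : 0 < lpow m delta x by exact: lprof_gt0.
have le1 : lpow m delta x <= lpow m 0 x by apply: lprof_le => //; exact: ltW.
rewrite -E; have := ler_wpM2r (ltW T0) profile_coef_ge.
by move=> H; apply/andP; split; lra.
Qed.

End log_profile.

(** * Choice of the constants in the solution *)

Section existence.
Context {R : realType} {n : nat}.
Local Notation L r := (ln (1 + r)).
Local Notation D := (n%:R - 2 : R).

(* Strict exponent conditions for [alpha] are nonstrict ones for some
   [alpha' < alpha], with room for any power [beta'] of the logarithm. *)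
Lemma solution_exists (alpha beta p q alpha' beta' K : R) : (2 < n)%N -> 1 <= p -> 1 <= q ->
  0 <= alpha -> alpha < n%:R -> alpha - n%:R < beta -> beta' < - 2 -> 0 < K ->
  (forall r : R, 1 <= r -> kappa alpha beta r <= K * kappa alpha' beta' r) ->
  n%:R - alpha' <= D * p -> n%:R - alpha' <= D * q -> 2 * n%:R - alpha' <= D * (p + q) ->
  exists lam : R, 0 < lam /\ exists u : 'rV[R]_n -> R,
    nonneg_solution alpha beta p q lam u /\ nontrivial u.
Proof.
move=> n2 p1 q1 a0 an ab b2 K0 HK hp hq hpq.
have p0 : 0 <= p by exact: le_trans p1.
have q0 : 0 <= q by exact: le_trans q1.
have nR : 3 <= n%:R :> R by rewrite ler_nat.
pose g := Num.max alpha (alpha - beta).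
have g0 : 0 <= g by rewrite le_max a0.
(* Local integrability of the kernel, where beta > alpha - n enters. *)
have gn : g < n%:R by rewrite gt_max an/=; lra.
have HK1 (r : R) (z : 'rV[R]_n) : 1 <= r -> 0 < enorm z -> enorm z <= r ->
    Kab alpha beta z <= K * (enorm z / r) `^ (- g) * kappa alpha' beta' r.
  move=> r1 z0 zr; have r0 : 0 < r by exact: lt_le_trans r1.
  apply: (le_trans (Kab_upper alpha beta r0 z0 zr)); rewrite -/g [K * _]mulrC -mulrA.
  by rewrite ler_wpM2l ?powR_ge0// HK.
have HK0 (r : R) : 1 <= r -> Kab alpha beta (0 : 'rV[R]_n) <= K * kappa alpha' beta' r.
  by move=> r1; apply: le_trans (Kab_0_le _ _ _) (HK r r1); exact: lt_le_trans r1.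
have D0 : 0 <= D by lra.
have aa : n%:R <= D * p + alpha' by lra.
have [C C0 HC] := Kconv_decay p0 g0 gn (ltW b2) K0 HK1 HK0 D0 aa.
(* This makes delta + 1 = -(beta' + 1), so the source has the power of the logarithm found in the
   convolution bound. *)
pose delta := - 2 - beta'; have delta0 : 0 < delta by rewrite /delta; lra.
have [lam lam0 Hlam] := profile_screened n2 delta0.
pose M := @profile_coef R n delta.
have M2 : 2 <= M by exact: (profile_coef_ge n2 delta0).
have M0 : 0 < M by lra.
pose B := C * M `^ p * M `^ q * 2 `^ (- (beta' + 1)).
have B0 : 0 < B by rewrite !mulr_gt0 ?powR_gt0.
(* As k <= 1 and p, q >= 1, one has k^p k^q <= k^2, and k B <= 1; so the constant [B] collected in
   the nonlinear term is beaten by the linear factor [k]. *)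
pose k := (B + 1)^-1; have k0 : 0 < k by rewrite invr_gt0; lra.
have k1 : k <= 1 by rewrite invf_le1; lra.
pose u (x : 'rV[R]_n) := k * profile delta x.
have Pb x := profile_bounds n2 delta0 x.
have u0 x : 0 < u x by have /andP[h _] := Pb x; exact: mulr_gt0.
have uk x : u x <= (k * M) * bracket x `^ (- D).
  by have /andP[_ h] := Pb x; rewrite -mulrA ler_pM2l.
have cP j : classC j (@profile R n delta) by exact: classC_profile.
have cu : classC 4 u by exact: classCZ.
have kM0 : 0 <= k * M by rewrite mulr_ge0 ?ltW.
have Ku := HC u (k * M) kM0 (fun x => ltW (u0 x)) uk (classC_continuous cu).
have lapu x : laplacian u x = k * laplacian (profile delta) x.
  exact: (is_lap_laplacian (is_lapZ k (classC_lap x (cP 2)))).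
have blapu x : bilaplacian u x = k * bilaplacian (profile delta) x.
  rewrite /bilaplacian (_ : laplacian u = fun y => k * laplacian (profile delta) y).
    exact: (is_lap_laplacian (is_lapZ k (classC_lap x (classC_laplacian (cP 4))))).
  exact/funext.
exists lam; split=> //; exists u; split; last by exists 0; rewrite gt_eqF.
split=> // [x|x|x]; first exact: ltW.
  by apply: le_lt_trans (Ku x) _; rewrite ltry.
apply: (le_trans (lee_wpmul2r _ (Ku x))); first by rewrite lee_fin powR_ge0.
rewrite -EFinM lee_fin blapu lapu [lam * (k * _)]mulrCA -mulrBr.
apply: le_trans (ler_wpM2l (ltW k0) (Hlam x)).
have uq : u x `^ q <= (k * M) `^ q * bracket x `^ (- D * q).
  apply: (@le_trans _ _ ((k * M * bracket x `^ (- D)) `^ q)).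
    by apply: powR_le_ge0 (uk x) => //; exact: ltW.
  by rewrite powRM ?powR_ge0// -powRrM.
apply: (le_trans (ler_wpM2l _ uq)); first by rewrite !mulr_ge0 ?powR_ge0 ?(ltW C0).
have r1 := bracket_ge1 x; have r0 := bracket_gt0 x.
set e := Num.max _ _; set r := bracket x in r1 r0 *.
have Lr0 : 0 < L r by exact: ln_gt0_1D.
have rn : r `^ (e - alpha') * r `^ (- D * q) <= r `^ (- n%:R).
  rewrite -(powR_addE _ _ r0); apply: ler_powR => //.
  (* The two arguments of the maximum are the conditions on p + q and on q. *)
  have : e <= D * q + alpha' - n%:R by rewrite ge_max; apply/andP; split; lra.
  lra.
have s1 := bracket2_gt1 x; have ls0 : 0 < ln (bracket2 x) by exact: ln_gt0.
have Ll : ln (bracket2 x) / 2 <= L r.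
  have lr : ln r <= L r by rewrite ler_ln ?posrE ?addr_gt0// lerDr.
  have -> : ln (bracket2 x) = 2 * ln r by rewrite -sqr_bracket lnXn// mulr_natl.
  by clear -lr; lra.
have Lb : L r `^ (beta' + 1) <= 2 `^ (- (beta' + 1)) * ln (bracket2 x) `^ (beta' + 1).
  rewrite powRN mulrC -powR_divE//; apply: powR_le_le0 Ll; first by lra.
  by rewrite divr_gt0.
have -> : lpow (n%:R / 2 - 1 + 1) (delta + 1) x = r `^ (- n%:R) * ln (bracket2 x) `^ (beta' + 1).
  rewrite /lpow /lprof /r powR_bracket; congr (_ `^ _ * _ `^ _); first by field.
  by rewrite /delta; ring.
have kpq : k `^ p * k `^ q <= k / (B + 1).
  rewrite -/k; apply: ler_pM; rewrite ?powR_ge0//.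
    by apply: ge1r_powR => //; rewrite k0.
  by apply: ge1r_powR => //; rewrite k0.
rewrite !powRM_gt0//; set r1' := r `^ (e - alpha') in rn *; set r2' := r `^ (- D * q) in rn *.
rewrite (_ : C * _ * _ * _ = C * M `^ p * M `^ q * ((k `^ p * k `^ q) * ((r1' * r2') * L r `^ (beta' + 1))));
  last by ring.
have Hr : (r1' * r2') * L r `^ (beta' + 1) <=
   r `^ (- n%:R) * (2 `^ (- (beta' + 1)) * ln (bracket2 x) `^ (beta' + 1)).
  by apply: ler_pM => //; rewrite ?mulr_ge0 ?powR_ge0.
have Hk := ler_pM (mulr_ge0 (powR_ge0 k p) (powR_ge0 k q)) _ kpq Hr.
have CM0 : 0 <= C * M `^ p * M `^ q by rewrite !mulr_ge0 ?powR_ge0 ?ltW.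
apply: (le_trans (ler_wpM2l CM0 (Hk _))).
  by rewrite !mulr_ge0 ?powR_ge0.
set G := r `^ (- n%:R) * ln (bracket2 x) `^ (beta' + 1).
rewrite (_ : C * _ * _ * _ = k * (B / (B + 1)) * G); last first.
  by move: ((B + 1)^-1) => i1; rewrite /G /B; ring.
rewrite ler_wpM2r//; first by rewrite mulr_ge0 ?powR_ge0.
by rewrite ler_piMr ?(ltW k0)// ler_pdivrMr ?mul1r ?lerDl//; lra.
Qed.

End existence.

(** Beyond [r0] the power wins; on [1, r0] the logarithm lies between its endpoint values, and the
    sum of their powers serves both signs of [g]. *)
Lemma ln_powR_dominated (R : realType) (g e : R) : 0 < e ->
  exists2 K, 0 < K & forall r : R, 1 <= r -> ln (1 + r) `^ g <= K * r `^ e.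
Proof.
move=> e0; have [r0 r01 H] := ln_powR_small 1 g e0.
have l0 (r : R) : 1 <= r -> 0 < ln (1 + r) by move=> r1; apply: ln_gt0_1D; exact: lt_le_trans r1.
exists (1 + ln (1 + 1) `^ g + ln (1 + r0) `^ g); first by rewrite !addr_gt0 ?powR_gt0 ?l0.
move=> r r1; have re : 1 <= r `^ e by rewrite -[leLHS](powRr0 r); apply: ler_powR => //; exact: ltW.
have P1 := powR_ge0 (ln (1 + 1 : R)) g; have P2 := powR_ge0 (ln (1 + r0)) g.
have [rr|/ltW rr] := leP r0 r.
  have := H r rr; rewrite mul1r => /le_trans; apply.
  by rewrite ler_peMl ?powR_ge0//; lra.
apply: (@le_trans _ _ (1 + ln (1 + 1) `^ g + ln (1 + r0) `^ g)); last by rewrite ler_peMr//; lra.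
have lr0 : ln (1 + r) <= ln (1 + r0) by rewrite ler_ln ?posrE ?lerD2l//; lra.
have lr1 : ln (1 + 1) <= ln (1 + r) by rewrite ler_ln ?posrE ?lerD2l//; lra.
have [g0|g0] := leP 0 g.
  by have := powR_le_ge0 g0 (ltW (l0 r r1)) lr0; lra.
by have := powR_le_le0 (ltW g0) (l0 1 (lexx 1)) lr1; lra.
Qed.

Theorem corollary1p5 (R : realType) (N : nat) (p q alpha beta : R)
    (hN : (3 <= N)%N) (hp : 1 <= p) (hq : 1 <= q)
    (halpha0 : 0 <= alpha) (halphaN : alpha < N%:R)
    (hbeta : alpha - N%:R < beta) :
  (beta < - 2 ->
    ((exists lambda : R, 0 < lambda /\
        exists u : 'rV[R]_N -> R,
          nonneg_solution alpha beta p q lambda u /\ nontrivial u) <->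
     [/\ (N%:R - alpha) / (N%:R - 2) <= p,
         (N%:R - alpha) / (N%:R - 2) <= q &
         (2 * N%:R - alpha) / (N%:R - 2) <= p + q])) /\
  (- 1 + 1 / q < beta ->
    ((exists lambda : R, 0 < lambda /\
        exists u : 'rV[R]_N -> R,
          nonneg_solution alpha beta p q lambda u /\ nontrivial u) <->
     [/\ (N%:R - alpha) / (N%:R - 2) < p,
         (N%:R - alpha) / (N%:R - 2) < q &
         (2 * N%:R - alpha) / (N%:R - 2) < p + q])).
Proof.
have N3 : 3 <= N%:R :> R by rewrite ler_nat.
have D0 : 0 < N%:R - 2 :> R by lra.
rewrite !ler_pdivrMr// !ltr_pdivrMr// ![_ * (N%:R - 2)]mulrC.
split=> b; split.
- move=> [lam [lam0 [u [usol unt]]]].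
  by have [] := solution_exponents hN hp hq halpha0 halphaN lam0 usol unt.
- move=> [h1 h2 h3]; apply: (@solution_exists R N alpha beta p q alpha beta 1) => // r _.
  by rewrite mul1r.
- move=> [lam [lam0 [u [usol unt]]]].
  have [_] := solution_exponents hN hp hq halpha0 halphaN lam0 usol unt; exact.
move=> [h1 h2 h3].
(* [e] is the least slack in the three strict inequalities, so lowering alpha by [e] keeps them as
   nonstrict ones. *)
pose e := Num.min ((N%:R - 2) * p - (N%:R - alpha))
  (Num.min ((N%:R - 2) * q - (N%:R - alpha)) ((N%:R - 2) * (p + q) - (2 * N%:R - alpha))).
have e0 : 0 < e by rewrite !lt_min !subr_gt0 h1 h2.
have e1 : e <= (N%:R - 2) * p - (N%:R - alpha) by rewrite ge_min lexx.
have e2 : e <= (N%:R - 2) * q - (N%:R - alpha) by rewrite !ge_min lexx orbT.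
have e3 : e <= (N%:R - 2) * (p + q) - (2 * N%:R - alpha) by rewrite !ge_min lexx !orbT.
(* The power beta of the logarithm is split as (beta + 3) - 3: the gain r^e from lowering alpha
   absorbs the first part, and -3 is a convenient exponent below -2. *)
have [K K0 HK] := ln_powR_dominated (beta + 3) e0.
have b3 : - 3 < - 2 :> R by lra.
apply: (@solution_exists R N alpha beta p q (alpha - e) (- 3) K) => // [r r1|||]; try lra.
have r0 : 0 < r by exact: lt_le_trans r1.
have L0 := ln_gt0_1D r0.
rewrite /kappa (_ : - (alpha - e) = - alpha + e); last by ring.
rewrite (powR_addE _ _ r0) (_ : beta = beta + 3 + (- 3)); last by ring.
rewrite (powR_addE _ _ L0) mulrCA [leRHS](_ : _ =
  r `^ (- alpha) * ((K * r `^ e) * ln (1 + r) `^ (- 3))); last by ring.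
by rewrite mulrCA ler_pM2l ?powR_gt0// ler_pM2r ?powR_gt0// HK.
Qed.
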